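(* Directed Symmetric Multicut parameterized by the solution size $k$ is W[1]-hard.
   Context: Directed Symmetric Multicut: given a directed graph $D$, a collection $\mathcal{P}$ of (unordered) pairs of vertices of $D$ (cut requests), and an integer $k$ (the parameter), decide whether there exists a set $X$ of at most $k$ arcs of $D$ such that for no pair $\{s,t\}\in\mathcal{P}$ are $s$ and $t$ strongly connected in $D-X$ (i.e. there is no pair with both a directed $s$–$t$ path and a directed $t$–$s$ path in $D-X$). *)

(* Defs.v *)
From HB Require Import structures.
From mathcomp Require Import all_boot.
Set Implicit Arguments.
Unset Strict Implicit.
Unset Printing Implicit Defensive.

(* Deterministic multi-tape Turing machines over the input alphabet bool.
   A cell holds [None] (blank), an input bit, or an auxiliary symbol. *)

Inductive move := MoveL | MoveN | MoveR.

Record tm := TM {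
  tm_tapes : nat; (* the machine has tm_tapes.+1 tapes *)
  tm_aux : finType;
  tm_state : finType;
  tm_start : tm_state;
  tm_halt : pred tm_state;
  tm_trans : tm_state -> {ffun 'I_tm_tapes.+1 -> option (bool + tm_aux)} ->
             tm_state * {ffun 'I_tm_tapes.+1 -> option (bool + tm_aux) * move}
}.

Section Run.
Variable M : tm.

Definition symbol : Type := option (bool + tm_aux M).

(* (l, r): l is what lies left of the head, nearest cell first; r starts with
   the scanned cell.  All cells beyond l and r are blank. *)
Definition tape : Type := (seq symbol * seq symbol)%type.

Definition scan (tp : tape) : symbol := head None tp.2.

Definition act (tp : tape) (a : symbol * move) : tape :=
  let: (l, r) := tp in
  match a.2 with
  | MoveL => (behead l, head None l :: a.1 :: behead r)
  | MoveN => (l, a.1 :: behead r)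
  | MoveR => (a.1 :: l, behead r)
  end.

Definition config : Type :=
  (tm_state M * {ffun 'I_(tm_tapes M).+1 -> tape})%type.

Definition step (c : config) : config :=
  if tm_halt c.1 then c else
  let: (q, a) := tm_trans c.1 [ffun i => scan (c.2 i)] in
  (q, [ffun i => act (c.2 i) (a i)]).

Definition init (w : seq bool) : config :=
  (tm_start M,
   [ffun i => if i == ord0 then ([::], [seq Some (inl b) | b <- w])
              else ([::], [::])]).

Fixpoint leading_bits (s : seq symbol) : seq bool :=
  if s is Some (inl b) :: s' then b :: leading_bits s' else [::].

(* The output is the longest word of bits on tape 0 starting at the head. *)
Definition output (c : config) : seq bool := leading_bits (c.2 ord0).2.

(* [step] fixes halted configurations, so this says that M, started on w,
   halts after at most T steps with output w'. *)
Definition outputs_within (w : seq bool) (T : nat) (w' : seq bool) : Prop :=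
  let c := iter T step (init w) in tm_halt c.1 /\ output c = w'.

End Run.

Definition computable (f : nat -> nat) : Prop :=
  exists M : tm, forall k, exists T,
    outputs_within M (nseq k true) T (nseq (f k) true).

(* A parameterized problem is a subset of {0,1}^* x N; an instance (x, k) is
   presented to a machine as the word 1^k 0 x. *)
Definition pproblem : Type := seq bool -> nat -> Prop.

Definition enc_instance (x : seq bool) (k : nat) : seq bool :=
  nseq k true ++ false :: x.

Definition fpt_reduces (L L' : pproblem) : Prop :=
  exists (M : tm) (f g : nat -> nat) (c : nat),
    [/\ computable f, computable g &
    forall x k, exists x' k',
      [/\ outputs_within M (enc_instance x k)
            (f k * size (enc_instance x k) ^ c) (enc_instance x' k'),
          L x k <-> L' x' k' &
          k' <= g k]].

(* Boolean circuits: nodes of indegree 0 are inputs, nodes of indegree 1 are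
   negations, and [is_and] tells and-nodes from or-nodes among the nodes of
   indegree at least 2 (elsewhere it is irrelevant). *)
Record circuit (m : nat) := Circuit {
  wire : rel 'I_m;
  is_and : pred 'I_m;
  out : 'I_m
}.

Section Circuit.
Variables (m : nat) (C : circuit m).

Definition fanin (i : 'I_m) : {set 'I_m} := [set j | wire C j i].
Definition inputs : {set 'I_m} := [set i | #|fanin i| == 0].
Definition large (i : 'I_m) : bool := 2 < #|fanin i|.

Definition wf_circuit : Prop :=
  (forall i j, wire C i j -> ~~ connect (wire C) j i) /\
  (forall j, ~~ wire C (out C) j).

Definition depth_le (d : nat) : Prop :=
  forall i p, i \in inputs -> path (wire C) i p -> last i p = out C ->
    size p <= d.

Definition weft_le (t : nat) : Prop :=
  forall i p, i \in inputs -> path (wire C) i p -> last i p = out C ->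
    count large (i :: p) <= t.

(* v assigns a value to every node; by acyclicity a gate-respecting v is
   determined by its restriction to the inputs, which is arbitrary. *)
Definition respects_gates (v : 'I_m -> bool) : Prop :=
  forall i, match #|fanin i| with
    | 0 => True
    | 1 => v i = [forall j in fanin i, ~~ v j]
    | _ => v i = if is_and C i then [forall j in fanin i, v j]
                 else [exists j in fanin i, v j]
    end.

Definition weighted_sat (k : nat) : Prop :=
  exists v, [/\ respects_gates v, v (out C) & #|[set i in inputs | v i]| = k].

Definition enc_circuit : seq bool :=
  nseq m true ++ false ::
  [seq is_and C i | i <- enum 'I_m] ++
  [seq i == out C | i <- enum 'I_m] ++
  [seq wire C i j | i <- enum 'I_m, j <- enum 'I_m].

End Circuit.

(* Weighted Circuit Satisfiability on circuits of weft <= t and depth <= d. *)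
Definition WCS (t d : nat) : pproblem := fun x k =>
  exists (m : nat) (C : circuit m),
    [/\ x = enc_circuit C, wf_circuit C, weft_le C t, depth_le C d &
        weighted_sat C k].

Definition in_W (t : nat) (L : pproblem) : Prop :=
  exists d, 0 < d /\ fpt_reduces L (WCS t d).

Definition W_hard (t : nat) (L : pproblem) : Prop :=
  forall L', in_W t L' -> fpt_reduces L' L.

Section SymmetricMulticut.
Variable V : finType.

Definition strongly_connected (A : {set V * V}) (s t : V) : bool :=
  let arc := [rel u v | (u, v) \in A] in connect arc s t && connect arc t s.

Definition symmetric_multicut (A : {set V * V}) (P : {set {set V}})
    (X : {set V * V}) : Prop :=
  X \subset A /\
  forall s t, [set s; t] \in P -> ~~ strongly_connected (A :\: X) s t.

End SymmetricMulticut.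

Definition enc_requests (n : nat) (A : {set 'I_n * 'I_n})
    (P : {set {set 'I_n}}) : seq bool :=
  nseq n true ++ false ::
  [seq (i, j) \in A | i <- enum 'I_n, j <- enum 'I_n] ++
  [seq [set i; j] \in P | i <- enum 'I_n, j <- enum 'I_n].

Definition directed_symmetric_multicut : pproblem := fun x k =>
  exists (n : nat) (A : {set 'I_n * 'I_n}) (P : {set {set 'I_n}}),
    [/\ forall v, (v, v) \notin A,
        forall p, p \in P -> #|p| = 2,
        x = enc_requests A P &
        exists X, symmetric_multicut A P X /\ #|X| <= k].

(* Main.v *)
From mathcomp Require Import all_boot zify.
Require Import Defs.
Set Implicit Arguments.
Unset Strict Implicit.
Unset Printing Implicit Defensive.

(* Weighted satisfiability of circuits of weft 1 and depth at most d reduces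
   directly to Directed Symmetric Multicut.

   Local views.  The k true inputs are guessed in increasing order: slot i holds
   the pair of the i-th and the (i+1)-st true input, so a few slots determine the
   truth or falsity of a few inputs.  Above the large gates there are boundedly
   many gates; for each large gate among them whose value is due to a single
   child, that child is guessed too.  The circuit is satisfied iff, for all
   bounded tuples of slots, a three-valued evaluation refutes neither the output
   nor a guess.  This is a bipartite binary constraint satisfaction problem: the
   rows are the slots and guesses, the columns are the tuples of slots, and a
   column agrees with the rows it mentions.

   Gadget.  There are three hubs S, M, T, pairwise to be kept apart.  A row value
   is the position of the cut on a path leading back from T to M, a column value
   the same for M and S; each variable also has a reversed copy of its path.
   After the cut every path vertex is strongly connected to one of two hubs.  To
   forbid the value a of a row together with the value b of a column, take a
   requested pair {s, t} where s and t have one arc in, from a column path, and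
   one arc out, to a row path: both are strongly connected to M exactly when the
   row is cut at a and the column at b.  Acyclicity of the circuit is itself a set
   of requests: the ends of a wire must not be strongly connected.

   Machines.  Everything above is expressible by terms built from +, truncated
   subtraction, bounded sums and the bits of the input.  Such terms have
   polynomially bounded values, hence a machine with unary counters evaluates
   them in polynomial time. *)

(** * Multi-tape programs *)

(** The target parameter is [4 * N] with N = (k+1)^q + k + 1 + Q: two sides, two copies, and one cut
    for each of N variables. It may depend on k and the depth bound d alone; the number of nodes
    enters through the path length D only. Weft 1 makes q and Q constants: under a large gate that
    can reach the output all gates have fan-in at most two, so each of its children depends on at
    most 2^d inputs, and at most 2^(d+1) gates can be reached backwards from the output through
    small gates.

    A cut position only yields one-sided tests: a path vertex is on the M side iff the position is
    at most, or at least, some number. The reversed copies supply the opposite inequalities, and two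
    tests for the row and two for the column make equalities.

    Terms have no recursion and can examine walks of bounded length only. That suffices for depth
    and weft, which concern walks to the output, but a cycle elsewhere may have any length; this is
    why reachability is left to the multicut instance. Words that encode no circuit must be mapped
    too: a validity bit then forbids every pair of values. *)

Section Programs.
Variables (M : tm) (N : nat).

Definition tapes : Type := {ffun 'I_N.+1 -> tape M}.
Definition scans : Type := {ffun 'I_N.+1 -> symbol M}.
Definition actions : Type := {ffun 'I_N.+1 -> symbol M * move}.

Definition scan_all (T : tapes) : scans := [ffun i => scan (T i)].
Definition act_all (T : tapes) (a : actions) : tapes :=
  [ffun i => act (T i) (a i)].

Record prog := Prog {
  pstate : finType;
  pstart : pstate;
  ptrans : pstate -> scans -> option pstate * actions
}.

(** The exit transition still performs its action and costs a step, so an atom takes time 1. *)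
Inductive runs (P : prog) : pstate P -> tapes -> nat -> tapes -> Prop :=
| runs_exit q T a : ptrans q (scan_all T) = (None, a) ->
    runs q T 1 (act_all T a)
| runs_step q T q' a n T' : ptrans q (scan_all T) = (Some q', a) ->
    runs q' (act_all T a) n T' -> runs q T n.+1 T'.

Definition idle (s : scans) : actions := [ffun i => (s i, MoveN)].

Definition on (i : 'I_N.+1) (f : scans -> symbol M * move) (s : scans) : actions :=
  [ffun j => if j == i then f s else (s j, MoveN)].

Definition patom (f : scans -> actions) : prog :=
  @Prog unit tt (fun _ s => (None, f s)).

Definition pseq (P Q : prog) : prog :=
  @Prog (pstate P + pstate Q)%type (inl (pstart P)) (fun q s =>
    match q with
    | inl p => let: (o, a) := ptrans p s in
        (Some (if o is Some p' then inl p' else inr (pstart Q)), a)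
    | inr p => let: (o, a) := ptrans p s in (omap inr o, a)
    end).

Definition pwhile (b : scans -> bool) (P : prog) : prog :=
  @Prog (option (pstate P)) None (fun q s =>
    match q with
    | None => (if b s then Some (Some (pstart P)) else None, idle s)
    | Some p => let: (o, a) := ptrans p s in (Some o, a)
    end).

Definition execs (P : prog) (T : tapes) (n : nat) (T' : tapes) : Prop :=
  exists2 n', n' <= n & runs (pstart P) T n' T'.

Lemma execs_atom f T : execs (patom f) T 1 (act_all T (f (scan_all T))).
Proof. by exists 1 => //; apply: runs_exit. Qed.

Lemma runs_seqr P Q q T n T' :
  @runs Q q T n T' -> @runs (pseq P Q) (inr q) T n T'.
Proof.
elim=> {q T n T'} [q T a e | q T q' a n T' e _ IH].
  by apply: runs_exit; rewrite /= e.
by apply: (@runs_step (pseq P Q) (inr q) T (inr q') a) => //; rewrite /= e.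
Qed.

Lemma execs_seq P Q T n1 T1 n2 T2 :
  execs P T n1 T1 -> execs Q T1 n2 T2 -> execs (pseq P Q) T (n1 + n2) T2.
Proof.
move=> [k1 le1 r1] [k2 le2 r2]; exists (k1 + k2); first by rewrite leq_add.
rewrite /=; elim: r1 r2 => {T k1 T1 le1} [q T a e | q T q' a k1 T1 e _ IH] r2.
  apply: (@runs_step (pseq P Q) (inl q) T (inr (pstart Q)) a); rewrite /= ?e //.
  exact: runs_seqr.
by apply: (@runs_step (pseq P Q) (inl q) T (inl q') a); rewrite /= ?e //; apply: IH.
Qed.

Lemma execs_while_end (b : scans -> bool) P T : ~~ b (scan_all T) ->
  execs (pwhile b P) T 1 (act_all T (idle (scan_all T))).
Proof.
by move=> nb; exists 1 => //; apply: runs_exit; rewrite /= (negbTE nb).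
Qed.

Lemma execs_while_step (b : scans -> bool) P T n1 T1 n2 T2 : b (scan_all T) ->
  execs P (act_all T (idle (scan_all T))) n1 T1 ->
  execs (pwhile b P) T1 n2 T2 -> execs (pwhile b P) T (n1 + n2).+1 T2.
Proof.
move=> hb [k1 le1 r1] [k2 le2 r2]; exists (k1 + k2).+1.
  by rewrite ltnS leq_add.
apply: (@runs_step (pwhile b P) None T (Some (pstart P)) (idle (scan_all T))).
  by rewrite /= hb.
elim: r1 r2 => {T k1 T1 le1 hb} [q T a e | q T q' a k1 T1 e _ IH] r2.
  by apply: (@runs_step (pwhile b P) (Some q) T None a); rewrite /= ?e.
by apply: (@runs_step (pwhile b P) (Some q) T (Some q') a); rewrite /= ?e //; apply: IH.
Qed.

Definition is_one (x : symbol M) : bool :=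
  if x is Some (inl true) then true else false.
Definition is_bit (x : symbol M) : bool :=
  if x is Some (inl _) then true else false.
Definition sbit (b : bool) : symbol M := Some (inl b).

(* The cells to the right of the head are left unspecified beyond the first
   blank, so popping needs no cleaning. *)
Definition holds (tp : tape M) (s : seq bool) : Prop :=
  (forall i, i < size s -> nth None tp.2 i = sbit (nth false s i)) /\
  nth None tp.2 (size s) = None.

(** Rewriting the scanned symbol may turn an empty list into one explicit blank. [nth] with default
    [None] does not see the difference, which is why tape contents are described through [nth]. *)
Lemma nth_idle (r : seq (symbol M)) i :
  nth None (head None r :: behead r) i = nth None r i.
Proof. by case: r i => [|x r] [|i] //=; rewrite nth_nil. Qed.

Lemma holds_idle tp s : holds tp s -> holds (act tp (scan tp, MoveN)) s.
Proof.
by case: tp => l r [h1 h2]; split=> [i hi|]; rewrite /= nth_idle //; apply: h1.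
Qed.

Lemma holds_pop tp b s x : holds tp (b :: s) -> holds (act tp (x, MoveR)) s.
Proof.
case: tp => l [|y r] /= [h1 h2]; last by split=> // i; apply: (h1 i.+1).
by have := h1 0 isT.
Qed.

Lemma holds_push tp b s : holds tp s ->
  holds (act (act tp (scan tp, MoveL)) (sbit b, MoveN)) (b :: s).
Proof.
by case: tp => l r [h1 h2]; split=> [[|i] hi|] //=; rewrite nth_idle //; apply: h1.
Qed.

Lemma holds_scan tp b s : holds tp (b :: s) -> scan tp = sbit b.
Proof. by case: tp => l r [h _]; rewrite /scan /= -nth0 (h 0). Qed.

Lemma holds_scan0 tp : holds tp [::] -> scan tp = None.
Proof. by case: tp => l r [_ h]; rewrite /scan /= -nth0. Qed.

(** Behind the word only a non-bit is required, and to its left nothing, because a simulated machine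
    may leave arbitrary symbols there. *)
Definition word_at (tp : tape M) (w : seq bool) (y : nat) : Prop :=
  [/\ y <= size w,
      forall i, i < y -> nth None tp.1 i = sbit (nth false w (y.-1 - i)),
      forall i, y + i < size w -> nth None tp.2 i = sbit (nth false w (y + i)) &
      ~~ is_bit (nth None tp.2 (size w - y))].

Lemma word_idle tp w y : word_at tp w y -> word_at (act tp (scan tp, MoveN)) w y.
Proof.
case: tp => l r [h1 h2 h3 h4]; split=> //= [i hi|]; rewrite nth_idle //.
exact: h3.
Qed.

Lemma word_right tp w y : word_at tp w y -> y < size w ->
  word_at (act tp (scan tp, MoveR)) w y.+1.
Proof.
case: tp => l r [h1 h2 h3 h4] hy; split=> //= [[|i] hi|i hi|] /=.
- by rewrite /scan /= -nth0 h3 ?addn0 // subn0.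
- by rewrite h2 //; congr (sbit (nth _ _ _)); lia.
- by rewrite nth_behead h3 -addSnnS.
- by rewrite nth_behead; move: h4; rewrite -subnSK.
Qed.

Lemma word_left tp w y : word_at tp w y.+1 ->
  word_at (act tp (scan tp, MoveL)) w y.
Proof.
case: tp => l r [h1 h2 h3 h4]; split=> [|i hi|[|i] hi|] /=.
- exact: ltnW.
- by rewrite nth_behead h2 //=; congr (sbit (nth _ _ _)); lia.
- by rewrite -nth0 h2 // addn0 subn0.
- by rewrite nth_idle h3 addSnnS.
- by rewrite -(subnSK h1) /= nth_idle.
Qed.

Lemma word_scan_bit tp w y : word_at tp w y -> is_bit (scan tp) = (y < size w).
Proof.
case: tp => l r [h1 h2 h3 h4]; rewrite /scan /= -nth0.
case: ltnP => hy; first by rewrite h3 ?addn0.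
by apply/negbTE; move: h4; rewrite (_ : size w - y = 0) //; lia.
Qed.

Lemma word_scan_one tp w y : word_at tp w y -> is_one (scan tp) = nth false w y.
Proof.
move=> h; have hb := word_scan_bit h; case: tp h hb => l r [h1 h2 h3 h4].
rewrite /scan /= -nth0; case: ltnP => hy.
  by rewrite h3 ?addn0 //; case: (nth false w y).
by rewrite (nth_default _ hy); case: (nth None r 0) => [[[]|]|].
Qed.

End Programs.

(** * Unary counters on the tapes of a program *)

Definition upd (r : nat -> nat) (i v : nat) : nat -> nat :=
  fun j => if j == i then v else r j.

Section Registers.
Variables (M : tm) (K : nat).

Local Notation N := ((tm_tapes M).+1 + K).
Local Notation prog := (prog M N).
Local Notation on := (@on M N).

(** The tapes [0] to [tm_tapes M] belong to the simulated machine; then come the output tape and the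
    [K] registers. *)
Definition out_tape : 'I_N.+1 := inord (tm_tapes M).+1.
Definition reg (i : nat) : 'I_N.+1 := inord ((tm_tapes M).+2 + i).

Lemma out_tapeE : out_tape = (tm_tapes M).+1 :> nat.
Proof. by rewrite inordK // ltnS leq_addr. Qed.

Lemma regE i : i < K -> reg i = (tm_tapes M).+2 + i :> nat.
Proof. by move=> hi; rewrite inordK //; lia. Qed.

Lemma reg_neq0 i : i < K -> (reg i == ord0) = false.
Proof. by move=> hi; apply/eqP => /(congr1 val) /=; rewrite regE. Qed.

Lemma reg_neq_out i : i < K -> (reg i == out_tape) = false.
Proof. by move=> hi; apply/eqP => /(congr1 val) /=; rewrite regE // out_tapeE; lia. Qed.

Lemma reg_eq i j : i < K -> j < K -> (reg i == reg j) = (i == j).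
Proof. by move=> hi hj; rewrite -val_eqE /= !regE // eqn_add2l. Qed.

Lemma out_neq0 : (out_tape == ord0) = false.
Proof. by apply/eqP => /(congr1 val) /=; rewrite out_tapeE. Qed.

(* Contents of the registers, head position on tape 0, contents of the output
   tape. *)
Definition rstate : Type := ((nat -> nat) * nat * seq bool)%type.

Definition rep (w : seq bool) (T : tapes M N) (s : rstate) : Prop :=
  let: (r, y, o) := s in
  [/\ word_at (T ord0) w y,
      forall i, i < K -> holds (T (reg i)) (nseq (r i) true) &
      holds (T out_tape) o].

Lemma on_same i f (T : tapes M N) :
  act_all T (on i f (scan_all T)) i = act (T i) (f (scan_all T)).
Proof. by rewrite !ffunE eqxx. Qed.

Lemma on_other i f (T : tapes M N) j : (j == i) = false ->
  act_all T (on i f (scan_all T)) j = act (T j) (scan (T j), MoveN).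
Proof. by move=> ne; rewrite !ffunE ne. Qed.

Lemma rep_idle w T s : rep w T s -> rep w (act_all T (idle (scan_all T))) s.
Proof.
case: s => [[r y] o] [h1 h2 h3]; split=> [|i hi|]; rewrite !ffunE.
- exact: word_idle.
- by apply: holds_idle; apply: h2.
- exact: holds_idle.
Qed.

Definition spec w (P : prog) (s : rstate) (n : nat) (s' : rstate) : Prop :=
  forall T, rep w T s -> exists2 T', execs P T n T' & rep w T' s'.

(** Register contents are functions compared pointwise; this lemma and its counterpart for the
    initial state stand in for function extensionality. *)
Lemma spec_ext w P r y o n r1 y1 o1 r2 :
  spec w P (r, y, o) n (r1, y1, o1) -> r1 =1 r2 ->
  spec w P (r, y, o) n (r2, y1, o1).
Proof.
move=> h e T /h [T' hT' [h1 h2 h3]]; exists T' => //; split=> // i hi.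
by rewrite -e; apply: h2.
Qed.

Lemma spec_extl w P r y o n r1 y1 o1 r2 :
  spec w P (r, y, o) n (r1, y1, o1) -> r =1 r2 ->
  spec w P (r2, y, o) n (r1, y1, o1).
Proof.
move=> h e T [h1 h2 h3]; apply: h; split=> // i hi.
by rewrite e; apply: h2.
Qed.

Lemma spec_le w P s n m s' : n <= m -> spec w P s n s' -> spec w P s m s'.
Proof.
move=> le h T /h [T' [k hk hr] h2]; exists T' => //; exists k => //.
exact: leq_trans le.
Qed.

Lemma spec_seq w P Q s n1 s1 n2 s2 :
  spec w P s n1 s1 -> spec w Q s1 n2 s2 -> spec w (pseq P Q) s (n1 + n2) s2.
Proof.
move=> h1 h2 T /h1 [T1 e1 /h2 [T2 e2 r2]]; exists T2 => //.
exact: execs_seq e1 e2.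
Qed.

Lemma spec_while w (b : scans M N -> bool) (P : prog) (s : nat -> rstate) v n :
  (forall j T, j <= v -> rep w T (s j) -> b (scan_all T) = (j < v)) ->
  (forall j, j < v -> spec w P (s j) n (s j.+1)) ->
  spec w (pwhile b P) (s 0) (v * n.+1).+1 (s v).
Proof.
elim: v s => [|v IH] s hb hP T hT.
  exists (act_all T (idle (scan_all T))); last exact: rep_idle.
  by rewrite mul0n; apply: execs_while_end; rewrite (hb 0).
have [T1 e1 r1] := hP 0 isT _ (rep_idle hT).
have [|j hj|T2 e2 r2] := IH (fun j => s j.+1) _ _ T1 r1.
- by move=> j T' hj; apply: (hb j.+1).
- exact: (hP j.+1).
exists T2 => //.
have := execs_while_step (b := b) (P := P) (T := T) _ e1 e2.
rewrite (hb 0) // => /(_ isT) [k hk hr]; exists k => //.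
by apply: leq_trans hk _; lia.
Qed.

(** A counter is a stack that grows to the left; a decrement leaves the popped cell behind the head,
    where [holds] does not look. *)
Definition inc i : prog :=
  pseq (patom (on (reg i) (fun s => (s (reg i), MoveL))))
       (patom (on (reg i) (fun s => (sbit M true, MoveN)))).

Definition dec i : prog := patom (on (reg i) (fun s => (s (reg i), MoveR))).

Definition nonzero i (s : scans M N) : bool := is_one (s (reg i)).

Definition right : prog := patom (on ord0 (fun s => (s ord0, MoveR))).
Definition left : prog := patom (on ord0 (fun s => (s ord0, MoveL))).

Definition at_bit (s : scans M N) : bool := is_bit (s ord0).

Definition inc_bit i : prog :=
  pseq (patom (on (reg i) (fun s =>
          (s (reg i), if is_one (s ord0) then MoveL else MoveN))))
       (patom (on (reg i) (fun s =>
          (if is_one (s ord0) then sbit M true else s (reg i), MoveN)))).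

Definition put i : prog :=
  pseq (patom (on out_tape (fun s => (s out_tape, MoveL))))
       (patom (on out_tape (fun s => (sbit M (nonzero i s), MoveN)))).

Lemma nonzeroE w T r y o i : i < K -> rep w T (r, y, o) ->
  nonzero i (scan_all T) = (0 < r i).
Proof.
move=> hi [_ h _]; have := h i hi; rewrite /nonzero ffunE.
case: (r i) => [|n] h'; first by rewrite (holds_scan0 h').
by rewrite (holds_scan h').
Qed.

Lemma at_bitE w T r y o : rep w T (r, y, o) -> at_bit (scan_all T) = (y < size w).
Proof. by move=> [h _ _]; rewrite /at_bit ffunE (word_scan_bit h). Qed.

Lemma spec_inc w i r y o : i < K ->
  spec w (inc i) (r, y, o) 2 (upd r i (r i).+1, y, o).
Proof.
move=> hi T [h1 h2 h3]; eexists.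
  by apply: (execs_seq (n1 := 1) (n2 := 1)); apply: execs_atom.
split=> [|j hj|].
- by rewrite 2?on_other // 1?eq_sym ?reg_neq0 //; do 2 apply: word_idle.
- rewrite /upd; case: (eqVneq j i) => [-> | ne].
    by rewrite 2!on_same ffunE; apply: holds_push; apply: h2.
  by rewrite 2?on_other ?reg_eq ?(negbTE ne) //; do 2 apply: holds_idle; apply: h2.
- by rewrite 2?on_other 1?eq_sym ?reg_neq_out //; do 2 apply: holds_idle.
Qed.

Lemma spec_dec w i r y o : i < K -> 0 < r i ->
  spec w (dec i) (r, y, o) 1 (upd r i (r i).-1, y, o).
Proof.
move=> hi h0 T [h1 h2 h3]; eexists; first exact: execs_atom.
split=> [|j hj|].
- by rewrite on_other 1?eq_sym ?reg_neq0 //; apply: word_idle.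
- rewrite /upd; case: (eqVneq j i) => [-> | ne].
    rewrite on_same; have := h2 i hi; case: (r i) h0 => //= n _.
    exact: holds_pop.
  by rewrite on_other ?reg_eq ?(negbTE ne) //; apply: holds_idle; apply: h2.
- by rewrite on_other 1?eq_sym ?reg_neq_out //; apply: holds_idle.
Qed.

Lemma spec_right w r y o : y < size w ->
  spec w right (r, y, o) 1 (r, y.+1, o).
Proof.
move=> hy T [h1 h2 h3]; eexists; first exact: execs_atom.
split=> [|j hj|].
- by rewrite on_same ffunE; apply: word_right.
- by rewrite on_other ?reg_neq0 //; apply: holds_idle; apply: h2.
- by rewrite on_other ?out_neq0 //; apply: holds_idle.
Qed.

Lemma spec_left w r y o : spec w left (r, y.+1, o) 1 (r, y, o).
Proof.
move=> T [h1 h2 h3]; eexists; first exact: execs_atom.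
split=> [|j hj|].
- by rewrite on_same ffunE; apply: word_left.
- by rewrite on_other ?reg_neq0 //; apply: holds_idle; apply: h2.
- by rewrite on_other ?out_neq0 //; apply: holds_idle.
Qed.

Lemma spec_inc_bit w i r y o : i < K ->
  spec w (inc_bit i) (r, y, o) 2 (upd r i (r i + nth false w y), y, o).
Proof.
move=> hi T [h1 h2 h3]; eexists.
  by apply: (execs_seq (n1 := 1) (n2 := 1)); apply: execs_atom.
have n0 : (ord0 == reg i) = false by rewrite eq_sym reg_neq0.
split=> [|j hj|].
- by rewrite 2?on_other //; do 2 apply: word_idle.
- rewrite /upd; case: (eqVneq j i) => [-> | ne].
    have s0 : is_one (scan_all T ord0) = nth false w y.
      by rewrite ffunE (word_scan_one h1).
    rewrite on_same; set T1 := act_all T _.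
    have -> : is_one (scan_all T1 ord0) = nth false w y.
      by rewrite ffunE on_other // (word_scan_one (word_idle h1)).
    rewrite [scan_all T1 _]ffunE /T1 on_same s0 ffunE.
    case: (nth false w y); rewrite ?addn1 ?addn0.
      by apply: holds_push; apply: h2.
    by do 2 apply: holds_idle; apply: h2.
  by rewrite 2?on_other ?reg_eq ?(negbTE ne) //; do 2 apply: holds_idle; apply: h2.
- by rewrite 2?on_other 1?eq_sym ?reg_neq_out //; do 2 apply: holds_idle.
Qed.

Lemma spec_put w i r y o : i < K ->
  spec w (put i) (r, y, o) 2 (r, y, (0 < r i) :: o).
Proof.
move=> hi T hT; have [h1 h2 h3] := hT; eexists.
  by apply: (execs_seq (n1 := 1) (n2 := 1)); apply: execs_atom.
have n0 : (ord0 == out_tape) = false by rewrite eq_sym out_neq0.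
split=> [|j hj|].
- by rewrite 2?on_other //; do 2 apply: word_idle.
- by rewrite 2?on_other ?reg_neq_out //; do 2 apply: holds_idle; apply: h2.
- rewrite 2!on_same ffunE /nonzero ffunE on_other ?reg_neq_out //.
  have : is_one (scan (act (T (reg i)) (scan (T (reg i)), MoveN))) = (0 < r i).
    have := holds_idle (h2 i hi); case: (r i) => [|n] h; first by rewrite (holds_scan0 h).
    by rewrite (holds_scan h).
  by move=> ->; apply: holds_push.
Qed.

End Registers.

(** * Bounded-sum terms and their compilation *)

(* The bounded sum is the only source of growth, hence values are polynomially
   bounded in the size of the word and the values of the variables. *)
Inductive term :=
| TVar of nat
| TLen
| TOne
| TAdd of term & term
| TSub of term & term
| TSum of term & term
| TBit of term.

Fixpoint eval (w : seq bool) (t : term) (e : seq nat) : nat :=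
  match t with
  | TVar i => nth 0 e i
  | TLen => size w
  | TOne => 1
  | TAdd a b => eval w a e + eval w b e
  | TSub a b => eval w a e - eval w b e
  | TSum a b => \sum_(j < eval w a e) eval w b (val j :: e)
  | TBit a => nth false w (eval w a e)
  end.

Definition polybound (f : nat -> nat) : Prop :=
  exists c, forall B, f B <= (B + 2) ^ c.

Lemma leq_polyexp c c' B : c <= c' -> (B + 2) ^ c <= (B + 2) ^ c'.
Proof. by move=> h; rewrite leq_pexp2l // addn2. Qed.

Lemma polyexp_gt0 B c : 0 < (B + 2) ^ c.
Proof. by rewrite expn_gt0 addn2. Qed.

Lemma polybound_id : polybound id.
Proof. by exists 1 => B; rewrite expn1 leq_addr. Qed.

Lemma polybound_const n : polybound (fun=> n).
Proof.
case: n => [|n]; first by exists 0.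
exists n.+1 => B; apply: leq_trans (ltnW (ltn_expl n.+1 (ltnSn 1))) _.
by rewrite leq_exp2r ?leq_addl.
Qed.

Lemma polybound_add f g : polybound f -> polybound g -> polybound (fun B => f B + g B).
Proof.
move=> [c hc] [c' hc']; exists (maxn c c').+1 => B.
rewrite expnS mulnDl addnC; apply: leq_trans (leq_addl _ _).
rewrite mul2n -addnn leq_add //.
  by apply: leq_trans (hc' B) _; rewrite leq_polyexp // leq_maxr.
by apply: leq_trans (hc B) _; rewrite leq_polyexp // leq_maxl.
Qed.

Lemma polybound_mul f g : polybound f -> polybound g -> polybound (fun B => f B * g B).
Proof. by move=> [c hc] [c' hc']; exists (c + c') => B; rewrite expnD leq_mul. Qed.

Lemma polybound_comp f g : polybound f -> polybound g -> polybound (fun B => f (g B)).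
Proof.
(* For x = (B+2)^c' one has x + 2 <= 4 x <= (B+2)^2 x, whence the exponent [c'.+2]. *)
move=> [c hc] [c' hc']; exists (c'.+2 * c) => B; apply: leq_trans (hc _) _.
rewrite expnM; case: (posnP c) => [->|c0]; first by rewrite !expn0.
rewrite leq_exp2r //; apply: leq_trans (leq_add (hc' B) (leqnn 2)) _.
rewrite !expnS; have := polyexp_gt0 B c'; nia.
Qed.

#[local] Hint Resolve polybound_id polybound_const polybound_add polybound_mul : core.

Lemma polybound_eval t : exists2 f, polybound f &
  forall w e B, size w <= B -> all (fun x => x <= B) e -> eval w t e <= f B.
Proof.
elim: t => [i|||a [f hf ha] b [g hg hb]|a [f hf ha] b _|a [f hf ha] b [g hg hb]|a _] /=.
- exists id => // w e B _ /allP h.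
  by case: (ltnP i (size e)) => hi; [apply: h; apply: mem_nth|rewrite nth_default].
- by exists id.
- by exists (fun=> 1).
- by exists (fun B => f B + g B); auto => w e B hw he; rewrite leq_add ?ha ?hb.
- by exists f => // w e B hw he; apply: leq_trans (leq_subr _ _) _; apply: ha.
(* The summation index stays below the value of [a], so the body is evaluated under the bound
   [B + f B]. *)
- exists (fun B => f B * g (B + f B)).
    by apply: polybound_mul => //; apply: polybound_comp; auto.
  move=> w e B hw he; have hv := ha w e B hw he.
  apply: leq_trans (leq_mul hv (leqnn _)).
  have -> : eval w a e * g (B + f B) = \sum_(j < eval w a e) g (B + f B).
    by rewrite sum_nat_const card_ord.
  apply: leq_sum => j _.
  apply: hb => /=; first exact: leq_trans (leq_addr _ _).
  rewrite (leq_trans (ltnW (ltn_ord j))) ?(leq_trans hv) ?leq_addl //=.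
  by apply: sub_all he => x hx; apply: leq_trans hx (leq_addr _ _).
- by exists (fun=> 1) => // w e B _ _; case: nth.
Qed.

Lemma map_upd r i v s : i \notin s -> map (upd r i v) s = map r s.
Proof.
move=> h; apply/eq_in_map => j hj; rewrite /upd; case: eqP => // e.
by rewrite -e hj in h.
Qed.

Ltac upd_lia := rewrite /= ?/upd; repeat
  match goal with
  | |- context [?a == ?b] => case: (a =P b) => ?
  end; subst; rewrite ?addn0 ?addn1; lia.

(** Number of scratch registers: two per nested level, and one for the temporary of [copy] at the
    leaves. *)
Fixpoint height (t : term) : nat :=
  match t with
  | TVar _ | TLen | TOne => 1
  | TAdd a b => maxn (height a) (height b)
  | TSub a b | TSum a b => (maxn (height a) (height b)).+2
  | TBit a => (height a).+2
  end.

Section Compiler.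
Variables (M : tm) (K : nat).
Local Notation N := ((tm_tapes M).+1 + K).
Local Notation prog := (prog M N).
Local Notation inc := (@inc M K).
Local Notation dec := (@dec M K).
Local Notation nonzero := (@nonzero M K).
Local Notation rep := (@rep M K).

Lemma spec_loop w (b : scans M N -> bool) (P : prog) (sr : nat -> nat -> nat)
    (sy : nat -> nat) (so : nat -> seq bool) v n r r' :
  r =1 sr 0 -> sr v =1 r' ->
  (forall j T, j <= v -> rep w T (sr j, sy j, so j) -> b (scan_all T) = (j < v)) ->
  (forall j, j < v -> spec w P (sr j, sy j, so j) n (sr j.+1, sy j.+1, so j.+1)) ->
  spec w (pwhile b P) (r, sy 0, so 0) (v * n.+1).+1 (r', sy v, so v).
Proof.
move=> e0 e1 hb hP; apply: spec_ext e1.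
apply: spec_extl (fsym e0).
exact: (spec_while (s := fun j => (sr j, sy j, so j))).
Qed.

Definition copy x dst tmp : prog :=
  pseq (pwhile (nonzero x) (pseq (dec x) (pseq (inc dst) (inc tmp))))
       (pwhile (nonzero tmp) (pseq (dec tmp) (inc x))).

Definition clear x : prog := pwhile (nonzero x) (dec x).

Lemma spec_clear w x r y o : x < K ->
  spec w (clear x) (r, y, o) (2 * r x + 1) (upd r x 0, y, o).
Proof.
move=> hx; apply: (spec_le (n := (r x * 2).+1)); first by lia.
apply: (@spec_loop _ _ _ (fun j => upd r x (r x - j)) (fun=> y) (fun=> o)) => //.
- move=> i; upd_lia.
- move=> i; upd_lia.
- move=> j T hj hT; rewrite (nonzeroE hx hT); upd_lia.
- move=> j hj; apply: spec_ext; first by apply: spec_dec => //; upd_lia.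
  by move=> i; upd_lia.
Qed.

Lemma spec_copy w x dst tmp r y o : x < K -> dst < K -> tmp < K ->
  x <> dst -> x <> tmp -> dst <> tmp -> r tmp = 0 ->
  spec w (copy x dst tmp) (r, y, o) (10 * r x + 2) (upd r dst (r dst + r x), y, o).
Proof.
move=> hx hd ht n1 n2 n3 r0.
apply: (spec_le (n := (r x * (1 + (2 + 2)).+1).+1 + (r x * (1 + 2).+1).+1)).
  by lia.
apply: (spec_seq (s1 := (upd (upd (upd r x 0) dst (r dst + r x)) tmp (r x), y, o))).
  apply: (@spec_loop _ _ _ (fun j => upd (upd (upd r x (r x - j)) dst (r dst + j)) tmp j)
            (fun=> y) (fun=> o)) => //.
  - move=> i; upd_lia.
  - move=> i; upd_lia.
  - move=> j T hj hT; rewrite (nonzeroE hx hT); upd_lia.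
  - move=> j hj; apply: spec_ext.
      apply: spec_seq; first by apply: spec_dec => //; upd_lia.
      by apply: spec_seq; apply: spec_inc.
    by move=> i; upd_lia.
apply: (@spec_loop _ _ _ (fun j => upd (upd (upd r x j) dst (r dst + r x)) tmp (r x - j))
          (fun=> y) (fun=> o)) => //.
- move=> i; upd_lia.
- move=> i; upd_lia.
- move=> j T hj hT; rewrite (nonzeroE ht hT); upd_lia.
- move=> j hj; apply: spec_ext.
    by apply: spec_seq; [apply: spec_dec => //; upd_lia | apply: spec_inc].
  by move=> i; upd_lia.
Qed.

Lemma spec_skip w r y o : spec w (patom (@idle M N)) (r, y, o) 1 (r, y, o).
Proof. by move=> T hT; eexists; [exact: execs_atom | apply: rep_idle]. Qed.

(* Adds the value of [t] to register [dst]; the variables are in the registers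
   [env], register 0 holds the size of the word, and the registers from [base]
   on are scratch space, which is zero before and after. *)
Fixpoint compile (t : term) (env : seq nat) (base dst : nat) : prog :=
  match t with
  | TVar i => if i < size env then copy (nth 0 env i) dst base
              else patom (@idle M N)
  | TLen => copy 0 dst base
  | TOne => inc dst
  | TAdd a b => pseq (compile a env base dst) (compile b env base dst)
  | TSub a b =>
      pseq (compile a env base.+2 base) (pseq (compile b env base.+2 base.+1)
      (pseq (pwhile (fun s => nonzero base s && nonzero base.+1 s)
               (pseq (dec base) (dec base.+1)))
      (pseq (clear base.+1)
            (pwhile (nonzero base) (pseq (dec base) (inc dst))))))
  | TSum a b =>
      pseq (compile a env base.+2 base)
      (pseq (pwhile (nonzero base) (pseq (dec base)
               (pseq (compile b (base.+1 :: env) base.+2 dst) (inc base.+1))))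
            (clear base.+1))
  | TBit a =>
      pseq (compile a env base.+2 base)
      (pseq (pwhile (fun s => nonzero base s && at_bit s)
               (pseq (dec base) (pseq (right M K) (inc base.+1))))
      (pseq (inc_bit M K dst) (pseq (clear base)
            (pwhile (nonzero base.+1) (pseq (dec base.+1) (left M K))))))
  end.

(** The time bound ignores the content of [dst], which is only incremented and never read. Keeping
    [dst] out of [env] lets the body of a sum accumulate into it without disturbing the
    variables. *)
Lemma compile_spec t : exists2 f, polybound f & forall w env base dst r o B,
  base + height t <= K -> 0 < dst < base ->
  all (fun i => (i < base) && (i != dst)) env ->
  (forall i, base <= i -> r i = 0) -> r 0 = size w ->
  size w <= B -> all (fun i => r i <= B) env ->
  spec w (compile t env base dst) (r, 0, o) (f B)
    (upd r dst (r dst + eval w t (map r env)), 0, o).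
Proof.
have envS (env : seq nat) base dst dst' : base <= dst' < base.+2 ->
    all (fun i => (i < base) && (i != dst)) env ->
    all (fun i => (i < base.+2) && (i != dst')) env.
  by move=> hd; apply: sub_all => i; lia.
have envN (env : seq nat) base dst dst' : base <= dst' ->
    all (fun i => (i < base) && (i != dst)) env -> dst' \notin env.
  by move=> hd /allP h; apply/negP => /h; lia.
elim: t => [i|||a [f hf ha] b [g hg hb]|a [f hf ha] b [g hg hb]
           |a [f hf ha] b [g hg hb]|a [f hf ha]].
- exists (fun B => 10 * B + 2); auto => w env base dst r o B /= hK hd he hr r0 hw hB.
  case: ifP => hi; last first.
    rewrite nth_default ?size_map 1?leqNgt ?hi // addn0.
    apply: (spec_le (n := 1)); first by lia.
    apply: spec_ext (@spec_skip _ _ _ _) _; move=> j; upd_lia.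
  have hm := mem_nth 0 hi; have := allP hB _ hm; have := allP he _ hm => h1 h2.
  rewrite (nth_map 0) //; move: (nth 0 env i) h1 h2 => x h1 h2.
  apply: (spec_le (n := 10 * r x + 2)); first by lia.
  by apply: spec_copy; try lia; apply: hr.
- exists (fun B => 10 * B + 2); auto => w env base dst r o B /= hK hd he hr r0 hw hB.
  rewrite -r0; apply: (spec_le (n := 10 * r 0 + 2)); first by lia.
  by apply: spec_copy; try lia; apply: hr.
- exists (fun=> 2) => // w env base dst r o B /= hK hd he hr r0 hw hB.
  by apply: spec_ext; [apply: spec_inc; lia | move=> i; upd_lia].
- exists (fun B => f B + g B); auto => w env base dst r o B /= hK hd he hr r0 hw hB.
  have hdN : dst \notin env by apply/negP => /(allP he); lia.
  apply: spec_ext.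
    apply: spec_seq; first by apply: ha => //; lia.
    apply: hb => //; rewrite ?map_upd //; try lia.
    - by move=> i hi; rewrite /upd; case: eqP => [|_]; [lia | apply: hr].
    - by rewrite /upd; case: eqP => //; lia.
    - by apply/allP => i hi; rewrite /upd; case: eqP => [e|_];
         [rewrite -e hi in hdN | apply: (allP hB)].
  by move=> i; rewrite map_upd //; upd_lia.
- have [fa hfa va] := polybound_eval a; have [fb hfb vb] := polybound_eval b.
  exists (fun B => f B + (g B + ((fa B * 3 + 1) + ((2 * fb B + 1) + (fa B * 4 + 1))))).
    by do !apply: polybound_add => //; apply: polybound_mul => //; auto.
  move=> w env base dst r o B /= hK hd he hr r0 hw hB.
  have {}va := va w (map r env) B hw _; have {}vb := vb w (map r env) B hw _.
  rewrite all_map in va vb; have {}va := va hB; have {}vb := vb hB.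
  have N1 := envN _ _ _ base (leqnn _) he.
  have N2 := envN _ _ _ base.+1 (leqnSn _) he.
  set x := eval w a _ in va *; set y := eval w b _ in vb *.
  have rb : r base = 0 by apply: hr.
  have rb1 : r base.+1 = 0 by apply: hr.
  apply: (spec_seq (s1 := (upd r base x, 0, o))).
    apply: spec_ext; first apply: ha => //; try lia.
    - by apply: (envS) he; lia.
    - by move=> i hi; apply: hr; lia.
    by move=> i; rewrite -/x; upd_lia.
  apply: (spec_seq (s1 := (upd (upd r base x) base.+1 y, 0, o))).
    apply: spec_ext; first apply: hb => //; try lia.
    - by apply: (envS) he; lia.
    - by move=> i hi; rewrite /upd; case: eqP => [|_]; [lia | apply: hr; lia].
    - by rewrite /upd; case: eqP => //; lia.
    - by apply/allP => i hi; rewrite /upd; case: eqP => [e|_];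
         [rewrite -e hi in N1 | apply: (allP hB)].
    by move=> i; rewrite map_upd // -/y; upd_lia.
  (* Both counters go down together min(x, y) times; truncated subtraction describes what is left of
     each. *)
  apply: (spec_seq (s1 := (upd (upd r base (x - y)) base.+1 (y - x), 0, o))).
    apply: (spec_le (n := (minn x y * (1 + 1).+1).+1)); first by lia.
    apply: (@spec_loop _ _ _ (fun j => upd (upd r base (x - j)) base.+1 (y - j))
              (fun=> 0) (fun=> o)).
    + by move=> i; upd_lia.
    + by move=> i; upd_lia.
    + move=> j T hj hT; rewrite (nonzeroE _ hT); last by lia.
      rewrite (nonzeroE _ hT); last by lia.
      by upd_lia.
    + move=> j hj; apply: spec_ext.
        by apply: spec_seq; apply: spec_dec; upd_lia.
      by move=> i; upd_lia.
  apply: (spec_seq (s1 := (upd r base (x - y), 0, o))).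
    apply: (spec_le (n := 2 * (y - x) + 1)); first by lia.
    apply: spec_ext.
      apply: spec_le; last by apply: spec_clear; lia.
      by upd_lia.
    by move=> i; upd_lia.
  apply: (spec_le (n := ((x - y) * (1 + 2).+1).+1)); first by lia.
  apply: (@spec_loop _ _ _ (fun j => upd (upd r base (x - y - j)) dst (r dst + j))
              (fun=> 0) (fun=> o)).
  + by move=> i; upd_lia.
  + by move=> i; upd_lia.
  + by move=> j T hj hT; rewrite (nonzeroE _ hT); upd_lia.
  + move=> j hj; apply: spec_ext.
      by apply: spec_seq; [apply: spec_dec; upd_lia | apply: spec_inc; lia].
    by move=> i; upd_lia.
- have [fa hfa va] := polybound_eval a.
  exists (fun B => f B + ((fa B * (g (B + fa B) + 4) + 1) + (2 * fa B + 1))).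
    do !apply: polybound_add => //; apply: polybound_mul => //.
    by apply: polybound_add => //; apply: polybound_comp; auto.
  move=> w env base dst r o B /= hK hd he hr r0 hw hB.
  have {}va := va w (map r env) B hw _.
  rewrite all_map in va; have {}va := va hB.
  have N1 := envN _ _ _ base (leqnn _) he.
  have N2 := envN _ _ _ base.+1 (leqnSn _) he.
  have hdN : dst \notin env by apply/negP => /(allP he); lia.
  set x := eval w a _ in va *.
  have rb : r base = 0 by apply: hr.
  have rb1 : r base.+1 = 0 by apply: hr.
  apply: (spec_seq (s1 := (upd r base x, 0, o))).
    apply: spec_ext; first apply: ha => //; try lia.
    - by apply: (envS) he; lia.
    - by move=> i hi; apply: hr; lia.
    by move=> i; rewrite -/x; upd_lia.
  pose S n := \sum_(j < n) eval w b (val j :: map r env).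
  apply: (spec_seq (s1 := (upd (upd r base.+1 x) dst (r dst + S x), 0, o))); last first.
    apply: spec_ext.
      apply: spec_le; last by apply: spec_clear; lia.
      by upd_lia.
    by move=> i; rewrite -/(S x); upd_lia.
  apply: (spec_le (n := (x * (1 + (g (B + fa B) + 2)).+1).+1)); first by nia.
  (* Invariant: [base] counts the remaining rounds, [base.+1] is the summation index, and [dst] has
     received the partial sum. *)
  apply: (@spec_loop _ _ _ (fun j => upd (upd (upd r base (x - j)) base.+1 j)
              dst (r dst + S j)) (fun=> 0) (fun=> o)).
  + by move=> i; rewrite /S big_ord0; upd_lia.
  + by move=> i; upd_lia.
  + by move=> j T hj hT; rewrite (nonzeroE _ hT); upd_lia.
  + move=> j hj; apply: spec_ext.
      apply: spec_seq; first by apply: spec_dec; upd_lia.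
      apply: spec_seq.
      apply: (hb w (base.+1 :: env) base.+2 dst _ o (B + fa B)).
      - by lia.
      - by lia.
      - apply/andP; split; first by lia.
        by apply: sub_all he => i; lia.
      - by move=> i hi; have := hr i; upd_lia.
      - by upd_lia.
      - by lia.
      - apply/andP; split; first by upd_lia.
        by apply/allP => i hi; have := allP he _ hi; have := allP hB _ hi; upd_lia.
      by apply: spec_inc; lia.
    move=> i.
    have -> : S j.+1 = S j + eval w b (j :: map r env) by rewrite /S big_ord_recr.
    rewrite [map _ (_ :: _)]/= !map_upd //.
    rewrite [X in X :: _](_ : _ = j); last by upd_lia.
    by upd_lia.
- have [fa hfa va] := polybound_eval a.
  exists (fun B => f B + ((fa B * 5 + 1) + (2 + ((2 * fa B + 1) + (fa B * 3 + 1))))).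
    by do !apply: polybound_add => //; apply: polybound_mul => //; auto.
  move=> w env base dst r o B /= hK hd he hr r0 hw hB.
  have {}va := va w (map r env) B hw _.
  rewrite all_map in va; have {}va := va hB.
  have N1 := envN _ _ _ base (leqnn _) he.
  set x := eval w a _ in va *.
  have rb : r base = 0 by apply: hr.
  have rb1 : r base.+1 = 0 by apply: hr.
  apply: (spec_seq (s1 := (upd r base x, 0, o))).
    apply: spec_ext; first apply: ha => //; try lia.
    - by apply: (envS) he; lia.
    - by move=> i hi; apply: hr; lia.
    by move=> i; rewrite -/x; upd_lia.
  (* For an address beyond the word the head stops at its end, where the symbol is not a bit and
     counts as false. *)
  set y := minn x (size w).
  apply: (spec_seq (s1 := (upd (upd r base (x - y)) base.+1 y, y, o))).
    apply: (spec_le (n := (y * (1 + (1 + 2)).+1).+1)); first by lia.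
    apply: (@spec_loop _ _ _ (fun j => upd (upd r base (x - j)) base.+1 j)
              id (fun=> o)).
    + by move=> i; upd_lia.
    + by move=> i; upd_lia.
    + move=> j T hj hT; rewrite (nonzeroE _ hT); last by lia.
      by rewrite (at_bitE hT); upd_lia.
    + move=> j hj; apply: spec_ext.
        apply: spec_seq; first by apply: spec_dec; upd_lia.
        apply: spec_seq; first by apply: spec_right; lia.
        by apply: spec_inc; lia.
      by move=> i; upd_lia.
  have ey : nth false w y = nth false w x.
    by rewrite /y /minn; case: ltnP => // hx; rewrite !nth_default.
  apply: spec_seq; first by apply: spec_inc_bit; lia.
  apply: (spec_seq (s1 := (upd (upd r base.+1 y) dst (r dst + nth false w x), y, o))).
    apply: (spec_le (n := 2 * (x - y) + 1)); first by lia.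
    apply: spec_ext.
      apply: spec_le; last by apply: spec_clear; lia.
      by upd_lia.
    by move=> i; rewrite ey; upd_lia.
  apply: (spec_le (n := (y * (1 + 1).+1).+1)); first by lia.
  set r1 := upd (upd r base.+1 y) _ _; set r2 := upd r dst _.
  (* The head returns by the [y] moves recorded in [base.+1]; the positions [y - j] have the shape
     of a loop invariant. *)
  suff : spec w (pwhile (nonzero base.+1) (pseq (dec base.+1) (left M K)))
           (r1, y - 0, o) (y * (1 + 1).+1).+1 (r2, y - y, o) by rewrite subn0 subnn.
  rewrite {}/r1 {}/r2.
  apply: (@spec_loop _ _ _ (fun j => upd (upd r base.+1 (y - j))
             dst (r dst + nth false w x)) (fun j => y - j) (fun=> o)).
  + by move=> i; upd_lia.
  + by move=> i; upd_lia.
  + by move=> j T hj hT; rewrite (nonzeroE _ hT); upd_lia.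
  + move=> j hj; apply: spec_ext.
      apply: spec_seq; first by apply: spec_dec; upd_lia.
      rewrite -subnSK //; exact: spec_left.
    by move=> i; upd_lia.
Qed.

End Compiler.

(** * Running a term on the output of a machine *)

Section MachineOfProgram.
Variables (M : tm) (N : nat) (P : prog M N).

Definition tm_of : tm :=
  @TM N (tm_aux M) (option (pstate P)) (Some (pstart P))
    (fun q => ~~ isSome q)
    (fun q s => if q is Some p then @ptrans M N P p s else (None, idle s)).

Lemma step_tm_of (q : pstate P) (T : tapes M N) : @step tm_of (Some q, T) =
  let: (o, a) := ptrans q (scan_all T) in (o, act_all T a).
Proof. by []. Qed.

Lemma tm_of_iter (q : pstate P) T n T' : runs q T n T' ->
  forall m, n <= m -> iter m (@step tm_of) (Some q, T) = (None, T').
Proof.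
have halted m (T1 : tapes M N) : iter m (@step tm_of) (None, T1) = (None, T1).
  by elim: m => //= m ->.
elim=> {q T n T'} [q T a e | q T q' a n T' e _ IH] [|m] // hm.
  by rewrite iterSr step_tm_of e halted.
by rewrite iterSr step_tm_of e IH.
Qed.

End MachineOfProgram.

Section Main.
Variables (M : tm) (K : nat) (tL tB : term).
Local Notation N := ((tm_tapes M).+1 + K).
Local Notation prog := (prog M N).
Local Notation on := (@on M N).

Definition embed (i : 'I_(tm_tapes M).+1) : 'I_N.+1 := inord i.

Lemma embedE i : embed i = i :> nat.
Proof. by rewrite inordK //; have := ltn_ord i; lia. Qed.

Definition simulate : prog :=
  @Prog M N (tm_state M) (tm_start M) (fun q s =>
    if tm_halt q then (None, idle s) else
    let: (q', a) := tm_trans q [ffun i => s (embed i)] in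
    (Some q', [ffun j => if insub (val j) is Some i then a i else (s j, MoveN)])).

(** The additional step is the one that notices the halting state. It idles, so the tapes agree with
    those of [M] up to a rewriting of the scanned symbol. *)
Lemma simulate_runs k (c : config M) (T : tapes M N) :
  (forall i, T (embed i) = c.2 i) ->
  (forall j : 'I_N.+1, tm_tapes M < j -> holds (T j) [::]) ->
  let c' := iter k (@step M) c in tm_halt c'.1 ->
  exists2 n, n <= k.+1 & exists2 T', @runs M N simulate c.1 T n T' &
    (forall i, T' (embed i) = act (c'.2 i) (scan (c'.2 i), MoveN)) /\
    (forall j : 'I_N.+1, tm_tapes M < j -> holds (T' j) [::]).
Proof.
elim: k c T => [|k IH] c T hT hj c' hc'.
  exists 1 => //; eexists; first by apply: runs_exit; rewrite /= hc'.
  split=> [i|j lj]; rewrite !ffunE ?hT //.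
  by apply: holds_idle; apply: hj.
case: (boolP (tm_halt c.1)) => hc.
  exists 1 => //; eexists; first by apply: runs_exit; rewrite /= hc.
  have -> : c' = c.
    rewrite /c'; elim: k.+1 => //= n ->; by rewrite /step hc.
  split=> [i|j lj]; rewrite !ffunE ?hT //.
  by apply: holds_idle; apply: hj.
have e : [ffun i => scan_all T (embed i)] = [ffun i => scan (c.2 i)].
  by apply/ffunP => i; rewrite !ffunE hT.
case E : (tm_trans c.1 [ffun i => scan (c.2 i)]) => [q a].
pose aa : actions M N := [ffun j => if insub (val j) is Some i then a i
                                    else (scan_all T j, MoveN)].
have hs : step c = (q, [ffun i => act (c.2 i) (a i)]).
  by rewrite /step (negbTE hc) E.
have := IH (step c) (act_all T aa); rewrite hs /= => /(_ _ _).
have ec : iter k (@step M) (q, [ffun i => act (c.2 i) (a i)]) = c'.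
  by rewrite /c' iterSr hs.
rewrite ec => /(_ _ _ hc') [||n hn [T' hr hT']].
- by move=> i; rewrite !ffunE hT /= embedE valK.
- move=> j lj; rewrite !ffunE insubN -?leqNgt //.
  by apply: holds_idle; apply: hj.
exists n.+1 => //; exists T' => //.
apply: (@runs_step M N simulate c.1 T q aa) => //.
by rewrite /= (negbTE hc) e E.
Qed.

Definition measure : prog :=
  pseq (pwhile (@at_bit M K) (pseq (right M K) (pseq (inc M K 0) (inc M K 1))))
       (pwhile (@nonzero M K 1) (pseq (dec M K 1) (left M K))).

(** Register 1 counts the bits still to be written, register 2 is the index of the current bit,
    register 3 its value. Bits are pushed, so the output tape carries the word in reverse. *)
Definition emit : prog :=
  pseq (compile M K tL [::] 4 1)
       (pwhile (@nonzero M K 1) (pseq (dec M K 1)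
          (pseq (compile M K tB [:: 2] 4 3) (pseq (put M K 3)
          (pseq (clear M K 3) (inc M K 2)))))).

Definition deliver : prog :=
  pwhile (fun s => is_bit (s (out_tape M K)))
    (pseq (patom (on ord0 (fun s => (s ord0, MoveL))))
    (pseq (patom (on ord0 (fun s => (s (out_tape M K), MoveN))))
          (patom (on (out_tape M K) (fun s => (s (out_tape M K), MoveR)))))).

(** The blank marks the end of the output, which is then pushed to the left of it over whatever [M]
    left there. *)
Definition terminate : prog :=
  pseq (patom (on ord0 (fun s => (s ord0, MoveL))))
       (patom (on ord0 (fun s => (None, MoveN)))).

Definition main_prog : prog :=
  pseq simulate (pseq measure (pseq emit (pseq terminate deliver))).

(** Moving a stack onto another one reverses it, which undoes the reversal made by [emit]. *)
Lemma deliver_execs o s (T : tapes M N) : holds (T ord0) s -> holds (T (out_tape M K)) o ->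
  exists2 T', execs deliver T (4 * size o + 1) T' & holds (T' ord0) (catrev o s).
Proof.
have n0 : (ord0 == out_tape M K) = false by rewrite eq_sym out_neq0.
elim: o s T => [|b o IH] s T h0 ho.
  eexists; first by apply: execs_while_end; rewrite ffunE (holds_scan0 ho).
  by rewrite !ffunE; apply: holds_idle.
set T0 := act_all T (idle (scan_all T)).
have {}h0 : holds (T0 ord0) s by rewrite !ffunE; apply: holds_idle.
have hob : is_bit (scan_all T (out_tape M K)) by rewrite ffunE (holds_scan ho).
have {}ho : holds (T0 (out_tape M K)) (b :: o) by rewrite !ffunE; apply: holds_idle.
pose T1 := act_all T0 (on ord0 (fun s => (s ord0, MoveL)) (scan_all T0)).
pose T2 := act_all T1 (on ord0 (fun s => (s (out_tape M K), MoveN)) (scan_all T1)).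
pose T3 := act_all T2 (on (out_tape M K) (fun s => (s (out_tape M K), MoveR)) (scan_all T2)).
have ho1 : holds (T1 (out_tape M K)) (b :: o).
  by rewrite /T1 on_other ?out_neq0 //; apply: holds_idle.
have ho2 : holds (T2 (out_tape M K)) (b :: o).
  by rewrite /T2 on_other ?out_neq0 //; apply: holds_idle.
have h2 : holds (T2 ord0) (b :: s).
  rewrite /T2 on_same [scan_all T1 _]ffunE (holds_scan ho1) /T1 on_same
    [scan_all T0 _]ffunE.
  exact: holds_push.
have [||T' e' h'] := IH (b :: s) T3.
- by rewrite /T3 on_other //; apply: holds_idle.
- by rewrite /T3 on_same; apply: holds_pop ho2.
exists T' => //.
have e3 : execs (pseq (patom (on ord0 (fun s => (s ord0, MoveL))))
    (pseq (patom (on ord0 (fun s => (s (out_tape M K), MoveN))))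
          (patom (on (out_tape M K) (fun s => (s (out_tape M K), MoveR)))))) T0 3 T3.
  apply: (execs_seq (n1 := 1) (n2 := 2)); first exact: execs_atom.
  by apply: (execs_seq (n1 := 1) (n2 := 1)); apply: execs_atom.
have := execs_while_step (b := fun s => is_bit (s (out_tape M K))) hob e3 e'.
by move=> [n hn hr]; exists n => //; apply: leq_trans hn _ => /=; lia.
Qed.

Lemma measure_spec w : 4 <= K -> spec w measure ((fun=> 0), 0, [::])
  (9 * size w + 2) (upd (fun=> 0) 0 (size w), 0, [::]).
Proof.
move=> hK; apply: (spec_le (n := (size w * (1 + (2 + 2)).+1).+1 + (size w * (1 + 1).+1).+1)).
  by lia.
pose r0 : nat -> nat := fun=> 0.
apply: (spec_seq (s1 := (upd (upd r0 0 (size w)) 1 (size w), size w, [::]))).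
  apply: (@spec_loop _ _ _ _ _ (fun j => upd (upd r0 0 j) 1 j) id (fun=> [::])) => //.
  - by move=> i; rewrite /r0; upd_lia.
  - by move=> j T hj hT; rewrite (at_bitE hT).
  - move=> j hj; apply: spec_ext.
      apply: spec_seq; first exact: spec_right.
      by apply: spec_seq; apply: spec_inc; lia.
    by move=> i; rewrite /r0; upd_lia.
set s1 := (_, _, _); set s2 := (_, _, _).
have -> : s1 = (upd (upd r0 0 (size w)) 1 (size w), size w - 0, [::]) by rewrite subn0.
have -> : s2 = (upd r0 0 (size w), size w - size w, [::]) by rewrite subnn.
apply: (@spec_loop _ _ _ _ _ (fun j => upd (upd r0 0 (size w)) 1 (size w - j))
  (fun j => size w - j) (fun=> [::])).
- by move=> i; rewrite /r0; upd_lia.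
- by move=> i; rewrite /r0; upd_lia.
- by move=> j T hj hT; rewrite (nonzeroE _ hT); upd_lia.
- move=> j hj; apply: spec_ext.
    apply: spec_seq; first by apply: spec_dec; upd_lia.
    rewrite -subnSK //; exact: spec_left.
  by move=> i; upd_lia.
Qed.

Definition word_of (w : seq bool) : seq bool :=
  mkseq (fun i => 0 < eval w tB [:: i]) (eval w tL [::]).

Lemma emit_spec : exists2 f, polybound f & forall w B, 4 + height tL <= K ->
  4 + height tB <= K -> size w <= B ->
  exists r, spec w emit (upd (fun=> 0) 0 (size w), 0, [::]) (f B) (r, 0, rev (word_of w)).
Proof.
have [fL hfL cL] := compile_spec M K tL; have [fB hfB cB] := compile_spec M K tB.
have [gL hgL vL] := polybound_eval tL; have [gB hgB vB] := polybound_eval tB.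
pose F B := B + gL B.
have hF : polybound F by apply: polybound_add => //; apply: polybound_id.
exists (fun B => fL B + (gL B * (1 + (fB (F B) + (2 + ((2 * gB (F B) + 1) + 2)) + 1)) + 1)).
  by repeat first [apply: polybound_add | apply: polybound_mul | apply: polybound_const
       | apply: hfL | apply: hgL | apply: polybound_comp hF | apply: hfB | apply: hgB].
move=> w B hKL hKB hw; pose r0 : nat -> nat := fun=> 0.
have {}vL := vL w [::] B hw isT; set x := eval w tL [::] in vL.
pose r1 j : nat -> nat := upd (upd (upd r0 0 (size w)) 1 (x - j)) 2 j.
pose o j := rev (mkseq (fun i => 0 < eval w tB [:: i]) j).
exists (r1 x).
apply: (spec_seq (s1 := (r1 0, 0, [::]))).
  apply: spec_ext; first by apply: cL => // i hi; upd_lia.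
  by move=> i; rewrite -/x /r1 /r0; upd_lia.
set P := pseq (dec _ _ _) _.
have hP j : j < x -> spec w P (r1 j, 0, o j)
    (1 + (fB (F B) + (2 + ((2 * gB (F B) + 1) + 2)))) (r1 j.+1, 0, o j.+1).
  move=> hj; have hv : eval w tB [:: j] <= gB (F B).
    by apply: vB; rewrite /F /= ?andbT; lia.
  have eo : o j.+1 = (0 < eval w tB [:: j]) :: o j.
    by rewrite /o mkseqS rev_rcons.
  apply: spec_ext.
    apply: spec_seq; first by apply: spec_dec; rewrite ?/r1; upd_lia.
    apply: spec_seq.
      apply: (cB w [:: 2] 4 3 _ (o j) (F B)) => //.
      - by move=> i hi; rewrite /r1 /r0; upd_lia.
      - by rewrite /F; lia.
      - by rewrite /r1 /F; upd_lia.
    have -> : eval w tB (map (upd (r1 j) 1 (r1 j 1).-1) [:: 2]) = eval w tB [:: j].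
      by congr eval.
    set v := eval w tB _ in hv eo *.
    apply: spec_seq; first by apply: spec_put; lia.
    rewrite [X in (_, _, X :: _)](_ : _ = (0 < v)); last by rewrite /r1 /r0; upd_lia.
    rewrite -eo; apply: spec_seq.
      apply: spec_le; last by apply: spec_clear; lia.
      by rewrite /r1 /r0; upd_lia.
    by apply: spec_inc; lia.
  by move=> i; rewrite /r1 /r0; upd_lia.
apply: (spec_le (n := (x * (1 + (fB (F B) + (2 + ((2 * gB (F B) + 1) + 2)))).+1).+1)).
  by rewrite -[X in X <= _]addn1 leq_add2r; apply: leq_mul => //; lia.
apply: (@spec_loop _ _ _ _ _ r1 (fun=> 0) o) => //.
by move=> j T hj hT; rewrite (nonzeroE _ hT) /r1; upd_lia.
Qed.

Lemma holds_leading (tp : tape M) s : holds tp s -> leading_bits tp.2 = s.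
Proof.
case: tp => l r /=; elim: s r => [|b s IH] [|x r] [h1 h2] //=.
- by move: h2 => /= ->.
- by have := h1 0 isT.
- have /= -> := h1 0 isT; congr cons; apply: IH; split=> // i hi.
  exact: (h1 i.+1).
Qed.

Lemma word_leading (tp : tape M) : word_at tp (leading_bits tp.2) 0.
Proof.
case: tp => l r; split=> //= [i|]; rewrite ?add0n ?subn0; last first.
  by elim: r => // -[[]|].
by elim: r i => // -[[b|a]|] r IH [|i] //=; apply: IH.
Qed.

Lemma machine_outputs : 4 + height tL <= K -> 4 + height tB <= K ->
  exists2 f, polybound f & forall w T w', outputs_within M w T w' ->
  size w' <= (T + size w).+1 ->
  outputs_within (tm_of main_prog) w (f (T + size w).+1) (word_of w').
Proof.
move=> hKL hKB; have [f hf hE] := emit_spec; have [gL hgL vL] := polybound_eval tL.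
exists (fun B => (B + 1) + ((9 * B + 2) + (f B + (2 + (4 * gL B + 1))))).
  by repeat first [apply: polybound_add | apply: polybound_mul | apply: polybound_const
     | apply: polybound_id | apply: hf | apply: hgL].
move=> w T w' [hh <-]; set c' := iter T _ _ in hh *; set v := output c'; set B := (T + _).+1.
move=> hv; have [r hr] := hE v B hKL hKB hv.
have hsz : size (word_of v) <= gL B by rewrite size_mkseq; apply: vL.
pose T0 : tapes M N := (init (tm_of main_prog) w).2.
have [||n hn [T1 hT1 [h1 h1']]] := @simulate_runs T (init M w) T0 _ _ hh.
- move=> i; rewrite !ffunE; congr (if _ then _ else _).
  by rewrite -!val_eqE /= embedE.
- by move=> j hj; rewrite !ffunE; case: eqP => [e|_] //; rewrite e in hj.
(* The output of [M] is the maximal run of bits at its head, hence a word in the sense of [word_at]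
   with no cleaning up. *)
have R1 : rep v T1 ((fun=> 0), 0, [::]).
  split=> [|i hi|].
  - have -> : ord0 = embed ord0 by apply/val_inj; rewrite /= embedE.
    rewrite h1; apply: word_idle; exact: word_leading.
  - by apply: h1'; rewrite regE //; lia.
  - by apply: h1'; rewrite out_tapeE.
have [T2 e2 R2] := measure_spec (w := v) (leq_trans (leq_addr _ _) hKL) R1.
have [T3 e3 [R3 _ R3']] := hr T2 R2.
pose T4 := act_all T3 (on ord0 (fun s => (s ord0, MoveL)) (scan_all T3)).
pose T5 := act_all T4 (on ord0 (fun s => (None, MoveN)) (scan_all T4)).
have e5 : execs terminate T3 2 T5.
  by apply: (execs_seq (n1 := 1) (n2 := 1)); apply: execs_atom.
have [||T6 e6 h6] := @deliver_execs (rev (word_of v)) [::] T5.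
- by rewrite /T5 on_same; case: (T4 ord0) => l rr; split.
- by rewrite /T5 on_other ?out_neq0 // /T4 on_other ?out_neq0 //; do 2 apply: holds_idle.
have e1 : execs simulate T0 T.+1 T1 by exists n.
have [m hm hrun] := execs_seq e1 (execs_seq e2 (execs_seq e3 (execs_seq e5 e6))).
have := tm_of_iter hrun; rewrite /outputs_within => H.
have -> : init (tm_of main_prog) w = (Some (pstart main_prog), T0) by [].
rewrite H; last first.
  apply: leq_trans hm _; rewrite size_rev; move: hv hsz; rewrite -/B => hv hsz.
  have hB : T < B by rewrite ltnS leq_addr.
  by lia.
split=> //; apply: etrans (holds_leading h6) _.
by rewrite catrevE cats0 revK.
Qed.

End Main.

(** A step adds at most one cell to the right part, except that a left move from an empty right part
    creates two; the extra unit absorbs this. *)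
Lemma output_size M w T w' : outputs_within M w T w' -> size w' <= (T + size w).+1.
Proof.
move=> [_ <-]; rewrite /output.
apply: (@leq_trans (size ((iter T (@step M) (init M w)).2 ord0).2)).
  by elim: (_.2) => // -[[]|].
elim: T => [|T IH]; first by rewrite ffunE /= size_map.
rewrite iterS; set c := iter T _ _ in IH *; rewrite /step.
case: (tm_halt c.1); first exact: leq_trans IH _.
case: (tm_trans _ _) => q a /=; rewrite ffunE.
case: (c.2 ord0) IH => l r /= IH; case: (a ord0) => x [] /=;
  rewrite size_behead; lia.
Qed.

Lemma outputs_within_le M w T T' w' : T <= T' ->
  outputs_within M w T w' -> outputs_within M w T' w'.
Proof.
move=> /subnK <- h; elim: (T' - T) => [|n [h1 h2]] //.
by rewrite /outputs_within addSn iterS /step h1.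
Qed.

(** Post-composition of a machine with a term-defined transformation of words. It yields both the
    reduction and the computability of its two bounds. *)
Theorem term_machine (M : tm) (tL tB : term) : exists (M' : tm) (c : nat),
  forall w T w', outputs_within M w T w' ->
  outputs_within M' w ((T + size w + 2) ^ c) (word_of tL tB w').
Proof.
pose K := 4 + (height tL + height tB).
have [||f hf h] := @machine_outputs M K tL tB; try by rewrite /K; lia.
have [|c hc] := @polybound_comp f (fun B => B + 1) hf.
  by apply: polybound_add; [apply: polybound_id | apply: polybound_const].
exists (tm_of (main_prog M K tL tB)), c => w T w' hw.
apply: outputs_within_le (h w T w' hw (output_size hw)).
by rewrite -addn1.
Qed.

(** * Definable functions and relations *)

(** Bounded quantifiers over plain numbers reduce to comparing a count, and a count is a bounded sum
    of bits. *)
Definition exn (n : nat) (P : nat -> bool) : bool := has P (iota 0 n).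
Definition alln (n : nat) (P : nat -> bool) : bool := all P (iota 0 n).
Definition cntn (n : nat) (P : nat -> bool) : nat := count P (iota 0 n).

Definition definable (F : seq bool -> seq nat -> nat) : Prop :=
  exists t, forall w e, eval w t e = F w e.

Definition decidable_rel (P : seq bool -> seq nat -> bool) : Prop :=
  definable (fun w e => P w e : nat).

Lemma definable_ext F G : definable F -> F =2 G -> definable G.
Proof. by move=> [t ht] h; exists t => w e; rewrite ht. Qed.

(** Weakening of de Bruijn indices: a fresh variable is inserted at index [c]. *)
Fixpoint shift (c : nat) (t : term) : term :=
  match t with
  | TVar i => TVar (if i < c then i else i.+1)
  | TLen => TLen
  | TOne => TOne
  | TAdd a b => TAdd (shift c a) (shift c b)
  | TSub a b => TSub (shift c a) (shift c b)
  | TSum a b => TSum (shift c a) (shift c.+1 b)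
  | TBit a => TBit (shift c a)
  end.

Lemma eval_shift w t c e e' :
  (forall i, nth 0 e (if i < c then i else i.+1) = nth 0 e' i) ->
  eval w (shift c t) e = eval w t e'.
Proof.
elim: t c e e' => [i|||a IHa b IHb|a IHa b IHb|a IHa b IHb|a IHa] c e e' h //=;
  rewrite ?(IHa c e e') // ?(IHb c e e') //.
apply: eq_bigr => j _; apply: IHb => -[|i] //=; rewrite ltnS -h.
by case: ifP.
Qed.

Lemma definable_behead F : definable F -> definable (fun w e => F w (behead e)).
Proof.
move=> [t ht]; exists (shift 0 t) => w e; rewrite -ht; apply: eval_shift => i.
by rewrite nth_behead.
Qed.

Lemma definable_head : definable (fun w e => head 0 e).
Proof. by exists (TVar 0) => w e; rewrite /= nth0. Qed.

Lemma definable_size : definable (fun w e => size w).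
Proof. by exists TLen. Qed.

Lemma definable_add F G : definable F -> definable G ->
  definable (fun w e => F w e + G w e).
Proof. by move=> [t ht] [u hu]; exists (TAdd t u) => w e; rewrite /= ht hu. Qed.

Lemma definable_sub F G : definable F -> definable G ->
  definable (fun w e => F w e - G w e).
Proof. by move=> [t ht] [u hu]; exists (TSub t u) => w e; rewrite /= ht hu. Qed.

Lemma definable_const n : definable (fun w e => n).
Proof.
elim: n => [|n IH]; first by exists (TSub TOne TOne).
by apply: definable_ext (definable_add IH (ex_intro _ TOne _)) _ => // w e; rewrite addn1.
Qed.

Lemma definable_succ F : definable F -> definable (fun w e => (F w e).+1).
Proof.
by move=> h; apply: definable_ext (definable_add h (definable_const 1)) _ => w e;
   rewrite addn1.
Qed.

Lemma definable_sum F G : definable F ->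
  definable (fun w e => G w (behead e) (head 0 e)) ->
  definable (fun w e => \sum_(j < F w e) G w e j).
Proof.
move=> [t ht] [u hu]; exists (TSum t u) => w e /=; rewrite ht.
by apply: eq_bigr => j _; rewrite hu.
Qed.

Lemma definable_mul F G : definable F -> definable G ->
  definable (fun w e => F w e * G w e).
Proof.
move=> hF hG.
apply: definable_ext (definable_sum (G := fun w e _ => G w e) hF (definable_behead hG)) _.
by move=> w e; rewrite sum_nat_const card_ord.
Qed.

(** The exponent is a constant of the term; a variable exponent would leave the polynomially bounded
    functions. *)
Lemma definable_expn F n : definable F -> definable (fun w e => F w e ^ n).
Proof.
move=> hF; elim: n => [|n IH]; first exact: definable_const.
by apply: definable_ext (definable_mul hF IH) _ => w e; rewrite expnS.
Qed.

Lemma decidable_bit F : definable F ->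
  decidable_rel (fun w e => nth false w (F w e)).
Proof. by move=> [t ht]; exists (TBit t) => w e; rewrite /= ht. Qed.

Lemma decidable_const b : decidable_rel (fun w e => b).
Proof. exact: definable_const. Qed.

Lemma decidable_not P : decidable_rel P -> decidable_rel (fun w e => ~~ P w e).
Proof.
move=> h; apply: definable_ext (definable_sub (definable_const 1) h) _ => w e.
by case: (P w e).
Qed.

Lemma decidable_and P Q : decidable_rel P -> decidable_rel Q ->
  decidable_rel (fun w e => P w e && Q w e).
Proof.
move=> hP hQ; apply: definable_ext (definable_mul hP hQ) _ => w e.
by rewrite mulnb.
Qed.

Lemma decidable_or P Q : decidable_rel P -> decidable_rel Q ->
  decidable_rel (fun w e => P w e || Q w e).
Proof.
move=> hP hQ; apply: definable_ext
  (decidable_not (decidable_and (decidable_not hP) (decidable_not hQ))) _ => w e.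
by rewrite negb_and !negbK.
Qed.

Lemma decidable_imply P Q : decidable_rel P -> decidable_rel Q ->
  decidable_rel (fun w e => P w e ==> Q w e).
Proof.
move=> hP hQ; apply: definable_ext (decidable_or (decidable_not hP) hQ) _ => w e.
by rewrite implybE.
Qed.

Lemma decidable_leq F G : definable F -> definable G ->
  decidable_rel (fun w e => F w e <= G w e).
Proof.
move=> hF hG.
apply: definable_ext (definable_sub (definable_const 1) (definable_sub hF hG)) _ => w e.
by rewrite /leq; case: (F w e - G w e).
Qed.

Lemma decidable_ltn F G : definable F -> definable G ->
  decidable_rel (fun w e => F w e < G w e).
Proof. by move=> hF hG; apply: decidable_leq => //; apply: definable_succ. Qed.

Lemma decidable_eqn F G : definable F -> definable G ->
  decidable_rel (fun w e => F w e == G w e).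
Proof.
move=> hF hG; apply: definable_ext (decidable_and (decidable_leq hF hG)
  (decidable_leq hG hF)) _ => w e.
by rewrite -eqn_leq.
Qed.

Lemma decidable_eqb P Q : decidable_rel P -> decidable_rel Q ->
  decidable_rel (fun w e => P w e == Q w e).
Proof.
move=> hP hQ; apply: definable_ext (decidable_eqn hP hQ) _ => w e.
by case: (P w e); case: (Q w e).
Qed.

Lemma decidable_addb P Q : decidable_rel P -> decidable_rel Q ->
  decidable_rel (fun w e => P w e (+) Q w e).
Proof.
move=> hP hQ; apply: definable_ext (decidable_not (decidable_eqb hP hQ)) _ => w e.
by case: (P w e); case: (Q w e).
Qed.

Lemma definable_if P F G : decidable_rel P -> definable F -> definable G ->
  definable (fun w e => if P w e then F w e else G w e).
Proof.
move=> hP hF hG; apply: definable_ext (definable_add (definable_mul hP hF)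
  (definable_mul (decidable_not hP) hG)) _ => w e.
by case: (P w e); rewrite !(mul0n, mul1n, addn0).
Qed.

Lemma decidable_if P Q R : decidable_rel P -> decidable_rel Q -> decidable_rel R ->
  decidable_rel (fun w e => if P w e then Q w e else R w e).
Proof.
move=> hP hF hG; apply: definable_ext (definable_if hP hF hG) _ => w e.
by case: (P w e).
Qed.

Lemma cntnE n P : cntn n P = \sum_(j < n) P j.
Proof.
rewrite /cntn -sum1_count big_mkcond -(big_mkord xpredT (fun j => P j : nat)).
by rewrite /index_iota subn0; apply: eq_bigr => j _; case: (P j).
Qed.

Lemma exnP n (P : nat -> bool) : reflect (exists2 j, j < n & P j) (exn n P).
Proof.
by apply: (iffP hasP) => -[j hj hP]; exists j; rewrite // mem_iota in hj *.
Qed.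

Lemma allnP n (P : nat -> bool) : reflect (forall j, j < n -> P j) (alln n P).
Proof.
by apply: (iffP allP) => h j hj; apply: h; rewrite // mem_iota in hj *.
Qed.

Lemma exn_ordP n (P : nat -> bool) : reflect (exists j : 'I_n, P j) (exn n P).
Proof.
apply: (iffP (exnP _ _)) => [[j hj h]|[j h]]; last by exists j.
by exists (Ordinal hj).
Qed.

Lemma alln_ordP n (P : nat -> bool) : reflect (forall j : 'I_n, P j) (alln n P).
Proof.
apply: (iffP (allnP _ _)) => [h j|h j hj]; first exact: h.
exact: (h (Ordinal hj)).
Qed.

Lemma definable_cntn F P : definable F ->
  decidable_rel (fun w e => P w (behead e) (head 0 e)) ->
  definable (fun w e => cntn (F w e) (P w e)).
Proof.
move=> hF hP.
apply: definable_ext (definable_sum (G := fun w e j => P w e j : nat) hF hP) _.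
by move=> w e; rewrite cntnE.
Qed.

Lemma decidable_exn F P : definable F ->
  decidable_rel (fun w e => P w (behead e) (head 0 e)) ->
  decidable_rel (fun w e => exn (F w e) (P w e)).
Proof.
move=> hF hP; apply: definable_ext
  (decidable_ltn (definable_const 0) (definable_cntn hF hP)) _ => w e.
by rewrite /exn has_count.
Qed.

Lemma decidable_alln F P : definable F ->
  decidable_rel (fun w e => P w (behead e) (head 0 e)) ->
  decidable_rel (fun w e => alln (F w e) (P w e)).
Proof.
move=> hF hP; apply: definable_ext (decidable_eqn (definable_cntn hF hP) hF) _ => w e.
by rewrite /alln all_count size_iota.
Qed.

(** The list is fixed, so the disjunction is written out in the term. *)
Lemma decidable_has (s : seq nat) P : (forall p, decidable_rel (P p)) ->
  decidable_rel (fun w e => has (fun p => P p w e) s).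
Proof.
move=> h; elim: s => [|p s IH] /=; first exact: decidable_const.
exact: decidable_or.
Qed.

Lemma cntn_lt a n : a <= n -> cntn n (fun i => i < a) = a.
Proof.
move=> le; rewrite /cntn -(subnKC le) iotaD count_cat.
rewrite (eq_in_count (a2 := xpredT)); last by move=> q; rewrite mem_iota add0n => /andP[_ ->].
rewrite count_predT size_iota (eq_in_count (a2 := xpred0)) ?count_pred0 ?addn0 //.
by move=> q; rewrite mem_iota /=; lia.
Qed.

Lemma definable_divn F G : definable F -> definable G ->
  definable (fun w e => F w e %/ G w e).
Proof.
move=> hF hG.
(* The quotient counts the q with (q+1) G <= F; the conjunct [0 < G w e] reproduces the convention
   that division by 0 gives 0. *)
have h : definable (fun w e => cntn (F w e)
    (fun q => (0 < G w e) && (q.+1 * G w e <= F w e))).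
  apply: definable_cntn => //; apply: decidable_and.
    by apply: decidable_ltn; [apply: definable_const | apply: definable_behead].
  apply: decidable_leq; last exact: definable_behead.
  apply: definable_mul; last exact: definable_behead.
  by apply: definable_succ; apply: definable_head.
apply: definable_ext h _ => w e; move: (F w e) (G w e) => a b.
case: (posnP b) => [->|b0].
  by rewrite divn0; apply/eqP; rewrite -leqn0 leqNgt -has_count; apply/hasPn.
rewrite -[RHS](cntn_lt (leq_div a b)); apply: eq_count => q /=.
by rewrite leq_divRL.
Qed.

Lemma definable_modn F G : definable F -> definable G ->
  definable (fun w e => F w e %% G w e).
Proof.
move=> hF hG; apply: definable_ext (definable_sub hF
  (definable_mul (definable_divn hF hG) hG)) _ => w e.
by rewrite {1}(divn_eq (F w e) (G w e)) addKn.
Qed.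

(** * Arcs that cannot be deleted *)

Lemma connect_homo (T U : finType) (e : rel T) (e' : rel U) (f : T -> U) :
  (forall u v, e u v -> connect e' (f u) (f v)) ->
  forall u v, connect e u v -> connect e' (f u) (f v).
Proof.
move=> h u v /connectP[p]; elim: p u => [|x p IH] u /=; first by move=> _ ->.
by case/andP=> /h hu /IH{}IH /IH; apply: connect_trans.
Qed.

Definition set2_of (T : finType) (r : rel T) : {set {set T}} :=
  [set [set p.1; p.2] | p in [set p : T * T | r p.1 p.2]].

Lemma mem_set2_of (T : finType) (r : rel T) : symmetric r -> forall i j,
  ([set i; j] \in set2_of r) = r i j.
Proof.
move=> sr i j; apply/imsetP/idP => [[[a b]]|h]; last by exists (i, j); rewrite ?inE.
rewrite inE /= => h e.
have : i \in [set a; b] by rewrite -e !inE eqxx.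
have : j \in [set a; b] by rewrite -e !inE eqxx orbT.
have : a \in [set i; j] by rewrite e !inE eqxx.
have : b \in [set i; j] by rewrite e !inE eqxx orbT.
rewrite !inE => /orP[]/eqP hb /orP[]/eqP ha /orP[]/eqP hj /orP[]/eqP hi;
  by subst; rewrite // sr.
Qed.

Lemma ltn_mixed a b n m : a < n -> b < m -> a * m + b < n * m.
Proof.
move=> ha hb; apply: (@leq_trans (a.+1 * m)); last by rewrite leq_mul2r ha orbT.
by rewrite mulSn addnC ltn_add2r.
Qed.

Section HardArcs.
Variables (nv K : nat) (soft hard req : nat -> nat -> bool).

(** Arcs form a set, so there are no parallel arcs: an undeletable arc becomes [K.+1] paths of
    length two through dummy vertices. Dummies exist for all pairs and are isolated for pairs that
    are not hard. *)
Definition nhard : nat := nv * nv * K.+1.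

Definition hard_pair (z : nat) : nat := (z - nv) %/ K.+1.

Definition arc_of (x y : nat) : bool :=
  if x < nv then
    if y < nv then soft x y && (x != y)
    else (hard_pair y %/ nv == x) && hard (hard_pair y %/ nv) (hard_pair y %% nv)
  else [&& y < nv, hard_pair x %% nv == y & hard (hard_pair x %/ nv) (hard_pair x %% nv)].

Definition req_of (x y : nat) : bool :=
  [&& x < nv, y < nv, x != y & req x y || req y x].

Lemma req_of_sym : symmetric req_of.
Proof. by move=> x y; rewrite /req_of eq_sym orbC andbCA. Qed.

Definition arcs_of : {set 'I_(nv + nhard) * 'I_(nv + nhard)} :=
  [set p | arc_of (val p.1) (val p.2)].

Definition reqs_of : {set {set 'I_(nv + nhard)}} :=
  set2_of (fun i j : 'I_(nv + nhard) => req_of i j).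

Lemma mem_reqs_of i j : ([set i; j] \in reqs_of) = req_of i j.
Proof. by rewrite mem_set2_of // => x y; apply: req_of_sym. Qed.

Lemma arcs_of_irr v : (v, v) \notin arcs_of.
Proof. by rewrite inE /arc_of /=; case: (v < nv); rewrite ?eqxx ?andbF. Qed.

Lemma reqs_of_card p : p \in reqs_of -> #|p| = 2.
Proof.
by case/imsetP=> -[a b]; rewrite inE /= => /and4P[_ _ ne _] ->; rewrite cards2 ne.
Qed.

Definition left_over (Y : {set 'I_nv * 'I_nv}) : rel 'I_nv := fun u v =>
  hard u v || soft u v && ((u, v) \notin Y).

Definition hard_solution (Y : {set 'I_nv * 'I_nv}) : Prop :=
  #|Y| <= K /\ forall s t : 'I_nv, s != t -> req s t || req t s ->
    ~~ (connect (left_over Y) s t && connect (left_over Y) t s).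

Definition dummy (u v : 'I_nv) (c : 'I_K.+1) : 'I_(nv + nhard).
Proof.
refine (rshift nv (@Ordinal nhard ((u * nv + v) * K.+1 + c) _)).
abstract (by apply: ltn_mixed => //; apply: ltn_mixed).
Defined.

Lemma hard_pair_dummy u v c : hard_pair (dummy u v c) = u * nv + v.
Proof. by rewrite /hard_pair /= addKn divnMDl // divn_small ?addn0. Qed.

Lemma hard_pair_div (u v : 'I_nv) : (u * nv + v) %/ nv = u.
Proof. by have := ltn_ord v => hv; rewrite divnMDl ?divn_small ?addn0 //; lia. Qed.

Lemma hard_pair_mod (u v : 'I_nv) : (u * nv + v) %% nv = v.
Proof. by rewrite modnMDl modn_small. Qed.

Lemma hard_arcsP :
  (exists X, symmetric_multicut arcs_of reqs_of X /\ #|X| <= K) <->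
  (exists Y, hard_solution Y).
Proof.
pose f u : 'I_(nv + nhard) := lshift nhard u.
have fI : injective f by apply: lshift_inj.
pose ff (p : 'I_nv * 'I_nv) := (f p.1, f p.2).
have ffI : injective ff by move=> [a b] [c d] [] e1 e2; congr pair; apply/val_inj.
split=> [[X [[sX hX] cX]]|[Y [cY hY]]].
  pose Y := ff @^-1: X; exists Y.
  have step u v : left_over Y u v ->
      connect [rel u v | (u, v) \in arcs_of :\: X] (f u) (f v).
    case: (eqVneq u v) => [-> //|ne].
    case/orP=> [h|/andP[h]]; last first.
      rewrite inE /= => nX; apply: connect1; rewrite /= !inE nX /=.
      by rewrite /arc_of /= !ltn_ord h.
    (* If all [K.+1] detours were hit, picking one deleted arc on each would inject [K.+1] indices
       into [X]. *)
    have [c hc] : exists c, ((f u, dummy u v c) \notin X) && ((dummy u v c, f v) \notin X).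
      apply/existsP; apply/contraT; rewrite negb_exists => /forallP hall.
      pose g c := if (f u, dummy u v c) \in X then (f u, dummy u v c) else (dummy u v c, f v).
      have dI : injective (dummy u v).
        move=> c c' /(congr1 val) /= /eqP; rewrite !eqn_add2l => /eqP e; exact/val_inj.
      have nd c w : f w != dummy u v c.
        by apply/eqP => /(congr1 val) /=; have := ltn_ord w; lia.
      have gI : injective g.
        move=> c c'; rewrite /g; do 2 case: ifP => _.
        - by move/(congr1 snd); apply: dI.
        - by move/(congr1 fst)/eqP; rewrite (negbTE (nd _ _)).
        - by move/(congr1 fst)/eqP; rewrite eq_sym (negbTE (nd _ _)).
        - by move/(congr1 fst); apply: dI.
      have : g @: setT \subset X.
        apply/subsetP => _ /imsetP[c _ ->]; have := hall c; rewrite /g.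
        by case: ifP => //= _; rewrite negbK.
      move/subset_leq_card; rewrite card_imset // cardsT card_ord => /leq_trans/(_ cX).
      by rewrite ltnn.
    have [h1 h2] := andP hc.
    have fN w : (f w < nv) = true by rewrite /= ltn_ord.
    have dN : (dummy u v c < nv) = false by rewrite /= ltnNge leq_addr.
    apply: (@connect_trans _ _ (dummy u v c)); apply: connect1; rewrite /= !inE ?h1 ?h2 /=.
      rewrite /arc_of fN dN /=.
      by rewrite hard_pair_dummy hard_pair_div hard_pair_mod h eqxx.
    rewrite /arc_of fN dN /=.
    by rewrite hard_pair_dummy hard_pair_div hard_pair_mod h eqxx.
  split=> [|s t ne hr].
    apply: leq_trans cX; rewrite -(card_imset _ ffI); apply: subset_leq_card.
    by apply/subsetP => q /imsetP[p + ->]; rewrite inE.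
  have hp : [set f s; f t] \in reqs_of.
    by rewrite mem_reqs_of /req_of /= !ltn_ord hr andbT; rewrite -val_eqE in ne.
  apply: contra (hX _ _ hp) => /andP[h1 h2]; apply/andP.
  by split; apply: (connect_homo step).
pose X := [set p in arcs_of | p \in ff @: Y]; exists X; split; last first.
  apply: leq_trans cY; rewrite -(card_imset _ ffI); apply: subset_leq_card.
  by apply/subsetP => p; rewrite inE => /andP[].
split=> [|s' t']; first by apply/subsetP => p; rewrite inE => /andP[].
rewrite mem_reqs_of => /and4P[hs ht ne hr].
pose s := Ordinal hs; pose t := Ordinal ht.
have es : s' = f s by apply/val_inj.
have et : t' = f t by apply/val_inj.
have hne : s != t by rewrite -val_eqE.
apply: contra (hY s t hne hr); rewrite es et.
(* Contracting each dummy into its tail turns its incoming arc into a point and its outgoing arc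
   into the hard arc. *)
pose pi (x : 'I_(nv + nhard)) : 'I_nv :=
  if x < nv then insubd s (val x) else insubd s (hard_pair x %/ nv).
have pif u : pi (f u) = u.
  by rewrite /pi /= ltn_ord; apply/val_inj; rewrite val_insubd ltn_ord.
have nv0 : 0 < nv by apply: leq_ltn_trans (ltn_ord s).
have hp (x : 'I_(nv + nhard)) : nv <= x -> hard_pair x < nv * nv.
  by move=> hx; rewrite /hard_pair ltn_divLR //; have := ltn_ord x; rewrite /nhard; lia.
have step x y : (x, y) \in arcs_of :\: X -> connect (left_over Y) (pi x) (pi y).
  rewrite !inE /= => /andP[hX ha]; move: (ha); rewrite ha /= in hX.
  rewrite /arc_of /pi; case: ltnP => hx; case: ltnP => hy //.
  - case/andP=> h _; apply: connect1; rewrite /left_over !val_insubd hx hy h /=.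
    apply/orP; right; apply: contra hX => hYY; apply/imsetP; eexists; first exact: hYY.
    by congr pair; apply/val_inj; rewrite /= val_insubd ?hx ?hy.
  - case/andP=> /eqP e h; rewrite [X in connect _ X _](_ : _ = insubd s (hard_pair y %/ nv)) //.
    by rewrite e.
  - case/and3P=> _ /eqP e h; apply: connect1; rewrite /left_over !val_insubd hy.
    by rewrite ltn_divLR // hp //; move: h; rewrite e => ->.
by case/andP=> h1 h2; apply/andP; split; rewrite -[s]pif -[t]pif; apply: connect_homo (step) _ _ _.
Qed.

End HardArcs.

(** * The gadget for a bipartite constraint satisfaction problem *)

Definition digit (B v p : nat) : nat := v %/ B ^ p %% B.

Definition undigits (B : nat) (s : seq nat) : nat :=
  foldr (fun d x => x * B + d) 0 s.

Lemma digit_undigits B s p : all (fun d => d < B) s -> p < size s ->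
  digit B (undigits B s) p = nth 0 s p.
Proof.
rewrite /digit; elim: s p => [|d s IH] [|p] //= /andP[hd hs] hp.
  by rewrite expn0 divn1 modnMDl modn_small.
by rewrite expnS divnMA divnMDl ?(leq_ltn_trans _ hd) // (divn_small hd) addn0 IH.
Qed.

Lemma undigits_lt B s : all (fun d => d < B) s -> undigits B s < B ^ size s.
Proof.
elim: s => //= d s IH /andP[hd hs]; rewrite expnSr; exact: ltn_mixed (IH hs) hd.
Qed.

Section Gadget.
(* Rows and columns are numbered below [N] and take values below [D];
   [forb i a j b] forbids value [a] for row [i] with value [b] for column [j]. *)
Variables (N D m : nat) (forb : nat -> nat -> nat -> nat -> bool).
Variable wr : nat -> nat -> bool.

(** Large enough for every coordinate to be a digit: a tag below 8, the index of a variable or node,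
    a position up to [D]. Numbers that code nothing are isolated vertices. *)
Definition vbase : nat := 8 + N + D + m.
Definition nvert : nat := vbase ^ 5.

Definition code (g i j a b : nat) : nat := undigits vbase [:: b; a; j; i; g].
(* [hub 0], [hub 1], [hub 2] are S, M, T.  [chn y r i a] is the vertex at position
   [a] on the path of variable [i], a row if [y = 1] and a column if [y = 0]; the
   copy [r = 1] is the reversed one.  [sv] and [tv] are the vertices s, t that
   forbid a pair of values, [nd] are the nodes of the circuit. *)
Definition hub h := code 0 h 0 0 0.
Definition chn y r i a := code (1 + 2 * y + r) i 0 a 0.
Definition sv i a j b := code 5 i j a b.
Definition tv i a j b := code 6 i j a b.
Definition nd i := code 7 i 0 0 0.

Definition soft (u v : nat) : bool :=
  exn 2 (fun y => exn 2 (fun r => exn N (fun i => exn D (fun a =>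
    (u == chn y r i a) && (v == chn y r i a.+1))))).

(** Every path vertex sits between its lower and upper hub, while the path leads from the upper hub
    back to the lower one; left uncut, it would join the two hubs. *)
Definition hard_chain (u v : nat) : bool :=
  exn 2 (fun y => exn 2 (fun r => exn N (fun i => exn D.+1 (fun a =>
    [|| (u == hub y) && (v == chn y r i a),
        (u == chn y r i a) && (v == hub y.+1),
        [&& a == 0, u == hub y.+1 & v == chn y r i a] |
        [&& a == D, u == chn y r i a & v == hub y]])))).

(** For cuts at f and h: the row vertex [a.+1] is on the M side iff f <= a, the vertex [D - a] of
    the reversed copy iff f >= a; the column vertex [b] iff h >= b, and [D - b.+1] of its copy iff h
    <= b. *)
Definition hard_forb (u v : nat) : bool :=
  exn N (fun i => exn N (fun j => exn D (fun a => exn D (fun b =>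
    forb i a j b &&
    [|| (u == sv i a j b) && (v == chn 1 0 i a.+1),
        (u == chn 0 0 j b) && (v == tv i a j b),
        (u == tv i a j b) && (v == chn 1 1 i (D - a)) |
        (u == chn 0 1 j (D - b.+1)) && (v == sv i a j b)])))).

Definition circuit_arc (u v : nat) : bool :=
  exn m (fun i => exn m (fun j => [&& wr i j, u == nd i & v == nd j])).

Definition hard (u v : nat) : bool :=
  [|| hard_chain u v, hard_forb u v | circuit_arc u v].

(** The pair S, T is implied: hard arcs lead from S to M and from M to T, so T reaching S would join
    T and M. *)
Definition req_hub (u v : nat) : bool :=
  exn 2 (fun y => (u == hub y) && (v == hub y.+1)).

Definition req_chain (u v : nat) : bool :=
  exn 2 (fun y => exn N (fun i => exn D.+1 (fun a =>
    (u == chn y 0 i a) && (v == chn y 1 i (D - a))))).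

Definition req_forb (u v : nat) : bool :=
  exn N (fun i => exn N (fun j => exn D (fun a => exn D (fun b =>
    [&& forb i a j b, u == sv i a j b & v == tv i a j b])))).

Definition req (u v : nat) : bool :=
  [|| req_hub u v, req_chain u v, req_forb u v | circuit_arc u v].

Definition csp_solution (f h : nat -> nat) : Prop :=
  [/\ forall i, i < N -> f i < D, forall j, j < N -> h j < D &
      forall i j, i < N -> j < N -> ~~ forb i (f i) j (h j)].

Definition wires : rel 'I_m := fun i j => wr i j.

(** A request has two distinct ends and cannot detect a loop; loops are tested in [well_shaped]. *)
Definition acyclic_wires : Prop :=
  forall i j, i != j -> wires i j -> ~~ connect wires j i.

Lemma code_lt g i j a b : g < 8 -> i < vbase -> j < vbase -> a < vbase -> b < vbase ->
  code g i j a b < nvert.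
Proof.
move=> hg hi hj ha hb; apply: (@undigits_lt vbase [:: b; a; j; i; g]).
by rewrite /= hi hj ha hb /vbase; lia.
Qed.

Lemma digits_code g i j a b : g < 8 -> i < vbase -> j < vbase -> a < vbase -> b < vbase ->
  [/\ digit vbase (code g i j a b) 4 = g, digit vbase (code g i j a b) 3 = i,
      digit vbase (code g i j a b) 2 = j, digit vbase (code g i j a b) 1 = a &
      digit vbase (code g i j a b) 0 = b].
Proof.
move=> hg hi hj ha hb.
have h : all (fun d => d < vbase) [:: b; a; j; i; g].
  by rewrite /= hi hj ha hb /vbase; lia.
by split; rewrite /code digit_undigits.
Qed.

Lemma vbaseE x : x < N \/ x < m \/ x <= D \/ x < 8 -> x < vbase.
Proof. by rewrite /vbase; lia. Qed.

Lemma hub_lt h : h < 3 -> hub h < nvert.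
Proof. by move=> hh; apply: code_lt => //; apply: vbaseE; lia. Qed.
Lemma chn_lt y r i a : y < 2 -> r < 2 -> i < N -> a <= D -> chn y r i a < nvert.
Proof. by move=> hy hr hi ha; apply: code_lt; try lia; apply: vbaseE; lia. Qed.
Lemma sv_lt i a j b : i < N -> a < D -> j < N -> b < D -> sv i a j b < nvert.
Proof. by move=> hi ha hj hb; apply: code_lt; try lia; apply: vbaseE; lia. Qed.
Lemma tv_lt i a j b : i < N -> a < D -> j < N -> b < D -> tv i a j b < nvert.
Proof. by move=> hi ha hj hb; apply: code_lt; try lia; apply: vbaseE; lia. Qed.
Lemma nd_lt i : i < m -> nd i < nvert.
Proof. by move=> hi; apply: code_lt; try lia; apply: vbaseE; lia. Qed.

Lemma hub_digits h : h < 3 ->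
  digit vbase (hub h) 4 = 0 /\ digit vbase (hub h) 3 = h.
Proof.
move=> hh; have hv : h < vbase by apply: vbaseE; lia.
by have [-> ->] := @digits_code 0 h 0 0 0 isT hv isT isT isT.
Qed.

Lemma chn_digits y r i a : y < 2 -> r < 2 -> i < N -> a <= D ->
  [/\ digit vbase (chn y r i a) 4 = 1 + 2 * y + r, digit vbase (chn y r i a) 3 = i &
      digit vbase (chn y r i a) 1 = a].
Proof.
move=> hy hr hi ha; have hg : 1 + 2 * y + r < 8 by lia.
have hv : i < vbase by apply: vbaseE; lia.
have hv' : a < vbase by apply: vbaseE; lia.
by have [-> -> _ -> _] := @digits_code _ i 0 a 0 hg hv isT hv' isT.
Qed.

Lemma sv_digits i a j b : i < N -> a < D -> j < N -> b < D ->
  [/\ digit vbase (sv i a j b) 4 = 5, digit vbase (sv i a j b) 3 = i,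
   digit vbase (sv i a j b) 2 = j, digit vbase (sv i a j b) 1 = a &
      digit vbase (sv i a j b) 0 = b].
Proof. by move=> hi ha hj hb; apply: digits_code; try lia; apply: vbaseE; lia. Qed.

Lemma tv_digits i a j b : i < N -> a < D -> j < N -> b < D ->
  [/\ digit vbase (tv i a j b) 4 = 6, digit vbase (tv i a j b) 3 = i,
   digit vbase (tv i a j b) 2 = j, digit vbase (tv i a j b) 1 = a &
      digit vbase (tv i a j b) 0 = b].
Proof. by move=> hi ha hj hb; apply: digits_code; try lia; apply: vbaseE; lia. Qed.

Lemma nd_digits i : i < m -> digit vbase (nd i) 4 = 7 /\ digit vbase (nd i) 3 = i.
Proof.
move=> hi; have hv : i < vbase by apply: vbaseE; lia.
by have [-> ->] := @digits_code 7 i 0 0 0 isT hv isT isT isT.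
Qed.

(** * From a multicut to a solution of the constraints *)

Section FromCut.
Variable Y : {set 'I_nvert * 'I_nvert}.
Hypotheses (N0 : 0 < N) (hY : hard_solution (4 * N) soft hard req Y).

Let e : rel 'I_nvert := left_over soft hard Y.

Lemma nvert_gt0 : 0 < nvert.
Proof. by rewrite expn_gt0 /vbase. Qed.

Definition ov (n : nat) : 'I_nvert := insubd (Ordinal nvert_gt0) n.

Lemma ovE n : n < nvert -> ov n = n :> nat.
Proof. by move=> h; rewrite val_insubd h. Qed.

Definition linked (u v : nat) : bool := connect e (ov u) (ov v).

Lemma linked_trans u v x : linked u v -> linked v x -> linked u x.
Proof. exact: connect_trans. Qed.

Lemma linked_hard u v : u < nvert -> v < nvert -> hard u v -> linked u v.
Proof. by move=> hu hv h; apply: connect1; rewrite /e /left_over !ovE // h. Qed.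

Lemma not_req u v : u < nvert -> v < nvert -> u != v -> req u v ->
  linked u v -> linked v u -> False.
Proof.
move=> hu hv ne hr h1 h2; have := hY.2 (ov u) (ov v).
by rewrite -val_eqE /= !ovE // ne hr -/e -!/(linked _ _) h1 h2 => /(_ isT isT).
Qed.

Definition cut_arc (y r i a : nat) := (ov (chn y r i a), ov (chn y r i a.+1)).

Lemma soft_linked y r i a : y < 2 -> r < 2 -> i < N -> a < D ->
  cut_arc y r i a \notin Y -> linked (chn y r i a) (chn y r i a.+1).
Proof.
move=> hy hr hi ha nY; apply: connect1; rewrite /e /left_over -/(cut_arc _ _ _ _) nY.
rewrite !ovE ?chn_lt // 1?ltnW // andbT; apply/orP; right.
apply/exnP; exists y => //; apply/exnP; exists r => //; apply/exnP; exists i => //.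
by apply/exnP; exists a => //; rewrite !eqxx.
Qed.

Lemma hard_chain_linked u v y r i a : u < nvert -> v < nvert ->
  y < 2 -> r < 2 -> i < N -> a <= D ->
  [|| (u == hub y) && (v == chn y r i a),
        (u == chn y r i a) && (v == hub y.+1),
        [&& a == 0, u == hub y.+1 & v == chn y r i a] |
        [&& a == D, u == chn y r i a & v == hub y]] -> linked u v.
Proof.
move=> hu hv hy hr hi ha h; apply: linked_hard => //; apply/or3P/Or31.
apply/exnP; exists y => //; apply/exnP; exists r => //; apply/exnP; exists i => //.
by apply/exnP; exists a.
Qed.

Lemma hub_up y r i a : y < 2 -> r < 2 -> i < N -> a <= D -> linked (hub y) (chn y r i a).
Proof.
move=> hy hr hi ha; apply: (hard_chain_linked (y := y) (r := r) (i := i) (a := a)) => //;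
  rewrite ?eqxx ?hub_lt ?chn_lt //; lia.
Qed.

Lemma up_hub y r i a : y < 2 -> r < 2 -> i < N -> a <= D -> linked (chn y r i a) (hub y.+1).
Proof.
move=> hy hr hi ha; apply: (hard_chain_linked (y := y) (r := r) (i := i) (a := a)) => //;
  rewrite ?eqxx ?orbT ?hub_lt ?chn_lt //; lia.
Qed.

Lemma hub_first y r i : y < 2 -> r < 2 -> i < N -> linked (hub y.+1) (chn y r i 0).
Proof.
move=> hy hr hi; apply: (hard_chain_linked (y := y) (r := r) (i := i) (a := 0)) => //;
  rewrite ?eqxx ?orbT ?hub_lt ?chn_lt //; lia.
Qed.

Lemma last_hub y r i : y < 2 -> r < 2 -> i < N -> linked (chn y r i D) (hub y).
Proof.
move=> hy hr hi; apply: (hard_chain_linked (y := y) (r := r) (i := i) (a := D)) => //;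
  rewrite ?eqxx ?orbT ?hub_lt ?chn_lt //; lia.
Qed.

Lemma chain_linked y r i a a' : y < 2 -> r < 2 -> i < N -> a <= a' <= D ->
  (forall c, a <= c < a' -> cut_arc y r i c \notin Y) ->
  linked (chn y r i a) (chn y r i a').
Proof.
move=> hy hr hi; elim: a' => [|a' IH] ha hc.
  by rewrite (_ : a = 0); [apply: connect0 | lia].
case: (eqVneq a a'.+1) => [->|ne]; first exact: connect0.
apply: (@linked_trans _ (chn y r i a')).
  by apply: IH => [|c hc']; [lia | apply: hc; lia].
by apply: soft_linked; try lia; apply: hc; lia.
Qed.

Definition pos y r i := find (fun a => cut_arc y r i a \in Y) (iota 0 D).

(** Without a cut on the path the lower hub reaches the upper one through any path vertex, and the
    path leads back. *)
Lemma posP y r i : y < 2 -> r < 2 -> i < N ->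
  pos y r i < D /\ cut_arc y r i (pos y r i) \in Y.
Proof.
move=> hy hr hi; case: (boolP (has (fun a => cut_arc y r i a \in Y) (iota 0 D))) => h.
  have hp : pos y r i < D by move: h; rewrite has_find size_iota.
  by split=> //; have := nth_find 0 h; rewrite nth_iota.
exfalso; apply: (@not_req (hub y) (hub y.+1)).
- by apply: hub_lt; lia.
- by apply: hub_lt; lia.
- apply/eqP => hh; have [|_] := @hub_digits y; first by lia.
  by rewrite hh; have [|_ ->] := @hub_digits y.+1; lia.
- by apply/or4P/Or41; apply/exnP; exists y; rewrite // !eqxx.
- apply: (@linked_trans _ (chn y r i 0)); [exact: hub_up | exact: up_hub].
- apply: linked_trans (hub_first hy hr hi) _; apply: linked_trans (last_hub hy hr hi).
  apply: chain_linked => //; first by lia.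
  move=> c hc; apply: contra h => hc'; apply/hasP; exists c => //.
  by rewrite mem_iota; lia.
Qed.

Lemma chn_inj y r i a y' r' i' a' : y < 2 -> r < 2 -> i < N -> a <= D ->
  y' < 2 -> r' < 2 -> i' < N -> a' <= D -> chn y r i a = chn y' r' i' a' ->
  [/\ y = y', r = r', i = i' & a = a'].
Proof.
move=> h1 h2 h3 h4 h1' h2' h3' h4' hh.
have [d1 d2 d3] := chn_digits h1 h2 h3 h4.
have [] := chn_digits h1' h2' h3' h4'; rewrite -hh d1 d2 d3 => *; split; lia.
Qed.

(** Pigeonhole: [posP] gives [4 * N] distinct arcs of [Y], which exhausts the budget, so [Y] has
    exactly one arc on each path. *)
Lemma pos_unique y r i a : y < 2 -> r < 2 -> i < N -> a < D ->
  cut_arc y r i a \in Y -> a = pos y r i.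
Proof.
pose F (c : 'I_2 * 'I_2 * 'I_N) := let: (y, r, i) := c in cut_arc y r i (pos y r i).
have arc_inj y1 r1 i1 a1 y2 r2 i2 a2 : y1 < 2 -> r1 < 2 -> i1 < N -> a1 < D ->
    y2 < 2 -> r2 < 2 -> i2 < N -> a2 < D -> cut_arc y1 r1 i1 a1 = cut_arc y2 r2 i2 a2 ->
    [/\ y1 = y2, r1 = r2, i1 = i2 & a1 = a2].
  move=> h1 h2 h3 h4 h1' h2' h3' h4' /(congr1 fst)/(congr1 val).
  have l1 : chn y1 r1 i1 a1 < nvert by apply: chn_lt => //; apply: ltnW.
  have l2 : chn y2 r2 i2 a2 < nvert by apply: chn_lt => //; apply: ltnW.
  rewrite /= !ovE // => hh.
  exact: (chn_inj h1 h2 h3 (ltnW h4) h1' h2' h3' (ltnW h4') hh).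
have FI : injective F.
  move=> [[y1 r1] i1] [[y2 r2] i2] /arc_inj [] //.
  - by case: (posP (ltn_ord y1) (ltn_ord r1) (ltn_ord i1)).
  - by case: (posP (ltn_ord y2) (ltn_ord r2) (ltn_ord i2)).
  by move=> /val_inj -> /val_inj -> /val_inj ->.
have FY : F @: setT = Y.
  apply/eqP; rewrite eqEcard; apply/andP; split.
    apply/subsetP => _ /imsetP[[[y1 r1] i1] _ ->].
    by case: (posP (ltn_ord y1) (ltn_ord r1) (ltn_ord i1)).
  by rewrite card_imset // cardsT !card_prod !card_ord (leq_trans hY.1).
move=> hy hr hi ha; rewrite -FY => /imsetP[[[y1 r1] i1] _ /arc_inj[] //].
  by case: (posP (ltn_ord y1) (ltn_ord r1) (ltn_ord i1)).
by move=> -> -> -> ->.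
Qed.

Definition same u v := linked u v && linked v u.

Lemma same_sym u v : same u v -> same v u.
Proof. by rewrite /same andbC. Qed.

Lemma same_trans u v x : same u v -> same v x -> same u x.
Proof.
case/andP=> h1 h2 /andP[h3 h4]; apply/andP.
by split; [apply: linked_trans h1 h3 | apply: linked_trans h4 h2].
Qed.

Lemma chn_high y r i a : y < 2 -> r < 2 -> i < N -> a <= pos y r i ->
  same (chn y r i a) (hub y.+1).
Proof.
move=> hy hr hi ha; have [hp _] := posP hy hr hi.
apply/andP; split; first by apply: up_hub => //; lia.
apply: linked_trans (hub_first hy hr hi) _; apply: chain_linked => //; first by lia.
by move=> c hc; apply/negP => /pos_unique => /(_ hy hr hi); lia.
Qed.

Lemma chn_low y r i a : y < 2 -> r < 2 -> i < N -> pos y r i < a <= D ->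
  same (chn y r i a) (hub y).
Proof.
move=> hy hr hi ha; have [hp _] := posP hy hr hi.
apply/andP; split; last by apply: hub_up => //; lia.
apply: linked_trans (last_hub hy hr hi); apply: chain_linked => //; first by lia.
by move=> c hc; apply/negP => /pos_unique => /(_ hy hr hi); lia.
Qed.

Lemma not_same_copies y i a : y < 2 -> i < N -> a <= D ->
  ~ same (chn y 0 i a) (chn y 1 i (D - a)).
Proof.
move=> hy hi ha /andP[h1 h2].
apply: (@not_req (chn y 0 i a) (chn y 1 i (D - a))) => //; try by apply: chn_lt => //; lia.
- by apply/eqP => /chn_inj[] //; lia.
- apply/or4P/Or42; apply/exnP; exists y => //; apply/exnP; exists i => //.
  by apply/exnP; exists a; rewrite ?eqxx.
Qed.

(** The request just after the cut keeps the copies from both being low there, the one just before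
    it from both being high; this bounds the cut of the copy from both sides. *)
Lemma pos_copy y i : y < 2 -> i < N -> pos y 1 i = D - (pos y 0 i).+1.
Proof.
move=> hy hi; have [h0 _] := @posP y 0 i hy isT hi; have [h1 _] := @posP y 1 i hy isT hi.
case: (ltngtP (pos y 1 i) (D - (pos y 0 i).+1)) => // hh; exfalso.
  apply: (@not_same_copies y i (pos y 0 i).+1) => //.
  apply: (@same_trans _ (hub y)); first by apply: chn_low => //; lia.
  by apply: same_sym; apply: chn_low => //; lia.
apply: (@not_same_copies y i (pos y 0 i)) => //; first by lia.
apply: (@same_trans _ (hub y.+1)); first by apply: chn_high => //; lia.
by apply: same_sym; apply: chn_high => //; lia.
Qed.

Lemma hard_forb_linked i a j b u v : i < N -> j < N -> a < D -> b < D ->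
  forb i a j b -> u < nvert -> v < nvert ->
  [|| (u == sv i a j b) && (v == chn 1 0 i a.+1),
        (u == chn 0 0 j b) && (v == tv i a j b),
        (u == tv i a j b) && (v == chn 1 1 i (D - a)) |
        (u == chn 0 1 j (D - b.+1)) && (v == sv i a j b)] -> linked u v.
Proof.
move=> hi hj ha hb hf hu hv h; apply: linked_hard => //; apply/or3P/Or32.
apply/exnP; exists i => //; apply/exnP; exists j => //.
by apply/exnP; exists a => //; apply/exnP; exists b => //; rewrite hf.
Qed.

Lemma csp_of_cut : csp_solution (pos 1 0) (pos 0 0).
Proof.
split=> [i hi|j hj|i j hi hj]; try by case: (@posP 1 0 i) || case: (@posP 0 0 j).
apply/negP => hf; set a := pos 1 0 i in hf; set b := pos 0 0 j in hf.
have [ha _] := @posP 1 0 i isT isT hi; have [hb _] := @posP 0 0 j isT isT hj.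
have pc1 := @pos_copy 1 i isT hi; have pc0 := @pos_copy 0 j isT hj.
rewrite -/a in ha pc1; rewrite -/b in hb pc0.
have sl := sv_lt hi ha hj hb; have tl := tv_lt hi ha hj hb.
have HL := hard_forb_linked hi hj ha hb hf.
have := @chn_low 1 0 i a.+1 isT isT hi; rewrite -/a => /(_ _)/andP[|h1 _]; first by lia.
have := @chn_low 1 1 i (D - a) isT isT hi; rewrite pc1 => /(_ _)/andP[|h2 _]; first by lia.
have := @chn_high 0 0 j b isT isT hj (leqnn _) => /andP[_ h3].
have := @chn_high 0 1 j (D - b.+1) isT isT hj; rewrite pc0 => /(_ (leqnn _))/andP[_ h4].
apply: (@not_req (sv i a j b) (tv i a j b)) => //.
- apply/eqP => hh; have [d1 _ _ _ _] := sv_digits hi ha hj hb.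
  by have [] := tv_digits hi ha hj hb; rewrite -hh d1.
- apply/or4P/Or43; apply/exnP; exists i => //; apply/exnP; exists j => //.
  by apply/exnP; exists a => //; apply/exnP; exists b => //; rewrite hf !eqxx.
(* From s to the row, through the component of M to the column, and on to t; the way back uses the
   reversed copies. *)
- apply: (@linked_trans _ (chn 1 0 i a.+1)).
    by apply: HL; rewrite ?eqxx ?orbT ?chn_lt //.
  apply: linked_trans h1 _; apply: linked_trans h3 _.
  by apply: HL; rewrite ?eqxx ?orbT ?chn_lt //; lia.
- apply: (@linked_trans _ (chn 1 1 i (D - a))).
    by apply: HL; rewrite ?eqxx ?orbT ?chn_lt //; lia.
  apply: linked_trans h2 _; apply: linked_trans h4 _.
  by apply: HL; rewrite ?eqxx ?orbT ?chn_lt //; lia.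
Qed.

Lemma acyclic_of_cut : acyclic_wires.
Proof.
move=> i j ne hw; apply/negP => hc.
have hwl (i1 j1 : 'I_m) : wires i1 j1 -> connect e (ov (nd i1)) (ov (nd j1)).
  move=> h; apply: linked_hard; rewrite ?nd_lt //; apply/or3P/Or33.
  apply/exnP; exists i1 => //; apply/exnP; exists j1 => //; rewrite !eqxx !andbT.
  exact: h.
apply: (@not_req (nd i) (nd j)); rewrite ?nd_lt //.
- apply: contra ne => /eqP hh; have [_ d] := nd_digits (ltn_ord i).
  by have [_] := nd_digits (ltn_ord j); rewrite -hh d => /val_inj ->.
- apply/or4P/Or44; apply/exnP; exists i => //; apply/exnP; exists j => //.
  by rewrite !eqxx !andbT.
- exact: hwl.
- exact: (connect_homo (f := fun x : 'I_m => ov (nd x)) hwl hc).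
Qed.

End FromCut.
End Gadget.

(** * From a solution of the constraints to a multicut *)

Ltac split_if := repeat
  match goal with
  | |- context [if ?b then _ else _] => case: (boolP b) => ?
  end.

Section ToCut.
Variables (N D m : nat) (forb : nat -> nat -> nat -> nat -> bool).
Variable wr : nat -> nat -> bool.
Local Notation vbase := (vbase N D m).
Local Notation nvert := (nvert N D m).
Local Notation hub := (hub N D m).
Local Notation chn := (chn N D m).
Local Notation sv := (sv N D m).
Local Notation tv := (tv N D m).
Local Notation nd := (nd N D m).
Local Notation soft := (soft N D m).
Local Notation hard := (hard N D m forb wr).
Local Notation req := (req N D m forb wr).
Local Notation wires := (@wires m wr).

Variables f h : nat -> nat.
Hypothesis sol : csp_solution N D forb f h.
Hypothesis acyc : @acyclic_wires m wr.

Definition cut_pos (y r i : nat) : nat :=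
  let p := if y == 1 then f i else h i in if r == 0 then p else D - p.+1.

(** Quantifying over [z] makes this meaningful for any number, in particular for a digit of an
    arbitrary vertex. *)
Definition ancestors (i : nat) : {set 'I_m} :=
  [set x | [exists z : 'I_m, (z == i :> nat) && connect wires x z]].

(* Nondecreasing along the remaining arcs; the vertices s and t get values
   different from each other unless both are strongly connected to M. *)
Definition potential (v : nat) : nat :=
  let: (i, j, a, b) := (digit vbase v 3, digit vbase v 2, digit vbase v 1, digit vbase v 0) in
  match digit vbase v 4 with
  | 0 => 10 * i
  | 1 => if a <= cut_pos 0 0 i then 10 else 0
  | 2 => if a <= cut_pos 0 1 i then 10 else 0
  | 3 => if a <= cut_pos 1 0 i then 20 else 10
  | 4 => if a <= cut_pos 1 1 i then 20 else 10
  | 5 => if b < h j then 3 else if f i <= a then 10 else 13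
  | 6 => if h j < b then 5 else if a <= f i then 10 else 15
  | _ => #|ancestors i|
  end.

Lemma potential_hub y : y < 3 -> potential (hub y) = 10 * y.
Proof. by move=> hy; rewrite /potential; have [-> ->] := hub_digits N D m hy. Qed.

Lemma potential_chn y r i a : y < 2 -> r < 2 -> i < N -> a <= D ->
  potential (chn y r i a) = if a <= cut_pos y r i then 10 * y.+1 else 10 * y.
Proof.
move=> hy hr hi ha; rewrite /potential; have [-> -> ->] := chn_digits m hy hr hi ha.
by case: y hy => [|[|]] //; case: r hr => [|[|]].
Qed.

Lemma potential_sv i a j b : i < N -> a < D -> j < N -> b < D ->
  potential (sv i a j b) = if b < h j then 3 else if f i <= a then 10 else 13.
Proof.
by move=> hi ha hj hb; rewrite /potential;
   have [-> -> -> -> ->] := sv_digits m hi ha hj hb.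
Qed.

Lemma potential_tv i a j b : i < N -> a < D -> j < N -> b < D ->
  potential (tv i a j b) = if h j < b then 5 else if a <= f i then 10 else 15.
Proof.
by move=> hi ha hj hb; rewrite /potential;
   have [-> -> -> -> ->] := tv_digits m hi ha hj hb.
Qed.

Lemma potential_nd i : i < m -> potential (nd i) = #|ancestors i|.
Proof. by move=> hi; rewrite /potential; have [-> ->] := nd_digits N D hi. Qed.

Lemma mem_ancestors (x i : 'I_m) : (x \in ancestors i) = connect wires x i.
Proof.
rewrite inE; apply/existsP/idP => [[z /andP[/eqP/val_inj-> //]]|hc].
by exists i; rewrite eqxx.
Qed.

Lemma ancestors_leq i j : i < m -> j < m -> wr i j -> #|ancestors i| <= #|ancestors j|.
Proof.
move=> hi hj hw; apply: subset_leq_card; apply/subsetP => x.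
rewrite (mem_ancestors x (Ordinal hi)) (mem_ancestors x (Ordinal hj)) => hc.
by apply: connect_trans hc _; apply: connect1.
Qed.

Lemma ancestors_ltn i j : i < m -> j < m -> wr i j -> i != j ->
  #|ancestors i| < #|ancestors j|.
Proof.
move=> hi hj hw ne; apply: proper_card; apply/properP; split.
  apply/subsetP => x.
  rewrite (mem_ancestors x (Ordinal hi)) (mem_ancestors x (Ordinal hj)) => hc.
  by apply: connect_trans hc _; apply: connect1.
exists (Ordinal hj); first by rewrite (mem_ancestors _ (Ordinal hj)) connect0.
rewrite (mem_ancestors _ (Ordinal hi)).
exact: (@acyc (Ordinal hi) (Ordinal hj) _ hw).
Qed.

Definition cut_set : {set 'I_nvert * 'I_nvert} :=
  [set (ov N D m (chn (val c.1.1) (val c.1.2) (val c.2) (cut_pos c.1.1 c.1.2 c.2)),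
        ov N D m (chn (val c.1.1) (val c.1.2) (val c.2) (cut_pos c.1.1 c.1.2 c.2).+1))
   | c : 'I_2 * 'I_2 * 'I_N].

Lemma potential_hard u v : hard u v -> potential u <= potential v.
Proof.
have [hf hh hn] := sol.
case/or3P.
- case/exnP=> y hy /exnP[r hr /exnP[i hi /exnP[a ha]]].
  rewrite ltnS in ha.
  have hc : cut_pos y r i < D.
    by have := hf i hi; have := hh i hi; rewrite /cut_pos; case: (y == 1); case: (r == 0); lia.
  case/or4P=> [/andP[]|/andP[]|/and3P[/eqP a0]|/and3P[/eqP a0]] /eqP-> /eqP->;
  rewrite potential_chn // potential_hub; try lia; split_if; lia.
- case/exnP=> i hi /exnP[j hj /exnP[a ha /exnP[b hb /andP[_]]]].
  have hfi := hf i hi; have hhj := hh j hj.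
  case/or4P=> /andP[/eqP-> /eqP->].
  + rewrite (potential_sv hi ha hj hb) (potential_chn _ _ hi ha) // /cut_pos /=.
    by split_if; lia.
  + rewrite (potential_chn _ _ hj (ltnW hb)) // (potential_tv hi ha hj hb) /cut_pos /=.
    by split_if; lia.
  + rewrite (potential_tv hi ha hj hb) (potential_chn _ _ hi (leq_subr a D)) // /cut_pos /=.
    by split_if; lia.
  + rewrite (potential_chn _ _ hj (leq_subr b.+1 D)) // (potential_sv hi ha hj hb) /cut_pos /=.
    by split_if; lia.
- case/exnP=> i hi /exnP[j hj /and3P[hw /eqP-> /eqP->]].
  by rewrite !potential_nd //; apply: ancestors_leq.
Qed.

Lemma potential_soft (u v : 'I_nvert) : soft u v -> (u, v) \notin cut_set ->
  potential u <= potential v.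
Proof.
case/exnP=> y hy /exnP[r hr /exnP[i hi /exnP[a ha /andP[/eqP eu /eqP ev]]]].
rewrite eu ev (potential_chn hy hr hi (ltnW ha)) (potential_chn hy hr hi ha) => nY.
case: (leqP a (cut_pos y r i)) => h1; case: (ltnP a (cut_pos y r i)) => h2 //; try lia.
have ea : a = cut_pos y r i by lia.
case/negP: nY; apply/imsetP; exists (Ordinal hy, Ordinal hr, Ordinal hi) => //=.
congr pair; apply/val_inj; rewrite /= ovE -ea ?eu ?ev //.
  by apply: chn_lt => //; apply: ltnW.
exact: chn_lt.
Qed.

(** Strongly connected vertices have equal potential, so it is enough that the ends of each request
    differ in potential. *)
Lemma cut_set_solution : hard_solution (4 * N) soft hard req cut_set.
Proof.
have [hf hh hn] := sol.
split=> [|s t ne hr].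
  apply: leq_trans (leq_imset_card _ _) _.
  by rewrite !card_prod !card_ord.
have mono (u v : 'I_nvert) : connect (left_over soft hard cut_set) u v ->
    potential u <= potential v.
  case/connectP=> p; elim: p u => [|x p IH] u /=; first by move=> _ ->.
  case/andP=> hu /IH{}IH /IH; apply: leq_trans.
  by case/orP: hu => [/potential_hard|/andP[]] //; apply: potential_soft.
apply/negP => /andP[/mono h1 /mono h2].
have {h1 h2 mono} : potential s = potential t by apply/eqP; rewrite eqn_leq h1.
wlog {hr} hr : s t ne / req s t.
  move=> H; case/orP: hr => hr e; first exact: (H s t).
  by apply: (H t s) => //; rewrite eq_sym.
apply/eqP; case/or4P: hr.
- by case/exnP=> y hy /andP[/eqP-> /eqP->]; rewrite !potential_hub //; lia.
- case/exnP=> y hy /exnP[i hi /exnP[a ha /andP[/eqP-> /eqP->]]].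
  have := hf i hi; have := hh i hi.
  rewrite !potential_chn ?leq_subr // /cut_pos /=.
  by case: (y == 1); split_if; lia.
- case/exnP=> i hi /exnP[j hj /exnP[a ha /exnP[b hb /and3P[hfb /eqP-> /eqP->]]]].
  rewrite potential_sv // potential_tv //.
  (* The values 3, 10, 13 of s and 5, 10, 15 of t meet only in 10, that is, when the cuts are
     exactly at [a] and [b]. *)
  case: ltnP => h1; case: ltnP => h2; do ?case: leqP => ? //; try lia.
  have ea : f i = a by lia. 
  have eb : h j = b by lia.
  by have := hn i j hi hj; rewrite ea eb hfb.
- case/exnP=> i hi /exnP[j hj /and3P[hw /eqP es /eqP et]].
  have nij : i != j by apply: contra ne => /eqP e; rewrite -val_eqE /= es et e.
  by rewrite es et !potential_nd // neq_ltn ancestors_ltn.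
Qed.

End ToCut.

Lemma gadgetP N D m forb wr : 0 < N ->
  (exists Y, hard_solution (nv := nvert N D m) (4 * N) (soft N D m) (hard N D m forb wr)
     (req N D m forb wr) Y) <->
  @acyclic_wires m wr /\ exists f h, csp_solution N D forb f h.
Proof.
move=> N0; split=> [[Y hY]|[ha [f [h hs]]]].
  split; first exact: (acyclic_of_cut hY).
  by exists (pos Y 1 0), (pos Y 0 0); apply: csp_of_cut N0 hY.
by exists (@cut_set N D m f h); apply: cut_set_solution.
Qed.

(** * Circuits of weft one and local views *)

Section LocalViews.
Variables (m k d q Q : nat) (wr : nat -> nat -> bool) (an ot : nat -> bool).

Definition fan (u : nat) : nat := cntn m (fun j => wr j u).
Definition bigfan (u : nat) : bool := 2 < fan u.

(** Whether some walk of length [l] from [u] to the output has at least [c] large nodes; the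
    recursion is on a fixed number, so it unfolds into a term. *)
Fixpoint heavy (l c u : nat) : bool :=
  match l with
  | 0 => ot u && (c <= bigfan u)
  | l'.+1 => exn m (fun j => wr u j &&
      (if bigfan u then heavy l' c.-1 j else heavy l' c j))
  end.

(** Excluding walks of length exactly [d.+1] bounds the depth, since a longer walk has such a
    suffix. *)
Definition well_shaped : bool :=
  [&& alln m (fun u => ~~ wr u u),
      alln m (fun u => alln m (fun v => ot u ==> ~~ wr u v)),
      alln m (fun u => ~~ heavy d.+1 0 u) &
      ~~ has (fun l => exn m (fun u => heavy l 2 u)) (iota 0 d.+1)].

(** Only the nodes after [u] have to be small; [u] itself may be one of the large gates whose value
    is guessed. *)
Fixpoint top (l u : nat) : bool :=
  match l with
  | 0 => ot u
  | l'.+1 => exn m (fun j => [&& wr u j, ~~ bigfan j & top l' j])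
  end.

Definition toprel (u : nat) : bool := has (fun l => top l u) (iota 0 d.+1).

(** In a slot, input [u] appears as [u.+1]; 0 and [m.+1] are sentinels before the first and after
    the last true input, whence the base. *)
Definition xval (e : nat) : nat := e %/ m.+2.
Definition yval (e : nat) : nat := e %% m.+2.

Section View.
(* [ex p] is the content of the slot [sl p] for [p < q]; the entries [ex p] for
   [q <= p < q + Q] are pairs (gate, child witnessing its value). *)
Variables sl ex : nat -> nat.

Definition known_true (u : nat) : bool :=
  has (fun p => (0 < sl p) && (xval (ex p) == u.+1)) (iota 0 q).
Definition known_false (u : nat) : bool :=
  has (fun p => (xval (ex p) < u.+1) && (u.+1 < yval (ex p))) (iota 0 q).
Definition listed (g c : nat) : bool :=
  has (fun r => (xval (ex (q + r)) == g) && (yval (ex (q + r)) == c)) (iota 0 Q).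
Definition witnessed (g : nat) : bool := exn m (fun c => wr c g && listed g c).
(** Gates of both kinds have value [an g] iff all children have that value, and a listed child is
    evidence for the opposite; this treats and-gates and or-gates alike. *)
Definition claim (g : nat) : bool := an g (+) witnessed g.

(* Three-valued evaluation: the node [u] certainly has value [b]. *)
Fixpoint forced (l : nat) (b : bool) (u : nat) : bool :=
  match l with
  | 0 => false
  | l'.+1 =>
    if fan u == 0 then (if b then known_true u else known_false u)
    else if fan u == 1 then exn m (fun j => wr j u && forced l' (~~ b) j)
    else if fan u == 2 then
      if an u == b then alln m (fun j => wr j u ==> forced l' b j)
      else exn m (fun j => wr j u && forced l' b j)
    else claim u == b
  end.

Definition bad_slot (p : nat) : bool :=
  ~~ [&& xval (ex p) < yval (ex p),
         (sl p == 0) ==> (xval (ex p) == 0),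
         (0 < sl p) ==> [&& 0 < xval (ex p), xval (ex p) <= m & fan (xval (ex p) - 1) == 0] &
         (sl p == k) ==> (yval (ex p) == m.+1)].

Definition bad_link (p p' : nat) : bool :=
  (sl p' == (sl p).+1) && (yval (ex p) != xval (ex p')).

(** With no listed witness every child has to take the value [an g], otherwise every listed child
    the opposite one. In both cases this value is the claim. *)
Definition bad_gate (g c : nat) : bool :=
  [&& wr c g, bigfan g, toprel g, witnessed g ==> listed g c &
      forced d.+1 (~~ claim g) c].

Definition bad : bool :=
  [|| has bad_slot (iota 0 q),
      has (fun p => has (bad_link p) (iota 0 q)) (iota 0 q),
      exn m (fun u => ot u && forced d.+1 false u) |
      exn m (fun g => exn m (bad_gate g))].
End View.

(** Rows 0 to [k] are the slots, one more than there are true inputs because of the two sentinels;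
    the next [Q] rows are the guesses. *)
Definition consistent (z sl ex : nat -> nat) : Prop :=
  (forall p, p < q -> sl p <= k /\ ex p = z (sl p)) /\
  (forall r, r < Q -> ex (q + r) = z (k.+1 + r)).

End LocalViews.

(** * Depth and weft through bounded walks to the output *)

Section Circuits.
Variables (m : nat) (C : circuit m) (wr : nat -> nat -> bool) (an ot : nat -> bool).
Hypothesis wrE : forall i j : 'I_m, wr i j = wire C i j.
Hypothesis anE : forall i : 'I_m, an i = is_and C i.
Hypothesis otE : forall i : 'I_m, ot i = (i == out C).
Variables k d : nat.

Local Notation fan := (fan m wr).
Local Notation bigfan := (bigfan m wr).
Local Notation wire := (wire C).
Local Notation top := (top m wr ot).
Local Notation toprel := (toprel m d wr ot).
Local Notation heavy := (heavy m wr ot).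

Lemma fanE (u : 'I_m) : fan u = #|fanin C u|.
Proof.
rewrite /fan cntnE -sum1_card [RHS]big_mkcond; apply: eq_bigr => j _.
by rewrite wrE inE; case: (wire j u).
Qed.

Lemma bigfanE (u : 'I_m) : bigfan u = large C u.
Proof. by rewrite /bigfan fanE. Qed.

Lemma ex_wire_to (u : 'I_m) (P : nat -> bool) :
  reflect (exists2 j : 'I_m, wire j u & P j) (exn m (fun j => wr j u && P j)).
Proof.
apply: (iffP (exn_ordP _ _)) => [[j /andP[h1 h2]]|[j h1 h2]]; exists j => //.
  by rewrite -wrE.
by rewrite wrE h1.
Qed.

Lemma ex_wire_from (u : 'I_m) (P : nat -> bool) :
  reflect (exists2 j : 'I_m, wire u j & P j) (exn m (fun j => wr u j && P j)).
Proof.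
apply: (iffP (exn_ordP _ _)) => [[j /andP[h1 h2]]|[j h1 h2]]; exists j => //.
  by rewrite -wrE.
by rewrite wrE h1.
Qed.

Lemma all_wire_to (u : 'I_m) (P : nat -> bool) :
  reflect (forall j : 'I_m, wire j u -> P j) (alln m (fun j => wr j u ==> P j)).
Proof.
apply: (iffP (alln_ordP _ _)) => h j; last by apply/implyP; rewrite wrE; apply: h.
by move=> hj; have := h j; rewrite wrE hj.
Qed.

Definition acyclic : Prop := forall i j, wire i j -> ~~ connect wire j i.

Definition shallow : Prop := forall u p, path wire u p -> last u p = out C ->
  size p <= d /\ count (large C) (u :: p) <= 1.

Lemma heavyP l c (u : 'I_m) : reflect
  (exists p, [/\ path wire u p, last u p = out C, size p = l &
                 c <= count (large C) (u :: p)]) (heavy l c u).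
Proof.
elim: l c u => [|l IH] c u /=.
  rewrite otE bigfanE; apply: (iffP andP) => [[/eqP-> hc]|[[|x p] [] //= _ -> _]].
    by exists [::]; rewrite /= addn0.
  by rewrite addn0 eqxx.
apply: (iffP (ex_wire_from _ _)) => [[j hw]|[[|j p] [] //= /andP[hw hp] hl [hs] hc]].
  rewrite bigfanE => h.
  have [p [h1 h2 h3 h4]] : exists p, [/\ path wire j p, last j p = out C, size p = l &
      c - large C u <= count (large C) (j :: p)].
    by case: (large C u) h => /IH[p [h1 h2 h3 h4]]; exists p; split; rewrite ?subn1 ?subn0.
  exists (j :: p); split=> //=; rewrite ?hw ?h3 //.
  by rewrite -leq_subLR.
exists j => //; rewrite bigfanE; rewrite -leq_subLR in hc.
by case: (large C u) hc => hc; apply/IH; exists p; split; rewrite ?subn1 ?subn0 in hc *.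
Qed.

Definition nanc (u : 'I_m) : nat := #|[set x | connect wire x u]|.

Lemma nanc_wire : acyclic -> forall j u, wire j u -> nanc j < nanc u.
Proof.
move=> ha j u hw; apply: proper_card; apply/properP; split.
  by apply/subsetP => x; rewrite !inE => h; apply: connect_trans h (connect1 hw).
by exists u; rewrite !inE // ha.
Qed.

Lemma from_input : acyclic -> forall u, exists i p,
  [/\ i \in inputs C, path wire i p & last i p = u].
Proof.
move=> ha u; have [n] := ubnP (nanc u); elim: n u => // n IH u hn.
case: (set_0Vmem (fanin C u)) => [h0|[j]].
  by exists u, [::]; split=> //; rewrite inE h0 cards0.
rewrite inE => hw; have [|i [p [h1 h2 h3]]] := IH j.
  by have := nanc_wire ha hw; lia.
by exists i, (rcons p u); rewrite rcons_path last_rcons h2 h3.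
Qed.

(** Depth and weft speak of paths from inputs, [shallow] of all paths to the output. Acyclicity lets
    every path be prolonged backwards to an input. *)
Lemma shallowP : acyclic -> (weft_le C 1 /\ depth_le C d) <-> shallow.
Proof.
move=> ha; split=> [[hw hd] u p hp hl|hs].
  have [i [p' [h1 h2 h3]]] := from_input ha u.
  have hpp : path wire i (p' ++ p) by rewrite cat_path h2 h3 hp.
  have hll : last i (p' ++ p) = out C by rewrite last_cat h3.
  split; first by have := hd i _ h1 hpp hll; rewrite size_cat; lia.
  apply: leq_trans (hw i _ h1 hpp hll); rewrite -cat_cons count_cat.
  rewrite [count _ (u :: p)]/= leq_add2r.
  case: (boolP (large C u)) => // hu; rewrite -has_count; apply/hasP.
  by exists u => //; rewrite -h3 mem_last.
by split=> i p _ h1 h2; have [] := hs i p h1 h2.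
Qed.

Lemma well_shapedP :
  acyclic_wires m wr /\ well_shaped m d wr ot <-> wf_circuit C /\ shallow.
Proof.
have cE : connect (@wires m wr) =2 connect wire.
  by apply: eq_connect => i j; rewrite /wires wrE.
split=> [[ha /and4P[/alln_ordP h1 /alln_ordP h2 /alln_ordP h3 h4]]|[[ha ho] hs]].
  split; first split=> [i j hw|j].
  - rewrite -cE; apply: ha; last by rewrite /wires wrE.
    by apply: contraTneq hw => ->; rewrite -wrE h1.
  - have /alln_ordP/(_ j) := h2 (out C); rewrite otE eqxx wrE; exact.
  move=> u p hp hl; have hd : size p <= d.
    rewrite leqNgt; apply/negP => hd.
    have /heavyP[] := h3 (last u (take (size p - d.+1) p)).
    exists (drop (size p - d.+1) p).
    move: hp hl; rewrite -{1 2}(cat_take_drop (size p - d.+1) p) cat_path last_cat.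
    by case/andP=> _ hp hl; split=> //; rewrite size_drop; lia.
  split=> //; rewrite leqNgt; apply: contra h4 => hc.
  apply/hasP; exists (size p); first by rewrite mem_iota.
  by apply/exn_ordP; exists u; apply/heavyP; exists p.
split=> [i j ne hw|]; first by rewrite cE; apply: ha; rewrite -wrE.
apply/and4P; split.
- by apply/alln_ordP => u; rewrite wrE; apply/negP => /ha; rewrite connect0.
- apply/alln_ordP => u; apply/alln_ordP => v; rewrite otE wrE.
  by apply/implyP => /eqP->.
- by apply/alln_ordP => u; apply/heavyP => -[p [h1 h2 h3 _]]; have [] := hs u p h1 h2; lia.
- apply/hasPn => l _; apply/exn_ordP => -[u /heavyP[p [h1 h2 _ h3]]].
  by have [] := hs u p h1 h2; lia.
Qed.

Lemma top_path l (u : 'I_m) : top l u -> exists p,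
  [/\ path wire u p, last u p = out C & size p = l].
Proof.
elim: l u => [|l IH] u /=; first by rewrite otE => /eqP->; exists [::].
case/ex_wire_from=> j hw /andP[_ /IH[p [h1 h2 h3]]].
by exists (j :: p); rewrite /= hw h1 h2 h3.
Qed.

Lemma toprelP (u : 'I_m) : shallow -> reflect (exists l, top l u) (toprel u).
Proof.
move=> hs; apply: (iffP hasP) => [[l _ h]|[l h]]; first by exists l.
exists l => //; rewrite mem_iota ltnS; have [p [h1 h2 <-]] := top_path h.
by have [] := hs u p h1 h2.
Qed.

Lemma toprel_step (u j : 'I_m) : shallow -> toprel u -> ~~ bigfan u -> wire j u ->
  toprel j.
Proof.
move=> hs /(toprelP _ hs)[l hl] hb hw; apply/(toprelP _ hs); exists l.+1.
by apply/ex_wire_from; exists u; rewrite ?hb.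
Qed.

(** Level l+1 consists of children of small nodes of level l, at most two for each; the levels add
    up to a geometric sum. *)
Lemma card_top : shallow -> #|[set u : 'I_m | toprel u]| <= 2 ^ d.+1.
Proof.
move=> hs.
have ht l : #|[set u : 'I_m | top l u]| <= 2 ^ l.
  elim: l => [|l IH].
    rewrite expn0 -(cards1 (out C)); apply: subset_leq_card; apply/subsetP => u.
    by rewrite !inE /= otE.
  have sub : [set u : 'I_m | top l.+1 u] \subset
      \bigcup_(j in [set j : 'I_m | top l j && ~~ bigfan j]) fanin C j.
    apply/subsetP => u; rewrite inE /= => /ex_wire_from[j hw /andP[hb ht]].
    by apply/bigcupP; exists j; rewrite !inE ?ht ?hb.
  apply: leq_trans (subset_leq_card sub) _.
  apply: (@leq_trans (\sum_(j in [set j : 'I_m | top l j && ~~ bigfan j]) #|fanin C j|)).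
    apply: (big_ind2 (fun (A : {set 'I_m}) n => #|A| <= n)) => [|A a B b hA hB|//]; first by rewrite cards0.
    by apply: leq_trans (leq_of_leqif (leq_card_setU A B)) _; apply: leq_add.
  apply: (@leq_trans (\sum_(j in [set j : 'I_m | top l j && ~~ bigfan j]) 2)).
    by apply: leq_sum => j; rewrite inE bigfanE /large -leqNgt => /andP[].
  rewrite sum_nat_const expnS mulnC leq_mul2l /=; apply: leq_trans IH.
  by apply: subset_leq_card; apply/subsetP => j; rewrite !inE => /andP[].
have : forall n, #|[set u : 'I_m | has (fun l => top l u) (iota 0 n)]| < 2 ^ n.
  elim=> [|n IH].
    by rewrite expn0 ltnS leqn0 cards_eq0; apply/eqP/setP => u; rewrite !inE.
  have -> : [set u : 'I_m | has (fun l => top l u) (iota 0 n.+1)] =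
     [set u : 'I_m | has (fun l => top l u) (iota 0 n)] :|: [set u : 'I_m | top n u].
    by apply/setP => u; rewrite !inE -addn1 iotaD has_cat /= add0n orbF.
  apply: leq_ltn_trans (leq_of_leqif (leq_card_setU _ _)) _.
  by rewrite expnS mul2n -addnn -addSn leq_add.
by move/(_ d.+1)/ltnW.
Qed.

(** The path goes on through [g] to the output, and [g] alone exhausts weft 1 on it. *)
Lemma below_top (g c u : 'I_m) p : shallow -> toprel g -> bigfan g -> wire c g ->
  path wire u p -> last u p = c -> size p <= d /\ ~~ has (large C) (u :: p).
Proof.
move=> hs /(toprelP _ hs)[l /top_path[pg [h1 h2 _]]] hb hw hp hl.
have [] := hs u (p ++ g :: pg).
- by rewrite cat_path hp /= hl hw.
- by rewrite last_cat.
rewrite size_cat /= count_cat /= -[large C g]bigfanE hb => hd hc.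
by split; [lia | rewrite has_count /=; lia].
Qed.

End Circuits.

(** * Three-valued evaluation compared with the true values *)

Section Evaluation.
Variables (m : nat) (C : circuit m) (wr : nat -> nat -> bool) (an ot : nat -> bool).
Hypothesis wrE : forall i j : 'I_m, wr i j = wire C i j.
Hypothesis anE : forall i : 'I_m, an i = is_and C i.
Hypothesis otE : forall i : 'I_m, ot i = (i == out C).
Variables k d q Q : nat.

Local Notation fan := (fan m wr).
Local Notation bigfan := (bigfan m wr).
Local Notation wire := (wire C).
Local Notation top := (top m wr ot).
Local Notation toprel := (toprel m d wr ot).
Local Notation forced := (forced m q Q wr an).
Local Notation claim := (claim m q Q wr an).
Local Notation witnessed := (witnessed m q Q wr).
Local Notation listed := (listed m q Q).
Local Notation consistent := (consistent k q Q).
Local Notation bad := (bad m k d q Q wr an ot).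
Local Notation xval := (xval m).
Local Notation yval := (yval m).

(** When the gate rule is iterated, the value of a node is final after as many rounds as the node
    has ancestors, itself included. *)
Lemma evaluation_exists (S : pred 'I_m) : acyclic C ->
  exists v, respects_gates C v /\ {in inputs C, v =1 S}.
Proof.
move=> ha.
pose gate (f : 'I_m -> bool) i := match #|fanin C i| with
    | 0 => S i
    | 1 => [forall j in fanin C i, ~~ f j]
    | _ => if is_and C i then [forall j in fanin C i, f j]
           else [exists j in fanin C i, f j]
    end.
have gate_ext f g i : (forall j, wire j i -> f j = g j) -> gate f i = gate g i.
  move=> h; rewrite /gate; case: #|_| => [//|[|_]].
    by apply: eq_forallb => j; rewrite inE; case: (boolP (wire j i)) => //= /h ->.
  case: ifP => _; [apply: eq_forallb | apply: eq_existsb] => j;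
    by rewrite inE; case: (boolP (wire j i)) => //= /h ->.
pose ev l := iter l gate S.
have stable n l l' i : nanc C i <= n -> n <= l -> n <= l' -> ev l i = ev l' i.
  elim: n l l' i => [|n IH] l l' i.
    by rewrite leqn0 cards_eq0 => /eqP/setP/(_ i); rewrite !inE connect0.
  move=> hi; case: l => // l; case: l' => // l' hl hl'.
  apply: gate_ext => j hw; apply: IH => //.
  by have := nanc_wire ha hw; lia.
exists (fun i => ev (nanc C i) i); split=> [i|i hi].
  have : ev (nanc C i) i = gate (fun j => ev (nanc C j) j) i.
    rewrite (@stable (nanc C i) _ (nanc C i).+1) //.
    by apply: gate_ext => j hw; apply: (@stable (nanc C j)) => //; apply: ltnW (nanc_wire ha hw).
  by rewrite /gate; case: #|_| => [|[]].
have -> : ev (nanc C i) i = ev (nanc C i).+1 i by apply: (@stable (nanc C i)).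
by rewrite /ev /= /gate; move: hi; rewrite inE => /eqP ->.
Qed.

Section Values.
Variable v : 'I_m -> bool.
Hypothesis hv : respects_gates C v.

Lemma not_gate (u j : 'I_m) : fan u = 1 -> wire j u -> v u = ~~ v j.
Proof.
rewrite (fanE wrE) => h1 hw; have := hv u; rewrite h1 => ->.
have /cards1P[x hx] : #|fanin C u| == 1 by rewrite h1.
have : j \in fanin C u by rewrite inE.
rewrite hx inE => /eqP->; apply/forall_inP/idP => [|h y]; first by apply; rewrite inE.
by rewrite inE => /eqP->.
Qed.

Lemma and_or_gate (u : 'I_m) : 1 < fan u ->
  reflect (forall j, wire j u -> v j = an u) (v u == an u).
Proof.
rewrite (fanE wrE) anE => h1; have := hv u; case: #|_| h1 => [|[|n]] // _ ->.
apply: (iffP eqP); case: (is_and C u).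
- by move/forall_inP=> h j hw; apply: h; rewrite inE.
- move/existsP=> h j hw; apply/negP => hj; apply: h; exists j.
  by rewrite inE hw.
- by move=> h; apply/forall_inP => j; rewrite inE; apply: h.
- move=> h; apply/existsP => -[j]; rewrite inE => /andP[/h ->].
  by [].
Qed.

Lemma gate_witness (u : 'I_m) : 1 < fan u -> v u != an u ->
  exists2 j, wire j u & v j = v u.
Proof.
move=> f1 ne; case: (pickP (fun j => wire j u && (v j == v u))) => [j /andP[h /eqP]|h].
  by exists j.
have : v u == an u; last by rewrite (negbTE ne).
apply/(and_or_gate f1) => j hw; have := h j; rewrite hw /= => {h}.
by case: (v j) (v u) (an u) ne => [] [] [].
Qed.

Section Good.
Variable good : pred 'I_m.
Hypothesis good_step : forall u j, good u -> ~~ bigfan u -> wire j u -> good j.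

(** The set [good] is used in two ways: as [toprel], to descend from the output to the large gates,
    and as the nodes with no large gate at or below them, where the hypothesis on claims is
    vacuous. *)
Lemma forced_sound sl ex :
  (forall u, good u -> bigfan u -> claim ex u = v u) ->
  (forall u : 'I_m, fan u = 0 -> known_true m q sl ex u -> v u) ->
  (forall u : 'I_m, fan u = 0 -> known_false m q ex u -> ~~ v u) ->
  forall l b u, good u -> forced sl ex l b u -> v u = b.
Proof.
move=> hc ht hf; elim=> // l IH b u hg /=.
have small j : fan u <= 2 -> wire j u -> good j.
  by move=> h2; apply: good_step => //; rewrite /bigfan -leqNgt.
case: eqP => [h0|n0].
  by case: b => [/ht|/hf h]; [apply | apply/negbTE/h].
case: eqP => [h1|n1].
  case/(ex_wire_to wrE)=> j hw /IH hj; rewrite (not_gate h1 hw) hj ?negbK //.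
  by apply: small => //; rewrite h1.
case: (fan u =P 2) => [h2|n2]; last by move/eqP=> <-; rewrite hc // /bigfan; lia.
have f1 : 1 < fan u by rewrite h2.
case: eqP => [<-|nb].
  move/(all_wire_to wrE)=> h; apply/eqP/(and_or_gate f1) => j hw.
  by apply: IH (h j hw); apply: small => //; rewrite h2.
case/(ex_wire_to wrE)=> j hw /IH hj.
have vj : v j = b by apply: hj; apply: small => //; rewrite h2.
have : v u != an u.
  by apply/negP => /(and_or_gate f1)/(_ j hw); rewrite vj => e; apply: nb.
by case: (v u) nb; case: (an u); case: (b).
Qed.

(** The evaluation branches only at gates with at most two children, stops at large gates with their
    claims, and needs one slot per input reached, hence at most 2^l slots. They are chosen before
    the view. *)
Lemma forced_complete z :
  (forall u, good u -> bigfan u -> forall sl ex, consistent z sl ex -> claim ex u = v u) ->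
  (forall u : 'I_m, fan u = 0 -> exists2 i, i <= k & forall sl ex,
     consistent z sl ex -> (exists2 p, p < q & sl p = i) ->
     if v u then known_true m q sl ex u else known_false m q ex u) ->
  forall l u, good u -> (forall u' p, path wire u' p -> last u' p = u -> size p <= l) ->
  exists s : seq nat, [/\ size s <= 2 ^ l, all (fun i => i <= k) s & forall sl ex,
    consistent z sl ex -> (forall i, i \in s -> exists2 p, p < q & sl p = i) ->
    forced sl ex l.+1 (v u) u].
Proof.
move=> hc hz; elim=> [|l IH] u hg hl.
  have f0 : fan u = 0.
    rewrite (fanE wrE); apply/eqP; rewrite cards_eq0; apply/eqP/setP => j.
    rewrite !inE; apply/negP => hw.
    by have := hl j [:: u]; rewrite /= hw => /(_ isT erefl).
  have [i hi h] := hz u f0; exists [:: i]; rewrite /= hi; split=> // sl ex hs hp.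
  by rewrite f0 eqxx; apply: h => //; apply: hp; rewrite inE.
have small j : ~~ bigfan u -> wire j u ->
    exists s : seq nat, [/\ size s <= 2 ^ l, all (fun i => i <= k) s & forall sl ex,
      consistent z sl ex -> (forall i, i \in s -> exists2 p, p < q & sl p = i) ->
      forced sl ex l.+1 (v j) j].
  move=> hb hw; apply: IH; first exact: good_step hw.
  move=> u' p hp hlast; have := hl u' (rcons p u).
  by rewrite rcons_path hp hlast hw last_rcons size_rcons => /(_ isT erefl).
have l0 : 0 < 2 ^ l by rewrite expn_gt0.
case hfan : (fan u) => [|[|[|n]]].
- have [i hi h] := hz u hfan; exists [:: i]; rewrite /= hi; split=> //.
    by rewrite expn_gt0.
  move=> sl ex hs hp; rewrite hfan eqxx; apply: h => //; apply: hp.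
  by rewrite inE.
- have /cards1P[j hj] : #|fanin C u| == 1 by rewrite -(fanE wrE) hfan.
  have hw : wire j u by have := set11 j; rewrite -hj inE.
  have [|s [h1 h2 h3]] := small j _ hw; first by rewrite /bigfan hfan.
  exists s; split=> //; first by rewrite expnS; lia.
  move=> sl ex hs hp; rewrite -[forced _ _ l.+2 _ _]/(if _ then _ else _) hfan /=.
  apply/(ex_wire_to wrE); exists j => //.
  by rewrite (not_gate hfan hw) negbK; apply: h3.
- have /cards2P[i [j [nij hij]]] : #|fanin C u| == 2 by rewrite -(fanE wrE) hfan.
  have hwi : wire i u by have := set21 i j; rewrite -hij inE.
  have hwj : wire j u by have := set22 i j; rewrite -hij inE.
  have hb : ~~ bigfan u by rewrite /bigfan hfan.
  have [si [hi1 hi2 hi3]] := small i hb hwi.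
  have [sj [hj1 hj2 hj3]] := small j hb hwj.
  exists (si ++ sj); split.
  + by rewrite size_cat expnS mul2n -addnn leq_add.
  + by rewrite all_cat hi2.
  move=> sl ex hs hp; rewrite -[forced _ _ l.+2 _ _]/(if _ then _ else _) hfan /=.
  have fi : forced sl ex l.+1 (v i) i.
    by apply: hi3 => // x hx; apply: hp; rewrite mem_cat hx.
  have fj : forced sl ex l.+1 (v j) j.
    by apply: hj3 => // x hx; apply: hp; rewrite mem_cat hx orbT.
  have f1 : 1 < fan u by rewrite hfan.
  case: eqP => [eb|/eqP nb].
    have hv' : forall x, wire x u -> v x = an u by apply/(and_or_gate f1); rewrite eb.
    apply/(all_wire_to wrE) => x hw; have : x \in fanin C u by rewrite inE.
    by rewrite -eb -(hv' x hw) hij !inE => /orP[]/eqP->.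
  have [|x hw hx] := @gate_witness u f1; first by rewrite eq_sym.
  apply/(ex_wire_to wrE); exists x => //.
  have : x \in fanin C u by rewrite inE.
  by rewrite -hx hij !inE => /orP[]/eqP->.
- exists [::]; split=> // sl ex hs _; rewrite -[forced _ _ l.+2 _ _]/(if _ then _ else _) hfan /=.
  by apply/eqP; apply: (hc u) hs => //; rewrite /bigfan hfan.
Qed.

End Good.
End Values.
End Evaluation.

(** * From local views to a weighted satisfying assignment *)

Section Views.
Variables (m : nat) (C : circuit m) (wr : nat -> nat -> bool) (an ot : nat -> bool).
Hypothesis wrE : forall i j : 'I_m, wr i j = wire C i j.
Hypothesis anE : forall i : 'I_m, an i = is_and C i.
Hypothesis otE : forall i : 'I_m, ot i = (i == out C).
Variables k d q Q : nat.
Hypotheses (q2 : 2 <= q) (hq : 2 ^ d <= q).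
Hypothesis hs : shallow C d.

Local Notation fan := (fan m wr).
Local Notation bigfan := (bigfan m wr).
Local Notation wire := (wire C).
Local Notation toprel := (toprel m d wr ot).
Local Notation forced := (forced m q Q wr an).
Local Notation claim := (claim m q Q wr an).
Local Notation witnessed := (witnessed m q Q wr).
Local Notation listed := (listed m q Q).
Local Notation consistent := (consistent k q Q).
Local Notation bad := (bad m k d q Q wr an ot).
Local Notation xval := (xval m).
Local Notation yval := (yval m).

(** Every view contains all guesses, taken from the same rows, so that claims do not depend on the
    view. *)
Lemma listed_eq z sl ex sl' ex' g c : consistent z sl ex -> consistent z sl' ex' ->
  listed ex g c = listed ex' g c.
Proof.
move=> [_ h] [_ h']; apply: eq_in_has => r; rewrite mem_iota => hr.
by rewrite h // h'.
Qed.

Lemma witnessed_eq z sl ex sl' ex' g : consistent z sl ex -> consistent z sl' ex' ->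
  witnessed ex g = witnessed ex' g.
Proof.
by move=> h h'; apply: eq_in_has => c _; rewrite (listed_eq _ _ h h').
Qed.

Lemma claim_eq z sl ex sl' ex' g : consistent z sl ex -> consistent z sl' ex' ->
  claim ex g = claim ex' g.
Proof. by move=> h h'; rewrite /claim (witnessed_eq _ h h'). Qed.

Definition small_below (u : 'I_m) : bool :=
  [forall u', connect wire u' u ==> ~~ bigfan u'].

Lemma small_below_step u j : small_below u -> ~~ bigfan u -> wire j u -> small_below j.
Proof.
move=> /forallP h _ hw; apply/forallP => x; apply/implyP => hc.
by apply: (implyP (h x)); apply: connect_trans hc (connect1 hw).
Qed.

Lemma small_below_self u : small_below u -> bigfan u = false.
Proof. by move/forallP/(_ u); rewrite connect0 => /negbTE. Qed.

Lemma small_below_child (g c : 'I_m) : toprel g -> bigfan g -> wire c g -> small_below c.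
Proof.
move=> ht hb hw; apply/forallP => x; apply/implyP => /connectP[p hp hl].
have [_] := below_top wrE otE hs ht hb hw hp (esym hl).
by rewrite (bigfanE wrE) /= negb_or => /andP[].
Qed.

Section FromViews.
Variable z : nat -> nat.
Hypothesis ha : acyclic C.
Hypothesis views : forall s : seq nat, size s <= q -> all (fun i => i <= k) s ->
  exists sl ex, [/\ consistent z sl ex,
    forall i, i \in s -> exists2 p, p < q & sl p = i & ~~ bad sl ex].

Let X i := xval (z i).
Let Y i := yval (z i).

Lemma slotP i : i <= k -> [/\ X i < Y i, i = 0 -> X i = 0,
  0 < i -> [/\ 0 < X i, X i <= m & fan (X i - 1) = 0] & i = k -> Y i = m.+1].
Proof.
move=> hi; have [||sl [ex [[hc _] hp]]] := views (s := [:: i]); rewrite /= ?hi //.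
  exact: ltnW.
have [p hp1 hp2] := hp i (mem_head _ _).
have [_ ep] := hc p hp1; rewrite hp2 in ep.
rewrite !negb_or => /and4P[/hasPn/(_ p) h _ _ _]; move: h; rewrite mem_iota => /(_ hp1).
rewrite negbK ep hp2 => /and4P[h1 h2 h3 h4]; split=> //.
- by move=> i0; apply/eqP; apply: (implyP h2); apply/eqP.
- by move=> /(implyP h3)/and3P[? ? /eqP ?].
- by move=> ik; apply/eqP; apply: (implyP h4); apply/eqP.
Qed.

(** Two consecutive slots have to occur in one view, which is the reason for [2 <= q]. *)
Lemma linkP i : i < k -> Y i = X i.+1.
Proof.
move=> hi; have [||sl [ex [[hc _] hp]]] := views (s := [:: i; i.+1]); rewrite /= ?hi ?andbT //.
  exact: ltnW.
have [p hp1 hp2] := hp i (mem_head _ _).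
have [|p' hp1' hp2'] := hp i.+1; first by rewrite !inE eqxx orbT.
have [_ ep] := hc p hp1; rewrite hp2 in ep.
have [_ ep'] := hc p' hp1'; rewrite hp2' in ep'.
rewrite !negb_or => /and4P[_ /hasPn/(_ p) h _ _]; move: h; rewrite mem_iota => /(_ hp1).
move/hasPn/(_ p'); rewrite mem_iota => /(_ hp1').
by rewrite /bad_link hp2 hp2' eqxx /= negbK ep ep' => /eqP.
Qed.

Lemma X_mono i j : i < j -> j <= k -> X i < X j.
Proof.
elim: j => // j IH; rewrite ltnS leq_eqVlt => /orP[/eqP->|hij] hj.
  by have [h _ _ _] := slotP (ltnW hj); rewrite linkP in h.
apply: ltn_trans (IH hij (ltnW hj)) _.
by have [h _ _ _] := slotP (ltnW hj); rewrite linkP in h.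
Qed.

Lemma X_leq i j : i <= j -> j <= k -> X i <= X j.
Proof. by rewrite leq_eqVlt => /orP[/eqP->|hij] hj //; apply: ltnW (X_mono hij hj). Qed.

(** Take the last slot whose left end is at most [t]. *)
Lemma locate t : 0 < t <= m -> exists2 i, i <= k &
  (0 < i) && (X i == t) \/ X i < t < Y i.
Proof.
move=> ht; have h0 : exists i, (i <= k) && (X i <= t).
  by exists 0; rewrite leq0n; have [_ -> // _ _] := slotP (leq0n k).
have [i /andP[hi hxi] hmax] := ex_maxnP h0 (m := k) (fun i h => proj1 (andP h)).
exists i => //; have [h1 h2 h3 h4] := slotP hi.
move: hxi; rewrite leq_eqVlt => /orP[/eqP e|lt].
  left; rewrite e eqxx andbT; case: i e {hmax hi h1 h3 h4} h2 => // e /(_ erefl).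
  by rewrite e; lia.
right; rewrite lt /=; move: hi; rewrite leq_eqVlt => /orP[/eqP ik|ik].
  by rewrite h4 //; lia.
rewrite linkP // ltnNge; apply/negP => h; have := hmax i.+1; rewrite ik h => /(_ isT).
by rewrite ltnn.
Qed.

Definition chosen : pred 'I_m := fun u => [exists i : 'I_k, X i.+1 == u.+1].

Lemma chosen_input u : chosen u -> u \in inputs C.
Proof.
case/existsP=> i /eqP e; have [_ _ h _] := slotP (ltn_ord i).
have [_ _] := h isT; rewrite e subn1 /= (fanE wrE) => h0.
by rewrite inE h0.
Qed.

Lemma card_chosen : #|[set u in inputs C | chosen u]| = k.
Proof.
have hX (i : 'I_k) : X i.+1 - 1 < m.
  by have [_ _ /(_ isT)[h1 h2 _] _] := slotP (ltn_ord i); lia.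
pose f i : 'I_m := Ordinal (hX i).
have fI : injective f.
  move=> i j /(congr1 val) /= e; apply/val_inj.
  have [_ _ /(_ isT)[h1 _ _] _] := slotP (ltn_ord i).
  have [_ _ /(_ isT)[h2 _ _] _] := slotP (ltn_ord j).
  case: (ltngtP i j) => // h.
    by have := @X_mono i.+1 j.+1 h (ltn_ord j); lia.
  by have := @X_mono j.+1 i.+1 h (ltn_ord i); lia.
rewrite -[RHS]card_ord -(card_imset _ fI); congr #|pred_of_set _|.
apply/setP => u; rewrite inE; apply/andP/imsetP => [[_ /existsP[i /eqP e]]|[i _ ->]].
  by exists i => //; apply/val_inj; rewrite /= e subn1.
have hc : chosen (f i).
  apply/existsP; exists i; rewrite /=.
  by have [_ _ /(_ isT)[h1 _ _] _] := slotP (ltn_ord i); lia.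
by split=> //; apply: chosen_input.
Qed.

Lemma weighted_sat_of_views : weighted_sat C k.
Proof.
have [v [hv hin]] := evaluation_exists chosen ha.
have vin (u : 'I_m) : fan u = 0 -> v u = chosen u.
  by rewrite (fanE wrE) => h; apply: hin; rewrite inE h.
exists v; split=> //; last first.
  rewrite -[RHS]card_chosen; congr #|pred_of_set _|; apply/setP => u; rewrite !inE.
  by case: (boolP (_ == 0)) => //= h; apply: hin; rewrite inE.
have slots (u : 'I_m) : fan u = 0 -> exists2 i, i <= k & forall sl ex,
     consistent z sl ex -> (exists2 p, p < q & sl p = i) ->
     if v u then known_true m q sl ex u else known_false m q ex u.
  move=> f0; have [|i hi hloc] := @locate u.+1; first by rewrite /= ltn_ord.
  exists i => // sl ex [hc _] [p hp ep]; have [_ exp] := hc p hp; rewrite ep in exp.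
  rewrite vin //; case: hloc => [/andP[i0 /eqP e]|/andP[lo hi']].
    have -> : chosen u.
      case: i i0 hi e {ep exp} => // i _ hi e.
      by apply/existsP; exists (Ordinal hi); rewrite /= e.
    by apply/hasP; exists p; rewrite ?mem_iota // ep i0 exp /= -/(X i) e.
  have -> : chosen u = false.
    apply/existsP => -[j /eqP e]; have hj := ltn_ord j.
    case: (leqP i j) => hij.
      have ik : i < k by apply: leq_ltn_trans hij hj.
      by have := @X_leq i.+1 j.+1 hij hj; move: hi'; rewrite linkP // e; lia.
    by have := X_leq hij hi; rewrite e; lia.
  by apply/hasP; exists p; rewrite ?mem_iota // exp -/(X i) -/(Y i) lo hi'.
(* A view showing the slots that determine [c] forces the true value of [c], so a disagreement with
   the claim would make the view bad. *)
have child (g c : 'I_m) : toprel g -> bigfan g -> wire c g ->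
    forall sl ex, consistent z sl ex -> (witnessed ex g ==> listed ex g c) ->
    v c = claim ex g.
  move=> ht hb hw sl ex hc hl.
  have [|||s [h1 h2 h3]] := @forced_complete _ _ _ _ wrE anE k q Q v hv
    small_below small_below_step z _ slots d c.
  - by move=> u /small_below_self ->.
  - exact: small_below_child hw.
  - by move=> u' p hp hlast; case: (below_top wrE otE hs ht hb hw hp hlast).
  have [||sl' [ex' [hc' hp' hbad]]] := views (s := s) => //; first exact: leq_trans hq.
  have hf := h3 sl' ex' hc' hp'.
  move: hbad; rewrite !negb_or => /and4P[_ _ _].
  move/exn_ordP=> hn; apply/eqP/negPn/negP => ne; apply: hn; exists g; apply/exn_ordP.
  exists c; rewrite /bad_gate wrE hw hb ht -(witnessed_eq _ hc hc') -(listed_eq _ _ hc hc') hl /=.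
  have -> : ~~ claim ex' g = v c; last exact: hf.
  by rewrite -(claim_eq _ hc hc'); case: (v c) (claim ex g) ne => [] [].
(* The children now settle the gate: a listed one has the value opposite to [an g], or all of them
   have the value [an g]. *)
have hclaim (g : 'I_m) : toprel g -> bigfan g ->
    forall sl ex, consistent z sl ex -> claim ex g = v g.
  move=> ht hb sl ex hc; have f1 : 1 < fan g by apply: ltnW.
  rewrite /claim; case: (boolP (witnessed ex g)) => hw.
    case/(ex_wire_to wrE): (hw) => c hwc hl.
    have vc := child g c ht hb hwc sl ex hc; rewrite hw hl /= in vc.
    have {}vc := vc isT; rewrite /claim hw addbT in vc.
    have : v g != an g.
      by apply/negP => /(and_or_gate wrE anE hv f1)/(_ c hwc); rewrite vc; case: (an g).
    by rewrite addbT; case: (v g) (an g) => [] [].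
  rewrite addbF; apply/esym/eqP/(and_or_gate wrE anE hv f1) => c hwc.
  by rewrite (child g c ht hb hwc sl ex hc) ?(negbTE hw) // /claim (negbTE hw) addbF.
(* With the claims known to be right, the evaluation also determines the output. *)
have [||s [h1 h2 h3]] := @forced_complete _ _ _ _ wrE anE k q Q v hv
    (fun u : 'I_m => toprel u) (fun u j h1 h2 => toprel_step wrE otE hs h1 h2)
    z hclaim slots d (out C).
- by apply/(toprelP wrE otE _ hs); exists 0; rewrite /= otE.
- by move=> u' p hp hlast; case: (hs hp hlast).
have [||sl [ex [hc hp hbad]]] := views (s := s) => //; first exact: leq_trans hq.
have hf := h3 sl ex hc hp.
move: hbad; rewrite !negb_or => /and4P[_ _ + _] => /exn_ordP hn.
by apply/negPn/negP => nv; apply: hn; exists (out C); rewrite otE eqxx -(negbTE nv).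
Qed.
End FromViews.
End Views.

(** * From a weighted satisfying assignment to local views *)

Section ToViews.
Variables (m : nat) (C : circuit m) (wr : nat -> nat -> bool) (an ot : nat -> bool).
Hypothesis wrE : forall i j : 'I_m, wr i j = wire C i j.
Hypothesis anE : forall i : 'I_m, an i = is_and C i.
Hypothesis otE : forall i : 'I_m, ot i = (i == out C).
Variables k d q Q : nat.
Variable v : 'I_m -> bool.
Hypothesis vcard : #|[set i in inputs C | v i]| = k.

Local Notation fan := (fan m wr).
Local Notation bigfan := (bigfan m wr).
Local Notation wire := (wire C).
Local Notation toprel := (toprel m d wr ot).
Local Notation forced := (forced m q Q wr an).
Local Notation claim := (claim m q Q wr an).
Local Notation witnessed := (witnessed m q Q wr).
Local Notation listed := (listed m q Q).
Local Notation consistent := (consistent k q Q).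
Local Notation bad := (bad m k d q Q wr an ot).
Local Notation xval := (xval m).
Local Notation yval := (yval m).

Definition selected (u : nat) : bool :=
  [exists x : 'I_m, [&& val x == u, x \in inputs C & v x]].

Lemma selectedE (u : 'I_m) : selected u = (u \in inputs C) && v u.
Proof.
apply/existsP/idP => [[x /andP[/eqP/val_inj-> //]]|h].
by exists u; rewrite eqxx.
Qed.

Definition marks : seq nat := [seq u <- iota 1 m | selected u.-1].
Definition bounds : seq nat := 0 :: rcons marks m.+1.

Lemma size_marks : size marks = k.
Proof.
rewrite size_filter (iotaDl 1 0) count_map.
rewrite (eq_count (a2 := selected)); last by move=> u.
rewrite -/(cntn m selected) cntnE -vcard -sum1_card [RHS]big_mkcond.
by apply: eq_bigr => u _; rewrite selectedE inE; case: ifP.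
Qed.

Lemma size_bounds : size bounds = k.+2.
Proof. by rewrite /= size_rcons size_marks. Qed.

Lemma marks_range u : u \in marks -> 0 < u <= m.
Proof. by rewrite mem_filter mem_iota => /andP[_]; lia. Qed.

Lemma bounds_lt i j : i < j -> j < k.+2 -> nth 0 bounds i < nth 0 bounds j.
Proof.
move=> hij hj; apply: (sorted_ltn_nth ltn_trans) => //; rewrite ?inE ?size_bounds //; last first.
  exact: ltn_trans hj.
rewrite /bounds /= rcons_path; apply/andP; split.
  rewrite (path_sortedE ltn_trans); apply/andP; split.
    by apply/allP => u /marks_range /andP[].
  by apply: sorted_filter; [apply: ltn_trans | apply: iota_ltn_sorted].
suff h : last 0 marks <= m by [].
by have := mem_last 0 marks; rewrite inE => /orP[/eqP-> //|/marks_range/andP[]].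
Qed.

Lemma bounds_mem i : 0 < i <= k -> nth 0 bounds i \in marks.
Proof.
case: i => // i hi; rewrite /bounds /= nth_rcons size_marks ifT //.
by apply: mem_nth; rewrite size_marks.
Qed.

Lemma bounds_last : nth 0 bounds k.+1 = m.+1.
Proof. by rewrite /bounds /= nth_rcons size_marks ltnn eqxx. Qed.

Lemma bounds_range i : i < k.+2 -> nth 0 bounds i <= m.+1.
Proof.
move=> hi; case: (eqVneq i k.+1) => [->|ne]; first by rewrite bounds_last.
by rewrite -bounds_last ltnW // bounds_lt //; lia.
Qed.

Definition slot_value i := nth 0 bounds i * m.+2 + nth 0 bounds i.+1.

Lemma pair_xval x y : y < m.+2 -> xval (x * m.+2 + y) = x.
Proof. by move=> hy; rewrite /xval divnMDl // divn_small // addn0. Qed.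

Lemma pair_yval x y : y < m.+2 -> yval (x * m.+2 + y) = y.
Proof. by move=> hy; rewrite /yval modnMDl modn_small. Qed.

Definition gates : seq 'I_m :=
  [seq g : 'I_m <- enum 'I_m | [&& toprel g, bigfan g & v g != an g]].

Definition wit (g : 'I_m) : nat :=
  if [pick j | wire j g && (v j == v g)] is Some j then val j else 0.

Lemma wit_lt g : wit g < m.
Proof.
rewrite /wit; case: pickP => [j _|_]; first exact: ltn_ord.
exact: leq_ltn_trans (leq0n _) (ltn_ord g).
Qed.

Definition gate_entries : seq nat := [seq val g * m.+2 + wit g | g <- gates].

(** Spare guess rows hold the pair (m, m); as [m] is not a node, they list nothing. *)
Definition views_of i : nat :=
  if i <= k then slot_value i else nth (m * m.+2 + m) gate_entries (i - k.+1).

Lemma views_of_lt i : views_of i < m.+2 * m.+2.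
Proof.
rewrite /views_of /slot_value; case: (leqP i k) => hi.
  by apply: ltn_mixed; rewrite ltnS bounds_range ?ltnS // ltnW.
case: (ltnP (i - k.+1) (size gate_entries)) => h; last by rewrite nth_default //; apply: ltn_mixed.
have := mem_nth (m * m.+2 + m) h => /mapP[g _ ->].
by apply: ltn_mixed; [apply: ltn_trans (ltn_ord g) _ | apply: ltn_trans (wit_lt g) _].
Qed.

Hypothesis hQ : 2 ^ d.+1 <= Q.
Hypothesis hs : shallow C d.
Hypotheses (hv : respects_gates C v) (vout : v (out C)).

Lemma size_gates : size gates <= Q.
Proof.
apply: leq_trans hQ; apply: leq_trans (card_top wrE otE hs).
rewrite size_filter -sum1_count big_mkcond big_enum -big_mkcond sum1_card.
apply: subset_leq_card; apply/subsetP => u; rewrite !inE.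
by rewrite unfold_in => /andP[].
Qed.

Section View.
Variables sl ex : nat -> nat.
Hypothesis hc : consistent views_of sl ex.

Lemma slot_x p : p < q -> xval (ex p) = nth 0 bounds (sl p).
Proof.
move=> hp; have [h1 ->] := hc.1 p hp.
by rewrite /views_of h1 /slot_value pair_xval // ltnS bounds_range.
Qed.

Lemma slot_y p : p < q -> yval (ex p) = nth 0 bounds (sl p).+1.
Proof.
move=> hp; have [h1 ->] := hc.1 p hp.
by rewrite /views_of h1 /slot_value pair_yval // ltnS bounds_range.
Qed.

Lemma slot_le p : p < q -> sl p <= k.
Proof. by move=> hp; have [] := hc.1 p hp. Qed.

Lemma mark_selected (u : 'I_m) : (u.+1 \in marks) = (u \in inputs C) && v u.
Proof.
have -> : (u.+1 \in marks) = selected u && (u.+1 \in iota 1 m) by rewrite mem_filter.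
by rewrite mem_iota selectedE add1n !ltnS ltn_ord !andbT.
Qed.

Lemma known_true_sound (u : 'I_m) : known_true m q sl ex u -> v u.
Proof.
case/hasP=> p; rewrite mem_iota => hp /andP[p0 /eqP].
have := slot_le hp; rewrite slot_x // => hk e.
have := @bounds_mem (sl p); rewrite p0 hk e mark_selected => /(_ isT).
by case/andP.
Qed.

Lemma known_false_sound (u : 'I_m) : fan u = 0 -> known_false m q ex u -> ~~ v u.
Proof.
rewrite (fanE wrE) => f0 /hasP[p]; rewrite mem_iota => hp.
have hk := slot_le hp; rewrite slot_x // slot_y // => /andP[lo hi]; apply/negP => vu.
have : u.+1 \in marks by rewrite mark_selected inE f0.
move=> hm; have := hm; rewrite -index_mem size_marks => hi'.
have e : nth 0 bounds (index u.+1 marks).+1 = u.+1.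
  by rewrite /bounds /= nth_rcons size_marks hi' nth_index.
set i := (index _ _).+1 in hi' e.
(* No mark lies strictly between two consecutive bounds, as [bounds] is increasing. *)
case: (ltngtP i (sl p)) => h.
- by have := bounds_lt h; lia.
- case: (eqVneq i (sl p).+1) => [e'|ne]; first by rewrite -e' e ltnn in hi.
  have := @bounds_lt (sl p).+1 i; lia.
- by rewrite -h e ltnn in lo.
Qed.

Lemma listedP (g : 'I_m) c : listed ex g c = (g \in gates) && (c == wit g).
Proof.
apply/hasP/andP => [[r]|[hg /eqP->]].
  rewrite mem_iota => hr /andP[/eqP hx /eqP hy].
  have := hc.2 r hr; rewrite /views_of leqNgt ltnS leq_addr /= addKn => e.
  case: (ltnP r (size gates)) => hsz; last first.
    move: hx; rewrite e nth_default ?size_map // pair_xval // => hx.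
    by have := ltn_ord g; rewrite -hx ltnn.
  rewrite e (nth_map g) // in hx hy; have hm := mem_nth g hsz.
  move: (nth g gates r) hm hx hy => g' hm.
  have hw : wit g' < m.+2 by have := wit_lt g'; lia.
  by rewrite pair_xval // pair_yval // => /val_inj <- <-.
exists (index g gates); first by rewrite mem_iota (leq_trans _ size_gates) // index_mem.
have hr : index g gates < Q by rewrite (leq_trans _ size_gates) // index_mem.
rewrite hc.2 // /views_of leqNgt ltnS leq_addr /= addKn (nth_map g) ?index_mem // nth_index //.
have hw : wit g < m.+2 by have := wit_lt g; lia.
by rewrite pair_xval // pair_yval // !eqxx.
Qed.

Lemma witP (g : 'I_m) : bigfan g -> v g != an g -> exists2 j : 'I_m, wire j g &
  wit g = j /\ v j = v g.
Proof.
move=> hb ne; have f1 : 1 < fan g by apply: ltnW.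
have [j hw e] := gate_witness wrE anE hv f1 ne.
rewrite /wit; case: pickP => [x /andP[h1 /eqP h2]|/(_ j)]; first by exists x.
by rewrite hw e eqxx.
Qed.

Lemma mem_gates (g : 'I_m) : (g \in gates) = [&& toprel g, bigfan g & v g != an g].
Proof. by rewrite mem_filter mem_enum andbT. Qed.

Lemma witnessedE (g : 'I_m) : toprel g -> bigfan g -> witnessed ex g = (v g != an g).
Proof.
move=> ht hb; apply/(ex_wire_to wrE)/idP => [[c _]|ne].
  by rewrite listedP mem_gates ht hb /= => /andP[].
have [j hw [e _]] := witP hb ne; exists j => //.
by rewrite listedP mem_gates ht hb ne /= e.
Qed.

Lemma claimE (g : 'I_m) : toprel g -> bigfan g -> claim ex g = v g.
Proof.
by move=> ht hb; rewrite /claim witnessedE //; case: (v g) (an g) => [] [].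
Qed.

Lemma view_not_bad : ~~ bad sl ex.
Proof.
have small := small_below_step.
rewrite /bad !negb_or; apply/and4P; split.
- apply/hasPn => p; rewrite mem_iota => hp; have hk := slot_le hp.
  rewrite /bad_slot negbK slot_x // slot_y // bounds_lt //; apply/and4P; split=> //.
  + by apply/implyP => /eqP->.
  + apply/implyP => p0; have hm : nth 0 bounds (sl p) \in marks by apply: bounds_mem; rewrite p0.
    have /andP[h1 h2] := marks_range hm; rewrite h1 h2 /=.
    have hu : nth 0 bounds (sl p) - 1 < m by lia.
    have : (Ordinal hu).+1 \in marks by rewrite /= subn1 prednK.
    by rewrite mark_selected inE -(fanE wrE) => /andP[].
  + by apply/implyP => /eqP->; rewrite bounds_last.
- apply/hasPn => p; rewrite mem_iota => hp; apply/hasPn => p'; rewrite mem_iota => hp'.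
  by rewrite /bad_link slot_y // slot_x //; case: eqP => //= ->; rewrite eqxx.
- apply/exn_ordP => -[u]; rewrite otE => /andP[/eqP-> hf].
  have := @forced_sound _ _ _ _ wrE anE q Q v hv (fun u : 'I_m => toprel u)
    (fun u j h1 h2 => toprel_step wrE otE hs h1 h2) sl ex claimE
    (fun u _ => @known_true_sound u) known_false_sound _ _ _ _ hf.
  rewrite vout => H; suff : true = false by []; apply: H.
  by apply/(toprelP wrE otE _ hs); exists 0; rewrite /= otE.
- apply/exn_ordP => -[g /exn_ordP[c /and5P[hw hb ht hl hf]]]; rewrite wrE in hw.
  have nb u : small_below C wr u -> bigfan u -> claim ex u = v u.
    by move=> /small_below_self ->.
  have vc := @forced_sound _ _ _ _ wrE anE q Q v hv (small_below C wr)
    (@small_below_step _ _ _) sl ex nb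
    (fun u _ => @known_true_sound u) known_false_sound _ _ _
    (small_below_child wrE otE hs ht hb hw) hf.
  rewrite claimE // in vc; move: hl; rewrite witnessedE // listedP mem_gates ht hb /=.
  case: (boolP (v g != an g)) => [ne|/negPn/eqP e] /=.
    move=> /eqP e; have [j _ [e' vj]] := witP hb ne.
    have ej : c = j by apply/val_inj; rewrite /= e.
    by move: vc; rewrite ej vj; case: (v g).
  have f1 : 1 < fan g by apply: ltnW.
  have : v g == an g by rewrite e.
  by move/(and_or_gate wrE anE hv f1)/(_ c hw); rewrite vc e; case: (an g).
Qed.

End View.
End ToViews.

(** * Encodings *)

Section CspOfViews.
Variables (m k d q Q : nat) (valid : bool) (wr : nat -> nat -> bool) (an ot : nat -> bool).

Definition entry_base : nat := m.+2 * m.+2.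
(** A column value is the tuple of all entries that the column sees; it is polynomial in [m] because
    [q] and [Q] depend on the depth only. *)
Definition dom_size : nat := entry_base ^ (q + Q).
(** A common bound for the [k.+1 ^ q] columns and the [k.+1 + Q] rows, independent of the
    circuit. *)
Definition nvars : nat := k.+1 ^ q + k.+1 + Q.

(* The row variable that position [p] of the column variable [t] must agree
   with. *)
Definition row_of (t p : nat) : nat :=
  if p < q then digit k.+1 t p else k.+1 + (p - q).

(** On invalid input every pair is forbidden; since variables exist, the instance is then
    unsolvable. *)
Definition forbidden (i a t c : nat) : bool :=
  [|| ~~ valid,
      has (fun p => (row_of t p == i) && (digit entry_base c p != a)) (iota 0 (q + Q)) |
      bad m k d q Q wr an ot (digit k.+1 t) (digit entry_base c)].

Local Notation bad := (bad m k d q Q wr an ot).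
Local Notation consistent := (consistent k q Q).

Lemma csp_views f h : csp_solution nvars dom_size forbidden f h ->
  valid /\ forall s : seq nat, size s <= q -> all (fun i => i <= k) s ->
  exists sl ex, [/\ consistent f sl ex,
    forall i, i \in s -> exists2 p, p < q & sl p = i & ~~ bad sl ex].
Proof.
case=> _ _ hn; have N0 : 0 < nvars by rewrite /nvars addnS addSn.
split; first by have := hn 0 0 N0 N0; rewrite !negb_or negbK => /andP[].
move=> s hsz hall.
(* Slot 0 exists for every [k] and pads short tuples to length [q]. *)
pose s' := s ++ nseq (q - size s) 0; pose t := undigits k.+1 s'.
have sz : size s' = q by rewrite size_cat size_nseq subnKC.
have hs' : all (fun x => x < k.+1) s'.
  by rewrite all_cat; apply/andP; split=> //; apply/allP => x /nseqP[->].
have ht : t < nvars.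
  by apply: leq_trans (undigits_lt hs') _; rewrite sz /nvars -addnA leq_addr.
have hf i : i < nvars -> forall p, p < q + Q -> row_of t p = i ->
    digit entry_base (h t) p = f i.
  move=> hi p hp e; have := hn i t hi ht; rewrite !negb_or => /and3P[_ + _].
  move/hasPn/(_ p); rewrite mem_iota => /(_ hp); rewrite e eqxx /= negbK.
  by move/eqP.
exists (digit k.+1 t), (digit entry_base (h t)); split.
- split=> [p hp|r hr].
    have hd : digit k.+1 t p < k.+1 by rewrite ltn_pmod.
    split=> //; apply: hf; rewrite ?/row_of ?hp //; last by apply: leq_trans (leq_addr _ _).
    by apply: leq_trans hd _; rewrite /nvars addnAC leq_addl.
  apply: hf; rewrite ?ltn_add2l //.
    by rewrite /nvars -addnA; lia.
  by rewrite /row_of ltnNge leq_addr /= addKn.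
- move=> i hi; have hx : index i s < size s by rewrite index_mem.
  exists (index i s); first exact: leq_trans hsz.
  rewrite digit_undigits // ?sz; last exact: leq_trans hsz.
  by rewrite nth_cat hx nth_index.
- by have := hn 0 t N0 ht; rewrite !negb_or => /and3P[].
Qed.

Lemma views_csp z : 0 < q -> valid -> (forall i, z i < entry_base) ->
  (forall sl ex, consistent z sl ex -> ~~ bad sl ex) ->
  exists f h, csp_solution nvars dom_size forbidden f h.
Proof.
move=> q0 hval hz hb.
pose h t := undigits entry_base [seq z (row_of t p) | p <- iota 0 (q + Q)].
have hall t : all (fun x => x < entry_base) [seq z (row_of t p) | p <- iota 0 (q + Q)].
  by apply/allP => x /mapP[p _ ->].
have hd t p : p < q + Q -> digit entry_base (h t) p = z (row_of t p).
  move=> hp; rewrite digit_undigits // ?size_map ?size_iota //.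
  by rewrite (nth_map 0) ?size_iota // nth_iota.
exists z, h; split.
- move=> i _; apply: leq_trans (hz i) _; rewrite -{1}[entry_base]expn1 /dom_size.
  by rewrite leq_pexp2l // addn_gt0 q0.
- by move=> t _; have := undigits_lt (hall t); rewrite size_map size_iota.
- move=> i t _ _; rewrite /forbidden hval orFb negb_or; apply/andP; split.
    apply/hasPn => p; rewrite mem_iota => hp; rewrite hd //.
    by case: eqP => //= ->; rewrite eqxx.
  apply: hb; split=> [p hp|r hr].
    rewrite hd /row_of ?hp; last by apply: leq_trans (leq_addr _ _).
    by split=> //; rewrite -ltnS ltn_pmod.
  by rewrite hd ?ltn_add2l // /row_of ltnNge leq_addr /= addKn.
Qed.

End CspOfViews.

Lemma mkseq_add (T : Type) (f : nat -> T) a b :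
  mkseq f (a + b) = mkseq f a ++ mkseq (fun i => f (a + i)) b.
Proof. by rewrite /mkseq iotaD map_cat add0n -{2}[a]addn0 iotaDl -map_comp. Qed.

Lemma nseq_mkseq a : nseq a true = mkseq (fun=> true) a.
Proof. by elim: a => // a IH; rewrite mkseqS -IH; elim: (a) => //= b <-. Qed.

Lemma map_enum_ord (T : Type) (f : nat -> T) n :
  [seq f (val i) | i <- enum 'I_n] = mkseq f n.
Proof. by rewrite /mkseq -val_enum_ord -map_comp. Qed.

Lemma allpairs_mkseq (T : Type) (f : nat -> nat -> T) n :
  [seq f (val i) (val j) | i <- enum 'I_n, j <- enum 'I_n] =
  mkseq (fun t => f (t %/ n) (t %% n)) (n * n).
Proof.
rewrite (eq_map (g := fun i : 'I_n => mkseq (f (val i)) n)); last first.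
  by move=> i; rewrite map_enum_ord.
rewrite (map_enum_ord (fun i => mkseq (f i) n)).
have : forall a, flatten (mkseq (fun i => mkseq (f i) n) a) =
    mkseq (fun t => f (t %/ n) (t %% n)) (a * n); last exact.
elim=> // a IH; rewrite mkseqS -cats1 flatten_cat IH /= cats0 mulSn addnC mkseq_add.
congr cat; apply/eq_in_map => i; rewrite mem_iota => hi.
by rewrite divnMDl ?modnMDl ?modn_small ?divn_small ?addn0 //; lia.
Qed.

Lemma unary_prefix_inj a b s t :
  nseq a true ++ false :: s = nseq b true ++ false :: t -> a = b /\ s = t.
Proof.
by elim: a b => [|a IH] [|b] //= [] // /IH[-> ->].
Qed.

Lemma mkseq_inj_val (T : Type) (f g : nat -> T) n i : mkseq f n = mkseq g n ->
  i < n -> f i = g i.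
Proof.
move=> e hi; have := congr1 (fun s => nth (f i) s i) e.
by rewrite !nth_mkseq.
Qed.

Definition ext_rel n (r : rel 'I_n) (a b : nat) : bool :=
  if insub a is Some i then if insub b is Some j then r i j else false else false.

Lemma ext_relE n (r : rel 'I_n) i j : ext_rel r (val i) (val j) = r i j.
Proof. by rewrite /ext_rel !valK. Qed.

Lemma allpairs_rel n (r : rel 'I_n) : [seq r i j | i <- enum 'I_n, j <- enum 'I_n] =
  mkseq (fun t => ext_rel r (t %/ n) (t %% n)) (n * n).
Proof.
rewrite -allpairs_mkseq; congr flatten; apply: eq_map => i; apply: eq_map => j.
by rewrite ext_relE.
Qed.

Lemma nth_allpairs_rel n (r : rel 'I_n) (i j : 'I_n) :
  nth false [seq r i j | i <- enum 'I_n, j <- enum 'I_n] (i * n + j) = r i j.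
Proof.
have n0 : 0 < n by apply: leq_ltn_trans (ltn_ord i).
rewrite allpairs_rel nth_mkseq; last exact: ltn_mixed.
by rewrite divnMDl // modnMDl modn_small // divn_small // addn0 ext_relE.
Qed.

(** The target problem quantifies over all graphs with a given code, so the code has to determine
    the graph. Requests are recovered on sets of the form {i, j}, all that a multicut inspects. *)
Lemma requests_inj n A P n' A' P' : @enc_requests n A P = @enc_requests n' A' P' ->
  exists e : n = n', forall i j : 'I_n,
    (((i, j) \in A) = ((cast_ord e i, cast_ord e j) \in A')) *
    (([set i; j] \in P) = ([set cast_ord e i; cast_ord e j] \in P')).
Proof.
move/unary_prefix_inj=> [e H]; subst n'; exists erefl => i j; rewrite !cast_ord_id.
have n0 : 0 < n by apply: leq_ltn_trans (ltn_ord i).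
have inj (r r' : rel 'I_n) : [seq r i j | i <- enum 'I_n, j <- enum 'I_n] =
    [seq r' i j | i <- enum 'I_n, j <- enum 'I_n] -> r i j = r' i j.
  rewrite !allpairs_rel => /mkseq_inj_val /(_ (ltn_mixed (ltn_ord i) (ltn_ord j))).
  by rewrite divnMDl // modnMDl modn_small // divn_small // addn0 !ext_relE.
move/eqP: H; rewrite eqseq_cat; last by rewrite !size_allpairs.
by case/andP=> /eqP/(inj (fun i j => (i, j) \in A) (fun i j => (i, j) \in A'))->
  /eqP/(inj (fun i j => [set i; j] \in P) (fun i j => [set i; j] \in P'))->.
Qed.

Lemma dsm_encoded n (A : {set 'I_n * 'I_n}) (P : {set {set 'I_n}}) k :
  (forall v, (v, v) \notin A) -> (forall p, p \in P -> #|p| = 2) ->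
  directed_symmetric_multicut (enc_requests A P) k <->
  exists X, symmetric_multicut A P X /\ #|X| <= k.
Proof.
move=> hA hP; split=> [[n' [A' [P' [_ _ e hX]]]]|hX]; last by exists n, A, P.
have [en h] := requests_inj e; subst n'.
have eA : A' = A by apply/setP => -[i j]; rewrite (h i j).1 !cast_ord_id.
subst A'; case: hX => X [[h1 h2] h3]; exists X; split=> //; split=> // s t.
by rewrite (h s t).2 !cast_ord_id; apply: h2.
Qed.

Definition out_bit (K n : nat) (arc rq : nat -> nat -> bool) (i : nat) : bool :=
  if i < K then true else if i == K then false
  else if i < K.+1 + n then true else if i == K.+1 + n then false
  else let r := i - (K.+1 + n.+1) in
    if r < n * n then arc (r %/ n) (r %% n)
    else rq ((r - n * n) %/ n) ((r - n * n) %% n).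

Definition out_size (K n : nat) : nat := K.+1 + n.+1 + n * n + n * n.

Lemma out_word K n (arc rq : nat -> nat -> bool) (A : {set 'I_n * 'I_n})
    (P : {set {set 'I_n}}) :
  (forall i j, ((i, j) \in A) = arc i j) -> (forall i j, ([set i; j] \in P) = rq i j) ->
  mkseq (out_bit K n arc rq) (out_size K n) = enc_instance (enc_requests A P) K.
Proof.
move=> hA hP; rewrite /enc_instance /enc_requests.
have -> : [seq (i, j) \in A | i <- enum 'I_n, j <- enum 'I_n] =
    mkseq (fun t => arc (t %/ n) (t %% n)) (n * n).
  rewrite -allpairs_mkseq; congr flatten; apply: eq_map => i; apply: eq_map => j.
  exact: hA.
have -> : [seq [set i; j] \in P | i <- enum 'I_n, j <- enum 'I_n] =
    mkseq (fun t => rq (t %/ n) (t %% n)) (n * n).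
  rewrite -allpairs_mkseq; congr flatten; apply: eq_map => i; apply: eq_map => j.
  exact: hP.
rewrite !nseq_mkseq /out_size mkseq_add mkseq_add mkseq_add -!catA.
rewrite -[K.+1]addn1 mkseq_add -[n.+1]addn1 mkseq_add -!catA.
congr (_ ++ _).
  by apply/eq_in_map => i; rewrite mem_iota /out_bit => /andP[_ ->].
have one f : mkseq f 1 = [:: f 0] :> seq bool by [].
rewrite -[false :: _]cat1s; congr (_ ++ _).
  by rewrite one /out_bit addn0 ltnn eqxx.
congr (_ ++ _).
  apply/eq_in_map => i; rewrite mem_iota /out_bit add0n => hi.
  rewrite ifF; last by lia. rewrite ifF; last by lia.
  by rewrite ifT //; lia.
rewrite -[false :: _]cat1s; congr (_ ++ _).
  rewrite one /out_bit ifF; last by lia. rewrite ifF; last by lia.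
  by rewrite ifF; [rewrite ifT //; lia | lia].
congr (_ ++ _); apply/eq_in_map => i; rewrite mem_iota /out_bit add0n => hi.
  rewrite ifF; last by lia. rewrite ifF; last by lia.
  rewrite ifF; last by lia. rewrite ifF; last by lia.
  rewrite (_ : _ - _ = i); last by lia.
  by rewrite ifT //; lia.
rewrite ifF; last by lia. rewrite ifF; last by lia.
rewrite ifF; last by lia. rewrite ifF; last by lia.
have -> : K + 1 + (n + 1) + n * n + i - (K.+1 + n.+1) = n * n + i by lia.
by rewrite /= ltnNge leq_addr /= addKn.
Qed.

(** * The reduction *)

(** Length of the block of ones starting at [s], as a count and therefore definable. *)
Definition ones (w : seq bool) (s : nat) : nat :=
  cntn (size w) (fun i => alln i.+1 (fun j => nth false w (s + j))).

Lemma ones_prefix p a y : head false y = false ->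
  ones (p ++ nseq a true ++ y) (size p) = a.
Proof.
move=> hy; set w := p ++ _.
have ha : a <= size w by rewrite !size_cat size_nseq; lia.
rewrite -[RHS](cntn_lt ha); apply: eq_count => i.
have bit j : nth false w (size p + j) = (j < a) || (a <= j) && nth false y (j - a).
  rewrite nth_cat ltnNge leq_addr /= addKn nth_cat size_nseq nth_nseq.
  by case: ltnP.
apply/allnP/idP => [h|hi j hj].
  rewrite ltnNge; apply/negP => hai; have := h a hai.
  by rewrite bit ltnn leqnn subnn nth0 hy.
by rewrite bit (leq_trans hj).
Qed.

Lemma leading_ones (x : seq bool) : exists a y, x = nseq a true ++ y /\ head false y = false.
Proof.
elim: x => [|[] x [a [y [-> hy]]]]; first by exists 0, [::].
  by exists a.+1, y.
by exists 0, (false :: nseq a true ++ y).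
Qed.

Definition par_of (w : seq bool) : nat := ones w 0.
Definition nodes_of (w : seq bool) : nat := ones w (par_of w).+1.
Definition offset (w : seq bool) : nat := (par_of w).+1 + (nodes_of w).+1.
Definition and_bit (w : seq bool) (i : nat) : bool := nth false w (offset w + i).
Definition out_mark (w : seq bool) (i : nat) : bool :=
  nth false w (offset w + nodes_of w + i).
Definition wire_bit (w : seq bool) (i j : nat) : bool :=
  nth false w (offset w + (nodes_of w + nodes_of w) + (i * nodes_of w + j)).

Definition well_formatted (w : seq bool) : bool :=
  (size w == offset w + (nodes_of w + nodes_of w + nodes_of w * nodes_of w)) &&
  (cntn (nodes_of w) (out_mark w) == 1).

Definition describes (w : seq bool) (C : circuit (nodes_of w)) : Prop :=
  [/\ forall i j : 'I_(nodes_of w), wire_bit w i j = wire C i j,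
      forall i : 'I_(nodes_of w), and_bit w i = is_and C i &
      forall i : 'I_(nodes_of w), out_mark w i = (i == out C)].

Lemma par_of_instance x k : par_of (enc_instance x k) = k.
Proof. exact: (@ones_prefix [::] k (false :: x)). Qed.

Lemma nodes_of_instance k a y : head false y = false ->
  nodes_of (enc_instance (nseq a true ++ y) k) = a.
Proof.
move=> hy; rewrite /nodes_of par_of_instance.
have := ones_prefix (rcons (nseq k true) false) a hy.
by rewrite size_rcons size_nseq cat_rcons.
Qed.

Lemma nth_offset k a y i :
  nth false (enc_instance (nseq a true ++ false :: y) k) (k.+1 + a.+1 + i) = nth false y i.
Proof.
rewrite /enc_instance nth_cat size_nseq ltnNge (_ : k <= _) /=; last by lia.
rewrite (_ : _ - k = (a.+1 + i).+1) /=; last by lia.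
rewrite nth_cat size_nseq ltnNge (_ : a <= _) /=; last by lia.
by rewrite (_ : _ - a = i.+1) //; lia.
Qed.

Lemma card_marks n (P : nat -> bool) : cntn n P = #|[set i : 'I_n | P i]|.
Proof.
by rewrite cntnE -sum1_card [RHS]big_mkcond; apply: eq_bigr => i _; rewrite inE; case: (P i).
Qed.

(** The node count read off the word equals [m] only propositionally; [P] carries properties of [C]
    across that equation. *)
Lemma format_complete (P : forall m, circuit m -> Prop) m (C : circuit m) w k :
  w = enc_instance (enc_circuit C) k -> P m C ->
  exists C' : circuit (nodes_of w), [/\ P _ C', well_formatted w & @describes w C'].
Proof.
rewrite /enc_circuit; set y := _ ++ _ ++ _ => hw hP.
have em : nodes_of w = m by rewrite hw nodes_of_instance.
have ek : par_of w = k by rewrite hw par_of_instance.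
have eo : offset w = k.+1 + m.+1 by rewrite /offset em ek.
have bit i : nth false w (offset w + i) = nth false y i by rewrite eo hw nth_offset.
have s1 : size [seq is_and C i | i <- enum 'I_m] = m by rewrite size_map size_enum_ord.
have s2 : size [seq i == out C | i <- enum 'I_m] = m by rewrite size_map size_enum_ord.
have s3 : size [seq wire C i j | i <- enum 'I_m, j <- enum 'I_m] = m * m.
  by rewrite size_allpairs size_enum_ord.
have b1 (i : 'I_m) : and_bit w i = is_and C i.
  by rewrite /and_bit bit nth_cat s1 ltn_ord (nth_map i) ?size_enum_ord // nth_ord_enum.
have b2 (i : 'I_m) : out_mark w i = (i == out C).
  rewrite /out_mark em -addnA bit nth_cat s1 ltnNge leq_addr /= addKn nth_cat s2 ltn_ord.
  by rewrite (nth_map i) ?size_enum_ord // nth_ord_enum.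
have b3 (i j : 'I_m) : wire_bit w i j = wire C i j.
  rewrite /wire_bit em -addnA bit nth_cat s1 ltnNge -!addnA leq_addr /= addKn.
  by rewrite nth_cat s2 ltnNge leq_addr /= addKn nth_allpairs_rel.
have hf : well_formatted w.
  rewrite /well_formatted em card_marks; apply/andP; split.
    rewrite eo {1}hw /enc_instance size_cat /= size_cat /= !size_nseq !size_cat s1 s2 s3.
    by apply/eqP; lia.
  rewrite (_ : [set _ | _] = [set out C]) ?cards1 //.
  by apply/setP => i; rewrite !inE b2.
by subst m; exists C.
Qed.

Lemma format_sound x w k : w = enc_instance x k -> well_formatted w ->
  exists2 C : circuit (nodes_of w), x = enc_circuit C & @describes w C.
Proof.
move=> hw /andP[/eqP hsz]; rewrite card_marks => /cards1P[o ho].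
have otE (i : 'I_(nodes_of w)) : out_mark w i = (i == o).
  by have /setP/(_ i) := ho; rewrite !inE.
have [a [[|b y] [hx hy]]] := leading_ones x.
  (* Without a separating zero the word is too short for its own node count. *)
  exfalso; have em : nodes_of w = a by rewrite hw hx nodes_of_instance.
  move: hsz; rewrite /offset em {1}hw hx cats0 /enc_instance size_cat /= !size_nseq.
  by rewrite hw par_of_instance; lia.
rewrite /= in hy; subst b.
have em : nodes_of w = a by rewrite hw hx nodes_of_instance.
have ek : par_of w = k by rewrite hw par_of_instance.
have eo : offset w = k.+1 + a.+1 by rewrite /offset em ek.
have bit i : nth false w (offset w + i) = nth false y i by rewrite eo hw hx nth_offset.
have sy : size y = nodes_of w + nodes_of w + nodes_of w * nodes_of w.
  move: hsz; rewrite eo {1}hw hx /enc_instance size_cat /= size_cat /= !size_nseq; lia.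
pose C := @Circuit (nodes_of w) (fun i j => wire_bit w i j) (fun i => and_bit w i) o.
exists C => //; rewrite hx /enc_circuit -em; congr (_ ++ _ :: _).
rewrite -[LHS](mkseq_nth false) sy mkseq_add mkseq_add -catA /=.
rewrite (map_enum_ord (and_bit w)) (eq_map (g := fun i => out_mark w (val i))); last first.
  by move=> i; rewrite /= otE.
rewrite (map_enum_ord (out_mark w)) (allpairs_mkseq (wire_bit w)).
congr (_ ++ (_ ++ _)); apply/eq_in_map => i; rewrite mem_iota => hi.
- by rewrite /and_bit bit.
- by rewrite /out_mark -[offset w + _ + _]addnA bit.
- by rewrite /wire_bit -[offset w + _ + _]addnA bit -divn_eq.
Qed.

Section Reduction.
Variable d : nat.
(** The power is the number of slots that determine a node of depth d; the 2 serves to compare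
    consecutive slots. *)
Definition qd : nat := 2 ^ d + 2.
(** By [card_top], enough for one guess per gate that may need a witness. *)
Definition Qd : nat := 2 ^ d.+1.

Definition w_valid (w : seq bool) : bool :=
  well_formatted w && well_shaped (nodes_of w) d (wire_bit w) (out_mark w).
Definition w_forb (w : seq bool) : nat -> nat -> nat -> nat -> bool :=
  forbidden (nodes_of w) (par_of w) d qd Qd (w_valid w) (wire_bit w) (and_bit w) (out_mark w).
Definition w_N (w : seq bool) : nat := nvars (par_of w) qd Qd.
Definition w_D (w : seq bool) : nat := dom_size (nodes_of w) qd Qd.
Definition w_nv (w : seq bool) : nat := nvert (w_N w) (w_D w) (nodes_of w).
Definition w_soft (w : seq bool) := soft (w_N w) (w_D w) (nodes_of w).
Definition w_hard (w : seq bool) := hard (w_N w) (w_D w) (nodes_of w) (w_forb w) (wire_bit w).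
Definition w_req (w : seq bool) := req (w_N w) (w_D w) (nodes_of w) (w_forb w) (wire_bit w).
Definition w_arcs (w : seq bool) := arcs_of (w_nv w) (4 * w_N w) (w_soft w) (w_hard w).
Definition w_reqs (w : seq bool) := reqs_of (w_nv w) (4 * w_N w) (w_req w).

Lemma reduction_correct x k : let w := enc_instance x k in
  WCS 1 d x k <->
  directed_symmetric_multicut (enc_requests (w_arcs w) (w_reqs w)) (4 * w_N w).
Proof.
move=> w; have ek : par_of w = k by apply: par_of_instance.
rewrite dsm_encoded; [|exact: arcs_of_irr|by move=> p; apply: reqs_of_card].
rewrite hard_arcsP gadgetP; last by rewrite /w_N /nvars addnS addSn.
have q2 : 2 <= qd by rewrite /qd leq_addl.
have hq : 2 ^ d <= qd by rewrite /qd leq_addr.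
split=> [[m [C [hx hwf hwe hde hsat]]]|[hac [f [h hcsp]]]].
  have [C' [[{}hwf {}hwe {}hde {}hsat] hfm [wrE anE otE]]] :=
    format_complete (P := fun m C => [/\ wf_circuit C, weft_le C 1, depth_le C d &
      weighted_sat C k]) (congr1 (fun y => enc_instance y k) hx) (And4 hwf hwe hde hsat).
  rewrite -/w in C' hwf hwe hde hsat hfm wrE anE otE.
  have hsh : shallow C' d by apply/(shallowP d hwf.1); split.
  have [h1 h2] := (well_shapedP wrE otE d).2 (conj hwf hsh).
  split=> //; have [v [hv vout vcard]] := hsat.
  apply: (@views_csp _ _ _ _ _ _ _ _ _
    (views_of C' (wire_bit w) (and_bit w) (out_mark w) k d v)).
  - by apply: leq_trans q2.
  - by rewrite /w_valid hfm.
  - exact: (views_of_lt _ _ _ _ vcard).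
  - rewrite ek => sl ex hc; exact: (view_not_bad wrE anE otE vcard (leqnn Qd) hsh hv vout hc).
have [hval hviews] := csp_views hcsp.
have [hfm hws] := andP hval.
have [C hx [wrE anE otE]] := format_sound (erefl w) hfm.
(* Acyclicity comes from the multicut, the other syntactic conditions from the validity bit. *)
have [hwf hsh] := (well_shapedP wrE otE d).1 (conj hac hws).
have [hwe hde] := (shallowP d hwf.1).2 hsh.
exists (nodes_of w), C; split=> //.
rewrite ek in hviews; exact: (weighted_sat_of_views wrE anE otE q2 hq hsh hwf.1 hviews).
Qed.
End Reduction.

(** * Definability of the reduction *)

(** Redefined as more functions become definable, so that [define] treats them as primitives. *)
Ltac define_hook := fail.

(* Dispatching on the head symbol avoids unification problems that unfold the
   functions under consideration. *)
Ltac define_step := cbv beta zeta; first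
  [ assumption
  | lazymatch goal with
    | |- definable _ => refine (definable_const _)
    | |- decidable_rel _ => refine (decidable_const _)
    end
  | lazymatch goal with
    | |- definable (fun w e => head 0 e) => refine definable_head
    | |- definable (fun w e => head 0 (behead (@?X e))) =>
        refine (@definable_behead (fun w e => head 0 (X e)) _)
    | |- definable (fun w e => ?f w (behead (@?X e))) =>
        refine (@definable_behead (fun w e => f w (X e)) _)
    | |- definable (fun w e => size w) => refine definable_size
    | |- definable (fun w e => addn (@?F w e) (@?G w e)) => refine (@definable_add F G _ _)
    | |- definable (fun w e => subn (@?F w e) (@?G w e)) => refine (@definable_sub F G _ _)
    | |- definable (fun w e => muln (@?F w e) (@?G w e)) => refine (@definable_mul F G _ _)
    | |- definable (fun w e => expn (@?F w e) ?n) => refine (@definable_expn F n _)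
    | |- definable (fun w e => divn (@?F w e) (@?G w e)) => refine (@definable_divn F G _ _)
    | |- definable (fun w e => modn (@?F w e) (@?G w e)) => refine (@definable_modn F G _ _)
    | |- definable (fun w e => S (@?F w e)) => refine (@definable_succ F _)
    | |- definable (fun w e => cntn (@?F w e) (@?P w e)) => refine (@definable_cntn F P _ _)
    | |- definable (fun w e => nat_of_bool (@?P w e)) => change (decidable_rel P)
    | |- decidable_rel (fun w e => nth false w (@?F w e)) => refine (@decidable_bit F _)
    | |- decidable_rel (fun w e => negb (@?P w e)) => refine (@decidable_not P _)
    | |- decidable_rel (fun w e => andb (@?P w e) (@?Q w e)) => refine (@decidable_and P Q _ _)
    | |- decidable_rel (fun w e => orb (@?P w e) (@?Q w e)) => refine (@decidable_or P Q _ _)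
    | |- decidable_rel (fun w e => implb (@?P w e) (@?Q w e)) =>
        refine (@decidable_imply P Q _ _)
    | |- decidable_rel (fun w e => addb (@?P w e) (@?Q w e)) => refine (@decidable_addb P Q _ _)
    | |- decidable_rel (fun w e => leq (@?F w e) (@?G w e)) => refine (@decidable_leq F G _ _)
    | |- decidable_rel (fun w e => @eq_op _ (@?F w e) (@?G w e)) =>
        first [refine (@decidable_eqn F G _ _) | refine (@decidable_eqb F G _ _)]
    | |- decidable_rel (fun w e => exn (@?F w e) (@?P w e)) => refine (@decidable_exn F P _ _)
    | |- decidable_rel (fun w e => alln (@?F w e) (@?P w e)) => refine (@decidable_alln F P _ _)
    end
  | define_hook
  | match goal with H : forall p : nat, definable _ |- _ => exact (H _) end
  | lazymatch goal with
    | |- decidable_rel (fun w e => has _ ?s) => refine (@decidable_has s _ _); intro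
    | |- definable _ => refine (definable_if _ _ _)
    | |- decidable_rel _ => refine (decidable_if _ _ _)
    end ].

Ltac define := repeat define_step.

Lemma definable_ones S : definable S -> definable (fun w e => ones w (S w e)).
Proof. by move=> hS; rewrite /ones; define. Qed.

Lemma definable_par : definable (fun w e => par_of w).
Proof. exact: (definable_ones (definable_const 0)). Qed.

Lemma definable_nodes : definable (fun w e => nodes_of w).
Proof. exact: (definable_ones (definable_succ definable_par)). Qed.

Ltac define_hook ::= first [refine definable_par | refine definable_nodes].

Lemma definable_offset : definable (fun w e => offset w).
Proof. by rewrite /offset; define. Qed.

Ltac define_hook ::= first
  [refine definable_par | refine definable_nodes | refine definable_offset].

Lemma decidable_and_bit I : definable I -> decidable_rel (fun w e => and_bit w (I w e)).
Proof. by move=> hI; rewrite /and_bit; define. Qed.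

Lemma decidable_out_mark I : definable I -> decidable_rel (fun w e => out_mark w (I w e)).
Proof. by move=> hI; rewrite /out_mark; define. Qed.

Lemma decidable_wire_bit I J : definable I -> definable J ->
  decidable_rel (fun w e => wire_bit w (I w e) (J w e)).
Proof. by move=> hI hJ; rewrite /wire_bit; define. Qed.

Ltac define_hook ::= first
  [refine definable_par | refine definable_nodes | refine definable_offset
  |refine (decidable_and_bit _) | refine (decidable_out_mark _)
  |refine (decidable_wire_bit _ _)].

Lemma decidable_well_formatted : decidable_rel (fun w e => well_formatted w).
Proof. by rewrite /well_formatted; define. Qed.

Lemma definable_fan U : definable U ->
  definable (fun w e => fan (nodes_of w) (wire_bit w) (U w e)).
Proof. by move=> hU; rewrite /fan; define. Qed.

Lemma decidable_bigfan U : definable U ->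
  decidable_rel (fun w e => bigfan (nodes_of w) (wire_bit w) (U w e)).
Proof.
move=> hU; rewrite /bigfan; apply: decidable_ltn; first exact: definable_const.
exact: definable_fan.
Qed.

Ltac define_hook ::= first
  [refine definable_par | refine definable_nodes | refine definable_offset
  |refine (decidable_and_bit _) | refine (decidable_out_mark _)
  |refine (decidable_wire_bit _ _)
  |refine (definable_fan _) | refine (decidable_bigfan _) ].

Lemma decidable_heavy l c U : definable U ->
  decidable_rel (fun w e => heavy (nodes_of w) (wire_bit w) (out_mark w) l c (U w e)).
Proof.
elim: l c U => [|l IH] c U hU /=; first by define.
by define; apply: IH; define.
Qed.

Lemma decidable_top l U : definable U ->
  decidable_rel (fun w e => top (nodes_of w) (wire_bit w) (out_mark w) l (U w e)).
Proof.
elim: l U => [|l IH] U hU /=; first by define.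
by define; apply: IH; define.
Qed.

Ltac define_hook ::= first
  [refine definable_par | refine definable_nodes | refine definable_offset
  |refine (decidable_and_bit _) | refine (decidable_out_mark _)
  |refine (decidable_wire_bit _ _)
  |refine (definable_fan _) | refine (decidable_bigfan _)
  |refine (decidable_heavy _ _ _)  | refine (decidable_top _ _) ].

Lemma decidable_well_shaped d : decidable_rel (fun w e =>
  well_shaped (nodes_of w) d (wire_bit w) (out_mark w)).
Proof. by rewrite /well_shaped; define. Qed.

Lemma decidable_toprel d U : definable U ->
  decidable_rel (fun w e => toprel (nodes_of w) d (wire_bit w) (out_mark w) (U w e)).
Proof. by move=> hU; rewrite /toprel; define. Qed.

Lemma definable_digit B V p : definable B -> definable V ->
  definable (fun w e => digit (B w e) (V w e) p).
Proof. by move=> hB hV; rewrite /digit; define. Qed.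

Section Views.
Variables (k d q Q : nat).

(** Positions in a view are fixed numbers, not variables of a term, so [EX] supplies one definable
    function per position. *)
Lemma decidable_listed EX G c : (forall p : nat, definable (EX p)) -> definable G ->
  definable c -> decidable_rel (fun w e =>
    listed (nodes_of w) q Q (fun p => EX p w e) (G w e) (c w e)).
Proof. by move=> hE hG hc; rewrite /listed /xval /yval; define. Qed.

Lemma decidable_witnessed EX G : (forall p : nat, definable (EX p)) -> definable G ->
  decidable_rel (fun w e =>
    witnessed (nodes_of w) q Q (wire_bit w) (fun p => EX p w e) (G w e)).
Proof.
move=> hE hG; rewrite /witnessed; define.
apply: (decidable_listed (EX := fun p w e => EX p w (behead e))); last by define.
  by move=> p; define.
by define.
Qed.

Lemma decidable_claim EX G : (forall p : nat, definable (EX p)) -> definable G ->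
  decidable_rel (fun w e =>
    claim (nodes_of w) q Q (wire_bit w) (and_bit w) (fun p => EX p w e) (G w e)).
Proof.
by move=> hE hG; rewrite /claim; define; apply: decidable_witnessed.
Qed.

Lemma decidable_forced SL EX U l b :
  (forall p : nat, definable (SL p)) -> (forall p : nat, definable (EX p)) -> definable U ->
  decidable_rel (fun w e => forced (nodes_of w) q Q (wire_bit w) (and_bit w)
    (fun p => SL p w e) (fun p => EX p w e) l b (U w e)).
Proof.
elim: l b SL EX U => [|l IH] b SL EX U hS hE hU /=; first exact: decidable_const.
have IH' b' : decidable_rel (fun w e => forced (nodes_of w) q Q (wire_bit w) (and_bit w)
    (fun p => SL p w (behead e)) (fun p => EX p w (behead e)) l b' (head 0 e)).
  apply: (IH b' (fun p w e => SL p w (behead e)) (fun p w e => EX p w (behead e))).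
  - by move=> p; define.
  - by move=> p; define.
  - by define.
have h1 := IH' b; have h2 := IH' (~~ b).
apply: decidable_if; first by define.
  by case: b {IH' h1 h2}; rewrite /known_true /known_false /xval /yval; define.
apply: decidable_if; [by define | by define |].
apply: decidable_if; [by define | by apply: decidable_if; define |].
by apply: decidable_eqb; [apply: decidable_claim | define].
Qed.

Lemma decidable_bad_gate SL EX G c :
  (forall p : nat, definable (SL p)) -> (forall p : nat, definable (EX p)) ->
  definable G -> definable c ->
  decidable_rel (fun w e => bad_gate (nodes_of w) d q Q (wire_bit w) (and_bit w)
    (out_mark w) (fun p => SL p w e) (fun p => EX p w e) (G w e) (c w e)).
Proof.
move=> hS hE hG hc; rewrite /bad_gate.
apply: decidable_and; first by define.
apply: decidable_and; first by define.
apply: decidable_and; first exact: decidable_toprel.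
apply: decidable_and.
  by apply: decidable_imply; [apply: decidable_witnessed | apply: decidable_listed].
(* The value to be refuted depends on the word, whereas [decidable_forced] has a fixed Boolean;
   hence the case distinction on the claim. *)
have hf b : decidable_rel (fun w e => forced (nodes_of w) q Q (wire_bit w) (and_bit w)
    (fun p => SL p w e) (fun p => EX p w e) d.+1 b (c w e)) by apply: decidable_forced.
apply: definable_ext (decidable_if (decidable_claim hE hG) (hf false) (hf true)) _.
by move=> w e; case: (claim _ _ _ _ _ _ _).
Qed.

Lemma decidable_bad SL EX :
  (forall p : nat, definable (SL p)) -> (forall p : nat, definable (EX p)) ->
  decidable_rel (fun w e => bad (nodes_of w) (par_of w) d q Q (wire_bit w) (and_bit w)
    (out_mark w) (fun p => SL p w e) (fun p => EX p w e)).
Proof.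
move=> hS hE; rewrite /bad.
apply: decidable_or; first by rewrite /bad_slot /xval /yval; define.
apply: decidable_or; first by rewrite /bad_link /xval /yval; define.
apply: decidable_or; apply: decidable_exn; try by define.
  apply: decidable_and; first by define.
  apply: (decidable_forced (SL := fun p w e => SL p w (behead e))
    (EX := fun p w e => EX p w (behead e))); try move=> p; by define.
apply: decidable_exn; first by define.
apply: (decidable_bad_gate (SL := fun p w e => SL p w (behead (behead e)))
    (EX := fun p w e => EX p w (behead (behead e)))); try move=> p; by define.
Qed.
End Views.

Section Graph.
Variable d : nat.

Lemma decidable_valid : decidable_rel (fun w e => w_valid d w).
Proof.
apply: decidable_and; [exact: decidable_well_formatted | exact: decidable_well_shaped].
Qed.

Lemma decidable_forb I A J B : definable I -> definable A -> definable J -> definable B ->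
  decidable_rel (fun w e => w_forb d w (I w e) (A w e) (J w e) (B w e)).
Proof.
move=> hI hA hJ hB; rewrite /w_forb /forbidden.
have hS p : definable (fun w e => digit (par_of w).+1 (J w e) p).
  by apply: definable_digit; define.
have hE p : definable (fun w e => digit (entry_base (nodes_of w)) (B w e) p).
  by apply: definable_digit; rewrite ?/entry_base; define.
apply: decidable_or; first by apply: decidable_not; apply: decidable_valid.
apply: decidable_or; last exact: decidable_bad.
apply: decidable_has => p; rewrite /row_of; case: (p < _); by define.
Qed.

Lemma definable_N : definable (fun w e => w_N d w).
Proof. by rewrite /w_N /nvars; define. Qed.

Lemma definable_D : definable (fun w e => w_D d w).
Proof. by rewrite /w_D /dom_size /entry_base; define. Qed.

Ltac define_hook ::= first
  [refine definable_par | refine definable_nodes | refine definable_N | refine definable_D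
  |refine (decidable_wire_bit _ _) | refine (decidable_forb _ _ _ _) ].

Lemma definable_code G I J A B : definable G -> definable I -> definable J ->
  definable A -> definable B ->
  definable (fun w e => code (w_N d w) (w_D d w) (nodes_of w)
    (G w e) (I w e) (J w e) (A w e) (B w e)).
Proof. by move=> *; rewrite /code /= /vbase; define. Qed.

Ltac define_hook ::= first
  [refine definable_par | refine definable_nodes | refine definable_N | refine definable_D
  |refine (decidable_wire_bit _ _) | refine (decidable_forb _ _ _ _)
  |refine (definable_code _ _ _ _ _) ].

Lemma decidable_soft U V : definable U -> definable V ->
  decidable_rel (fun w e => w_soft d w (U w e) (V w e)).
Proof. by move=> hU hV; rewrite /w_soft /soft /chn; define. Qed.

Lemma decidable_circuit_arc U V : definable U -> definable V ->
  decidable_rel (fun w e => circuit_arc (w_N d w) (w_D d w) (nodes_of w) (wire_bit w)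
    (U w e) (V w e)).
Proof. by move=> hU hV; rewrite /circuit_arc /nd; define. Qed.

Lemma decidable_hard U V : definable U -> definable V ->
  decidable_rel (fun w e => w_hard d w (U w e) (V w e)).
Proof.
move=> hU hV; rewrite /w_hard /hard; apply: decidable_or.
  by rewrite /hard_chain /chn /hub; define.
apply: decidable_or; last exact: decidable_circuit_arc.
by rewrite /hard_forb /chn /sv /tv; define.
Qed.

Lemma decidable_req U V : definable U -> definable V ->
  decidable_rel (fun w e => w_req d w (U w e) (V w e)).
Proof.
move=> hU hV; rewrite /w_req /req; apply: decidable_or.
  by rewrite /req_hub /hub; define.
apply: decidable_or; first by rewrite /req_chain /chn; define.
apply: decidable_or; last exact: decidable_circuit_arc.
by rewrite /req_forb /sv /tv; define.
Qed.

Lemma definable_nv : definable (fun w e => w_nv d w).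
Proof. by rewrite /w_nv /nvert /vbase; define. Qed.

Ltac define_hook ::= first
  [refine definable_N | refine definable_nv | refine (decidable_soft _ _)
  |refine (decidable_hard _ _) | refine (decidable_req _ _)].

Definition w_arc (w : seq bool) := arc_of (w_nv d w) (4 * w_N d w) (w_soft d w) (w_hard d w).
Definition w_rq (w : seq bool) := req_of (w_nv d w) (w_req d w).
Definition w_n (w : seq bool) := w_nv d w + nhard (w_nv d w) (4 * w_N d w).

Lemma definable_n : definable (fun w e => w_n w).
Proof. by rewrite /w_n /nhard; define. Qed.

Lemma decidable_arc U V : definable U -> definable V ->
  decidable_rel (fun w e => w_arc w (U w e) (V w e)).
Proof. by move=> hU hV; rewrite /w_arc /arc_of /hard_pair; define. Qed.

Lemma decidable_rq U V : definable U -> definable V ->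
  decidable_rel (fun w e => w_rq w (U w e) (V w e)).
Proof. by move=> hU hV; rewrite /w_rq /req_of; define. Qed.

Ltac define_hook ::= first
  [refine definable_N | refine definable_n | refine (decidable_arc _ _)
  |refine (decidable_rq _ _)].

Lemma definable_out_size : definable (fun w e => out_size (4 * w_N d w) (w_n w)).
Proof. by rewrite /out_size; define. Qed.

Lemma decidable_out_bit : decidable_rel (fun w e =>
  out_bit (4 * w_N d w) (w_n w) (w_arc w) (w_rq w) (head 0 e)).
Proof. by rewrite /out_bit; define. Qed.

Lemma reduction_word w :
  mkseq (out_bit (4 * w_N d w) (w_n w) (w_arc w) (w_rq w)) (out_size (4 * w_N d w) (w_n w)) =
  enc_instance (enc_requests (w_arcs d w) (w_reqs d w)) (4 * w_N d w).
Proof.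
apply: out_word => i j; first by rewrite inE.
exact: mem_reqs_of.
Qed.
End Graph.

(** A unary number is read as the length of a word, and a term then writes a word of ones. *)
Lemma computable_comp (F f : nat -> nat) : definable (fun w e => F (size w)) ->
  computable f -> computable (fun k => F (f k)).
Proof.
move=> [t ht] [M hM]; have [M' [c hM']] := term_machine M t TOne.
exists M' => k; have [T hT] := hM k.
have e : word_of t TOne (nseq (f k) true) = nseq (F (f k)) true.
  by rewrite /word_of ht size_nseq [RHS]nseq_mkseq.
by eexists; rewrite -e; apply: hM' hT.
Qed.

Theorem theorem8 : W_hard 1 directed_symmetric_multicut.
Proof.
move=> L [d [_ [M [f [g [c [cf cg hM]]]]]]].
have [tL hL] := definable_out_size d; have [tB hB] := decidable_out_bit d.
have [M' [c' hM']] := term_machine M tL tB.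
(* For an input of size n >= 1 one has f k n^c + n + 2 <= (f k + 3) n^(c+1); the parameter bound
   uses that [nvars] grows with its first argument. *)
exists M', (fun k => (f k + 3) ^ c'), (fun k => 4 * nvars (g k) (qd d) (Qd d)), (c.+1 * c').
split.
- apply: (@computable_comp (fun n => (n + 3) ^ c')) cf.
  by apply: definable_expn; apply: definable_add; [apply: definable_size | apply: definable_const].
- apply: (@computable_comp (fun n => 4 * nvars n (qd d) (Qd d))) cg.
  by rewrite /nvars; define.
move=> x k; have [x1 [k1 [hout hL1 hk1]]] := hM x k.
set w1 := enc_instance x1 k1 in hout.
exists (enc_requests (w_arcs d w1) (w_reqs d w1)), (4 * w_N d w1); split.
- have := hM' _ _ _ hout; set n := size _.
  have -> : word_of tL tB w1 = enc_instance (enc_requests (w_arcs d w1) (w_reqs d w1)) (4 * w_N d w1).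
    rewrite -reduction_word /word_of hL; apply: eq_map => i.
    by rewrite hB lt0b.
  apply: outputs_within_le; rewrite expnM -expnMn.
  case: c' {hM'} => // c'; rewrite leq_exp2r // expnS.
  have n0 : 0 < n by rewrite /n size_cat addnS.
  by have := expn_gt0 n c; rewrite n0; nia.
- by rewrite hL1; apply: reduction_correct.
- rewrite leq_mul2l /= /w_N /nvars par_of_instance leq_add2r leq_add //.
  by rewrite leq_exp2r // /qd addn2.
Qed.
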